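(* Let $0<p<1$ and $\beta\in(1/2,1)$ with $p-2+2\beta>0$, and let $f\in BMO^{\beta}(\mathbb{T})$. Then the following conditions are equivalent: (1) $f\in Q_{p}^{\beta}(\mathbb{T})$; (2) $$\sup_{I\subset\mathbb{T}}|I|^{2\beta-p-2}\int_{0}^{|I|}\left(\int_{I}|f(e^{i(s+t)})-f(e^{is})|^{2}\,ds\right)\frac{dt}{t^{4-p-2\beta}}<\infty,$$ where the supremum is taken over all arcs $I\subset\mathbb{T}$; (3) $|\nabla\hat{f}(z)|^{2}(1-|z|^{2})^{p-2+2\beta}\,dA(z)$ is a $(p+2-2\beta)$-Carleson measure on $\mathbb{D}$.
   Context: $\mathbb{D}$ is the open unit disc and $\mathbb{T}$ the unit circle in $\mathbb{C}$; $dA=\frac1\pi dx\,dy$ is normalized area measure on $\mathbb{D}$. For an arc $I\subset\mathbb{T}$, $|I|=\int_I\frac{|d\zeta|}{2\pi}$ is its normalized length and $f_I=|I|^{-1}\int_I f(\zeta)\frac{|d\zeta|}{2\pi}$. An integral $\int_I\cdots ds$ is over those $s$ (modulo $2\pi$) with $e^{is}\in I$. $BMO^{\beta}(\mathbb{T})$ is the space of $f\in L^2(\mathbb{T})$ with $\sup_{I\subset\mathbb{T}}|I|^{4\beta-5}\int_I|f(e^{is})-f_I|^2ds<\infty$, the supremum being over all arcs $I\subset\mathbb{T}$. $Q_p^\beta(\mathbb{T})$ is the space of $f\in L^2(\mathbb{T})$ with $$\sup_{I\subset\mathbb{T}}|I|^{2\beta-2-p}\int_I\int_I\frac{|f(\zeta)-f(\eta)|^2}{|\zeta-\eta|^{4-p-2\beta}}|d\zeta||d\eta|<\infty,$$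 the supremum being over all arcs $I\subset\mathbb{T}$. $\hat f$ is the Poisson extension: $\hat f(z)=\int_{\mathbb{T}}f(\zeta)\frac{1-|z|^2}{|\zeta-z|^2}\frac{|d\zeta|}{2\pi}$ for $z\in\mathbb{D}$. $\nabla=(2\partial/\partial z,2\partial/\partial\bar z)$ is the gradient vector. For an arc $I\subset\mathbb{T}$, the Carleson box is $S(I)=\{z\in\mathbb{D}:1-|I|\le|z|<1,\ z/|z|\in I\}$. For $0<s<\infty$, a positive Borel measure $\mu$ on $\mathbb{D}$ is an $s$-Carleson measure if $\sup_{I\subset\mathbb{T}}\mu(S(I))/|I|^s<\infty$. *)

(* Defs.v *)
From HB Require Import structures.
From mathcomp Require Import all_boot all_order all_algebra.
From mathcomp Require Import complex.
From mathcomp Require Import all_classical all_reals all_analysis.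

Set Implicit Arguments.
Unset Strict Implicit.
Unset Printing Implicit Defensive.
Import Order.TTheory GRing.Theory Num.Theory.
Import numFieldNormedType.Exports.

Local Open Scope classical_set_scope.
Local Open Scope ring_scope.
Local Open Scope complex_scope.

(* The modulus as an element of R (the norm `|z| of R[i] has values in R[i]). *)
Definition cabs (R : realType) (z : R[i]) : R := Normc.normc z.

Definition cis (R : realType) (s : R) : R[i] := cos s +i* sin s.

Definition circle (R : realType) : set R[i] := [set z | cabs z = 1].

(* Arcs are nondegenerate, with either kind of endpoint (x and y choose between
   open and closed); the whole circle is an arc. *)
Definition is_arc (R : realType) (I : set R[i]) : Prop :=
  exists (a b : R) (x y : bool),
    [/\ a < b, b <= a + 2 * pi
      & I = @cis R @` [set` Interval (BSide x a) (BSide y b)]].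

(* The parameters s modulo 2 * pi such that cis s lies in I. An integral over
   I with respect to |dzeta| or ds is a Lebesgue integral over this set. *)
Definition params (R : realType) (I : set R[i]) : set R :=
  [set s | 0 <= s < 2 * pi /\ I (cis s)].

Definition arc_length (R : realType) (I : set R[i]) : R :=
  fine (@lebesgue_measure R (params I)) / (2 * pi).

(* Complex-valued integral over I with respect to |dzeta| / (2 * pi). *)
Definition arc_integral (R : realType) (I : set R[i]) (g : R[i] -> R[i])
    : R[i] :=
  ((\int[@lebesgue_measure R]_(s in params I) complex.Re (g (cis s))) +i*
   (\int[@lebesgue_measure R]_(s in params I) complex.Im (g (cis s))))
  / (2 * pi)%:C.

Definition arc_mean (R : realType) (f : R[i] -> R[i]) (I : set R[i]) : R[i] :=
  arc_integral I f / (arc_length I)%:C.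

(* A function on the circle is represented by a function on R[i] whose values
   off the circle are irrelevant. *)
Definition L2_circle (R : realType) (f : R[i] -> R[i]) : Prop :=
  [/\ measurable_fun [set: R] (fun s : R => complex.Re (f (cis s))),
      measurable_fun [set: R] (fun s : R => complex.Im (f (cis s)))
    & (\int[@lebesgue_measure R]_(s in params (@circle R))
         ((cabs (f (cis s)) ^+ 2)%:E) < +oo)%E].

Definition sup_arcs (R : realType) (Phi : set R[i] -> \bar R) : \bar R :=
  ereal_sup [set Phi I | I in @is_arc R].

Definition BMO (R : realType) (beta : R) (f : R[i] -> R[i]) : Prop :=
  L2_circle f /\
  (sup_arcs (fun I : set R[i] =>
     (arc_length I `^ (4 * beta - 5))%:E *
     \int[@lebesgue_measure R]_(s in params I)
       ((cabs (f (cis s) - arc_mean f I) ^+ 2)%:E)) < +oo)%E.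

(* On the diagonal the integrand takes the value 0 ^+ 2 / 0 = 0. *)
Definition Qspace (R : realType) (p beta : R) (f : R[i] -> R[i]) : Prop :=
  L2_circle f /\
  (sup_arcs (fun I : set R[i] =>
     (arc_length I `^ (2 * beta - 2 - p))%:E *
     \int[@lebesgue_measure R]_(s in params I)
       \int[@lebesgue_measure R]_(t in params I)
         ((cabs (f (cis s) - f (cis t)) ^+ 2 /
           cabs (cis s - cis t) `^ (4 - p - 2 * beta))%:E)) < +oo)%E.

Definition translation_condition (R : realType) (p beta : R)
    (f : R[i] -> R[i]) : Prop :=
  (sup_arcs (fun I : set R[i] =>
     (arc_length I `^ (2 * beta - p - 2))%:E *
     \int[@lebesgue_measure R]_(t in `]0%R, arc_length I])
       ((\int[@lebesgue_measure R]_(s in params I)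
           ((cabs (f (cis (s + t)) - f (cis s)) ^+ 2)%:E)) *
        ((t `^ (4 - p - 2 * beta))^-1)%:E)) < +oo)%E.

Definition poisson (R : realType) (f : R[i] -> R[i]) (z : R[i]) : R[i] :=
  arc_integral (@circle R)
    (fun zeta => f zeta * ((1 - cabs z ^+ 2) / cabs (zeta - z) ^+ 2)%:C).

(* Derivative of F at z in the real direction v. *)
Definition cpartial (R : realType) (v : R[i]) (F : R[i] -> R[i]) (z : R[i])
    : R[i] :=
  (derive1 (fun t : R => complex.Re (F (z + t%:C * v))) 0) +i*
  (derive1 (fun t : R => complex.Im (F (z + t%:C * v))) 0).

Definition d_dz (R : realType) (F : R[i] -> R[i]) (z : R[i]) : R[i] :=
  (cpartial 1 F z - 'i%C * cpartial 'i%C F z) / 2.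

Definition d_dzbar (R : realType) (F : R[i] -> R[i]) (z : R[i]) : R[i] :=
  (cpartial 1 F z + 'i%C * cpartial 'i%C F z) / 2.

Definition grad_sq (R : realType) (F : R[i] -> R[i]) (z : R[i]) : R :=
  cabs (2 * d_dz F z) ^+ 2 + cabs (2 * d_dzbar F z) ^+ 2.

(* Measures on the complex plane live on R * R, which carries the product
   sigma-algebra. *)
Definition pt (R : realType) (w : R * R) : R[i] := w.1 +i* w.2.

Definition disc (R : realType) : set R[i] := [set z | cabs z < 1].

Lemma inv_pi_ge0 (R : realType) : 0 <= (pi : R)^-1.
Proof. by rewrite invr_ge0 pi_ge0. Qed.

(* dA = dx dy / pi. *)
Definition area (R : realType)
    : {measure set (measurableTypeR R * measurableTypeR R) -> \bar R} :=
  mscale (NngNum (inv_pi_ge0 R))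
    (@lebesgue_measure R \x @lebesgue_measure R)%E.

Definition carleson_box (R : realType) (I : set R[i]) : set R[i] :=
  [set z | [/\ disc z, 1 - arc_length I <= cabs z & I (z / (cabs z)%:C)]].

Definition is_carleson (R : realType) (s : R)
    (mu : {measure set (measurableTypeR R * measurableTypeR R) -> \bar R})
    : Prop :=
  (sup_arcs (fun I : set R[i] =>
     mu (@pt R @^-1` carleson_box I) * ((arc_length I `^ s)^-1)%:E) < +oo)%E.

(* mu = h dA on the disc, and mu vanishes off the disc. *)
Definition has_density (R : realType)
    (mu : {measure set (measurableTypeR R * measurableTypeR R) -> \bar R})
    (h : R[i] -> R) : Prop :=
  forall A : set (measurableTypeR R * measurableTypeR R), measurable A ->
    mu A = (\int[area R]_(w in A `&` @pt R @^-1` @disc R) ((h (pt w))%:E))%E.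

(* Main.v *)
(** Put [al = 2 - 2 beta] and [sg = p - 2 + 2 beta]. By Campanato's argument a
    function in BMO^beta agrees almost everywhere with a function that is
    Hoelder continuous of order [al], so one works with a continuous
    2 pi-periodic representative [u]; the three conditions are quadratic and
    split into real and imaginary parts.

    (1) <=> (2): substitute [t - s] for [t]. The chord is comparable with the
    angle on [-pi, pi], and pairs of points at distance comparable with the
    length of the arc are controlled by the Hoelder bound.

    (2) => (3): the gradient of the Poisson kernel has mean zero and size
    [2 / |zeta - z|^2], so by Cauchy-Schwarz the squared gradient of the
    extension at depth [h] is at most a constant times
    [1/h * \int (u (s + t) - u s)^2 / (h^2 + t^2) dt] over a short interval,
    up to a Hoelder tail, and
    [\int h^(sg - 1) / (h^2 + t^2) dh <= C t^(sg - 2)].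

    (3) => (2): the increment [u (s + t) - u s] is bounded by the integral of
    the gradient along the path going radially inwards to depth [t], then
    along the circle of radius [1 - t], then radially outwards. The radial
    pieces are handled by a Hardy inequality, in which [h^b] with
    [sg < b < 1] is inserted into Cauchy-Schwarz.

    In polar coordinates the Carleson boxes become rectangles. *)

From HB Require Import structures.
Require Import Defs.
From mathcomp Require Import all_boot all_order all_algebra.
From mathcomp Require Import complex ring lra.
From mathcomp Require Import all_classical all_reals all_analysis.
From mathcomp Require Import measurable_realfun.
Import Order.TTheory GRing.Theory Num.Theory.
Import numFieldNormedType.Exports.
Set Implicit Arguments.
Unset Strict Implicit.
Unset Printing Implicit Defensive.
Local Open Scope classical_set_scope.
Local Open Scope ring_scope.

(** * Integration on the line *)

(** With [L = 2 pi |I|] the exponents read [4 beta - 5 = -(1 + 2 al)],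
    [2 beta - 2 - p = -(sg + 2 al)] and [p + 2 - 2 beta = sg + 2 al]. Each of the three conditions
    thus asks for a double integral of size [O(L^(sg + 2 al))], uniformly over the arcs of angle
    [L]. The Hoelder bound leaves errors of exactly this size: pairs at distance comparable with [L]
    contribute [L^(2 al) * L^(sg - 2) * L * L], and the part of the gradient that comes from beyond
    distance [rho] is [O(rho^(al - 1))], a convergent tail because [beta > 1/2] gives [al < 1]. In
    (2) the shift [t] runs only up to [|I| = L / (2 pi) <= L / 4], but [s + t] may leave the arc.
    Since the bounds do not depend on the position of the arc, an adjacent arc of the same length
    can be added at the price of a constant factor. The estimates concern nonnegative integrands
    with integrals in the extended reals, so that Tonelli and monotonicity apply before anything is
    known to be finite. *)

Lemma eq_leW d (T : porderType d) (x y : T) : x = y -> (x <= y)%O.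
Proof. by move->. Qed.

Lemma measurable_section1 d1 d2 d3 (T1 : measurableType d1) (T2 : measurableType d2)
    (T3 : measurableType d3) (x : T1) (f : T1 * T2 -> T3) :
  measurable_fun setT f -> measurable_fun setT (fun y => f (x, y)).
Proof. by move=> mf; apply: (measurableT_comp mf); exact: measurable_pair1. Qed.

Lemma measurable_section2 d1 d2 d3 (T1 : measurableType d1) (T2 : measurableType d2)
    (T3 : measurableType d3) (y : T2) (f : T1 * T2 -> T3) :
  measurable_fun setT f -> measurable_fun setT (fun x => f (x, y)).
Proof. by move=> mf; apply: (measurableT_comp mf); exact: measurable_pair2. Qed.

Section integral_tools.
Context {R : realType}.
Notation mu := (@lebesgue_measure R).
Local Open Scope ereal_scope.

(** The integral of a nonnegative function is a supremum over the simple functions below it, hence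
    monotone without any measurability. *)
Lemma ge0_le_integral_nomeas d (T : measurableType d)
    (m : {measure set T -> \bar R}) (D : set T) (f g : T -> \bar R) :
  (forall x, D x -> 0 <= f x) -> (forall x, D x -> f x <= g x) ->
  \int[m]_(x in D) f x <= \int[m]_(x in D) g x.
Proof.
move=> f0 fg.
have g0 x : D x -> 0 <= g x by move=> Dx; exact: le_trans (f0 _ Dx) (fg _ Dx).
rewrite !ge0_integralE//; apply: ereal_sup_le => _ [h hf <-].
exists h => // x.
apply: le_trans (hf x) _; rewrite !patchE; case: ifPn => // xD.
by apply: fg; exact/set_mem.
Qed.

Lemma ge0_subset_integral_nomeas d (T : measurableType d)
    (m : {measure set T -> \bar R}) (A B : set T) (f : T -> \bar R) :
  (forall x, 0 <= f x) -> A `<=` B ->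
  \int[m]_(x in A) f x <= \int[m]_(x in B) f x.
Proof.
move=> f0 AB; rewrite [leLHS]integral_mkcond [leRHS]integral_mkcond.
apply: ge0_le_integral_nomeas => x _; rewrite !patchE; first by case: ifPn.
case: ifPn => xA; last by case: ifPn.
by rewrite ifT// inE; apply: AB; exact/set_mem.
Qed.

(** Lebesgue measure is the only measure that gives each []a, b]] its length, so it is enough to
    compute preimages of such intervals. Scaling is treated in the same way. *)
Lemma lebesgue_measure_shift (c : R) (A : set R) : measurable A ->
  pushforward mu ((fun x => x + c)%R : _ -> measurableTypeR R) A = mu A.
Proof.
have mc : @measurable_fun _ _ (measurableTypeR R) (measurableTypeR R) setT (fun x => (x + c)%R).
  exact: measurable_funD.
move=> mA; apply/esym.
pose nu : {measure set (measurableTypeR R) -> \bar R} :=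
  pushforward mu ((fun x => x + c)%R : measurableTypeR R -> measurableTypeR R).
apply: (@lebesgue_measure_unique _ (nu mc)) => //= _ [[a b]] _ <-.
rewrite /pushforward.
have -> : (fun x : R => (x + c)%R) @^-1` `]a, b]%classic = `](a - c)%R, (b - c)%R]%classic.
  by apply/seteqP; split => x /=; rewrite !in_itv/= ltrBlDr lerBrDr.
rewrite !lebesgue_measure_itv/= !lte_fin ltrBlDr subrK.
by case: ifP => // _; rewrite -!EFinD; congr (_%:E); ring.
Qed.

Lemma lebesgue_measure_scale (k : R) (A : set R) : (0 < k)%R -> measurable A ->
  pushforward mu ((fun x => k * x)%R : _ -> measurableTypeR R) A = (k^-1)%:E * mu A.
Proof.
move=> k0.
have mc : @measurable_fun _ _ (measurableTypeR R) (measurableTypeR R) setT (fun x => (k * x)%R).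
  exact: measurable_funM.
move=> mA.
have kge0 : (0 <= k)%R by exact: ltW.
have kn : k != 0%R by rewrite gt_eqF.
pose nu : {measure set (measurableTypeR R) -> \bar R} :=
  mscale (NngNum kge0) (pushforward mu ((fun x => k * x)%R : measurableTypeR R -> measurableTypeR R)).
have : mu A = nu mc A.
  apply: (@lebesgue_measure_unique _ (nu mc)) => //= _ [[a b]] _ <-.
  rewrite /nu/= /mscale/= /pushforward.
  have -> : (fun x : R => (k * x)%R) @^-1` `]a, b]%classic = `](a / k)%R, (b / k)%R]%classic.
    by apply/seteqP; split => x /=; rewrite !in_itv/= ltr_pdivrMr// ler_pdivlMr// ![(x * k)%R]mulrC.
  rewrite !lebesgue_measure_itv/= !lte_fin ltr_pM2r ?invr_gt0//.
  case: ifP => _; last by rewrite mule0.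
  by rewrite -!EFinD -EFinM; congr (_%:E); field.
rewrite /nu/= /mscale/= => ->.
by rewrite muleA -EFinM mulVf// mul1e.
Qed.

Lemma integral_shift (c : R) (D : set R) (f : R -> \bar R) :
  measurable D -> measurable_fun setT f -> (forall x, 0 <= f x) ->
  \int[mu]_(x in (fun x => x + c)%R @^-1` D) f (x + c)%R = \int[mu]_(x in D) f x.
Proof.
move=> mD mf f0.
have mc : @measurable_fun _ _ (measurableTypeR R) (measurableTypeR R) setT (fun x => (x + c)%R).
  exact: measurable_funD.
rewrite -(ge0_integral_pushforward mc mu mD (f := f))//; last first.
  exact: measurable_funTS.
apply: eq_measure_integral => A mA _; exact: lebesgue_measure_shift.
Qed.

Lemma integral_scale (k : R) (f : R -> \bar R) : (0 < k)%R ->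
  measurable_fun setT f -> (forall x, 0 <= f x) ->
  \int[mu]_(x in `]0%R, +oo[) f (k * x)%R * k%:E = \int[mu]_(x in `]0%R, +oo[) f x.
Proof.
move=> k0 mf f0.
have kge0 : (0 <= k^-1)%R by rewrite invr_ge0 ltW.
have mc : @measurable_fun _ _ (measurableTypeR R) (measurableTypeR R) setT (fun x => (k * x)%R).
  exact: measurable_funM.
have -> : \int[mu]_(x in `]0%R, +oo[) f (k * x)%R =
   \int[pushforward mu ((fun x => k * x)%R : measurableTypeR R -> measurableTypeR R)]_(x in `]0%R, +oo[) f x.
  rewrite (ge0_integral_pushforward mc)//; last exact: measurable_funTS.
  congr (integral _ _ _); apply/seteqP; split => x /=; rewrite !in_itv/= !andbT => x0.
    by rewrite mulr_gt0.
  by rewrite -(pmulr_rgt0 _ k0).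
have -> : \int[pushforward mu ((fun x => k * x)%R : measurableTypeR R -> measurableTypeR R)]_(x in `]0%R, +oo[) f x
  = \int[mscale (NngNum kge0) mu]_(x in `]0%R, +oo[) f x.
  by apply: eq_measure_integral => A mA _; exact: lebesgue_measure_scale.
rewrite ge0_integral_mscale//; last exact: measurable_funTS.
rewrite muleAC -EFinM mulVf ?mul1e ?gt_eqF//.
Qed.

Lemma integral_opp (D : set R) (f : R -> \bar R) :
  measurable D -> measurable_fun setT f -> (forall x, 0 <= f x) ->
  \int[mu]_(x in -%R @^-1` D) f (- x)%R = \int[mu]_(x in D) f x.
Proof.
move=> mD mf f0.
have mc : @measurable_fun _ _ (measurableTypeR R) (measurableTypeR R) setT (fun x => (- x)%R).
  exact: oppr_measurable.
rewrite -(ge0_integral_pushforward mc mu mD (f := f))//; last first.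
  exact: measurable_funTS.
apply: eq_measure_integral => A mA _; exact: lebesgue_measureN.
Qed.

Lemma integral_itv_shift (c a b : R) (x y : bool) (f : R -> \bar R) :
  measurable_fun setT f -> (forall x, 0 <= f x) ->
  \int[mu]_(s in [set` Interval (BSide x a) (BSide y b)]) f (s + c)%R
  = \int[mu]_(s in [set` Interval (BSide x (a + c)%R) (BSide y (b + c)%R)]) f s.
Proof.
move=> mf f0; rewrite -[RHS](integral_shift c)//.
suff -> : (fun s => s + c)%R @^-1` [set` Interval (BSide x (a + c)%R) (BSide y (b + c)%R)] =
  [set` Interval (BSide x a) (BSide y b)] by [].
by apply/seteqP; split => s /=; case: x; case: y; rewrite !in_itv/= ?lerD2r ?ltrD2r.
Qed.

Lemma integral_itv_opp (a b : R) (f : R -> \bar R) :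
  measurable_fun setT f -> (forall x, 0 <= f x) ->
  \int[mu]_(s in `[(- b)%R, (- a)%R]) f s = \int[mu]_(s in `[a, b]) f (- s)%R.
Proof.
by move=> mf f0; rewrite -[LHS]integral_opp// opp_preimage_itvbndbnd/= !opprK.
Qed.

Lemma integral_itv_split (a b c : R) (f : R -> \bar R) : (a <= b)%R -> (b <= c)%R ->
  measurable_fun setT f -> (forall x, 0 <= f x) ->
  \int[mu]_(s in `[a, c]) f s = \int[mu]_(s in `[a, b]) f s + \int[mu]_(s in `[b, c]) f s.
Proof.
move=> ab bc mf f0.
rewrite -[in X in _ + X]integral_itv_obnd_cbnd; last exact: measurable_funTS.
rewrite -ge0_integral_setU//; last 2 first.
- exact: measurable_funTS.
- apply/disj_setPS => x /= []; rewrite !in_itv/= => /andP[_ xb] /andP[bx _].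
  by have := lt_le_trans bx xb; rewrite ltxx.
congr (integral _ _ _); apply/seteqP; split => x /=; rewrite !in_itv/=.
  by move=> /andP[-> ->]; case: (leP x b) => ?; [left|right].
by move=> [/andP[-> xb]|/andP[bx ->]]; rewrite ?andbT/= ?(le_trans xb)// ltW// (le_lt_trans ab).
Qed.

Lemma tonelli_in (A B : set R) (f : R -> R -> \bar R) :
  measurable A -> measurable B ->
  measurable_fun [set: R * R] (fun z => f z.1 z.2) -> (forall x y, 0 <= f x y) ->
  \int[mu]_(x in A) \int[mu]_(y in B) f x y = \int[mu]_(y in B) \int[mu]_(x in A) f x y.
Proof.
move=> mA mB mf f0.
pose g (z : R * R) := (fun z => f z.1 z.2) \_ (A `*` B) z.
have mg : measurable_fun [set: measurableTypeR R * measurableTypeR R] g.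
  apply/(measurable_restrict _ _) => //; first exact: measurableX.
  exact: measurable_funTS.
have g0 z : 0 <= g z by rewrite /g patchE; case: ifP.
have gE x y : g (x, y) = if (x \in A) && (y \in B) then f x y else 0.
  by rewrite /g patchE in_setX.
have := @fubini_tonelli _ _ _ _ _ mu mu g mg g0.
move=> H; rewrite integral_mkcond [RHS]integral_mkcond.
transitivity (\int[mu]_x \int[mu]_y g (x, y)).
  apply: eq_integral => x _; rewrite patchE; case: ifP => xA.
    by rewrite integral_mkcond; apply: eq_integral => y _; rewrite gE xA/= patchE.
  by rewrite integral0_eq// => y _; rewrite gE xA.
rewrite H; apply: eq_integral => y _; rewrite patchE; case: ifP => yB.
  by rewrite [RHS]integral_mkcond; apply: eq_integral => x _; rewrite gE yB patchE andbT.
by rewrite integral0_eq// => x _; rewrite gE yB andbF.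
Qed.

Lemma measurable_integral_in d (T : measurableType d) (B : set R) (f : T -> R -> \bar R) :
  measurable B ->
  measurable_fun [set: T * R] (fun z => f z.1 z.2) -> (forall x y, 0 <= f x y) ->
  measurable_fun setT (fun x => \int[mu]_(y in B) f x y).
Proof.
move=> mB mf f0.
pose g (z : T * R) := (fun z => f z.1 z.2) \_ (setT `*` B) z.
have mg : measurable_fun [set: T * measurableTypeR R] g.
  apply/(measurable_restrict _ _) => //; first exact: measurableX.
  exact: measurable_funTS.
have g0 z : 0 <= g z by rewrite /g patchE; case: ifP.
have := @measurable_fun_fubini_tonelli_F _ _ _ _ _ mu g mg g0.
congr (measurable_fun _ _); apply/funext => x; rewrite /fubini_F [RHS]integral_mkcond.
by apply: eq_integral => y _; rewrite /g !patchE in_setX/= in_setT.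
Qed.

(* The inequality [2 * l * f <= f ^+ 2 + l ^+ 2] integrated against [k], at
   [l = w / K]. *)
Lemma cauchy_schwarz_weighted d (T : measurableType d) (m : {measure set T -> \bar R})
    (D : set T) (f k : T -> R) (K w : R) :
  measurable D -> measurable_fun D f -> measurable_fun D k ->
  (forall x, D x -> 0 <= f x)%R -> (forall x, D x -> 0 <= k x)%R ->
  (0 < K)%R -> (0 <= w)%R ->
  \int[m]_(x in D) (k x)%:E <= K%:E -> w%:E <= \int[m]_(x in D) (f x * k x)%:E ->
  (w ^+ 2)%:E <= K%:E * \int[m]_(x in D) (f x ^+ 2 * k x)%:E.
Proof.
move=> mD mf mk f0 k0 K0 w0 kK wf.
pose l := (w / K)%R.
have l0 : (0 <= l)%R by rewrite divr_ge0// ltW.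
have mfk : measurable_fun D (fun x => (f x * k x)%:E).
  by apply/measurable_EFinP; exact: measurable_funM.
have mf2k : measurable_fun D (fun x => (f x ^+ 2 * k x)%:E).
  by apply/measurable_EFinP; apply: measurable_funM => //; exact: measurable_funX.
have Y0 : 0 <= \int[m]_(x in D) (f x ^+ 2 * k x)%:E.
  by apply: integral_ge0 => x Dx; rewrite lee_fin mulr_ge0 ?sqr_ge0// k0.
have H : (2 * l)%:E * w%:E <= \int[m]_(x in D) (f x ^+ 2 * k x)%:E + (l ^+ 2)%:E * K%:E.
  apply: (@le_trans _ _ (\int[m]_(x in D) ((2 * l)%:E * (f x * k x)%:E))).
    rewrite ge0_integralZl//; last 2 first.
    - by move=> x Dx; rewrite lee_fin mulr_ge0 ?f0 ?k0.
    - by rewrite lee_fin mulr_ge0.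
    by apply: lee_wpmul2l => //; rewrite lee_fin mulr_ge0.
  apply: (@le_trans _ _ (\int[m]_(x in D) ((f x ^+ 2 * k x)%:E + (l ^+ 2)%:E * (k x)%:E))).
    apply: ge0_le_integral_nomeas => x Dx.
      by rewrite -EFinM lee_fin; apply: mulr_ge0; [exact: mulr_ge0|apply: mulr_ge0; [exact: f0|exact: k0]].
    rewrite -!EFinM -EFinD lee_fin -subr_ge0.
    rewrite (_ : _ - _ = (f x - l) ^+ 2 * k x)%R; last by ring.
    by rewrite mulr_ge0 ?sqr_ge0 ?k0.
  rewrite ge0_integralD//; last 3 first.
  - by move=> x Dx; rewrite lee_fin mulr_ge0 ?sqr_ge0// k0.
  - by move=> x Dx; rewrite -EFinM lee_fin mulr_ge0 ?sqr_ge0// k0.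
  - by apply: measurable_funeM; exact/measurable_EFinP.
  rewrite ge0_integralZl//; last 2 first.
  - exact/measurable_EFinP.
  - by rewrite lee_fin sqr_ge0.
  by apply: leeD2l; apply: lee_wpmul2l => //; rewrite lee_fin sqr_ge0.
move: Y0 H; case: (\int[m]_(x in D) (f x ^+ 2 * k x)%:E) => [y| |] //.
  rewrite -!EFinM -EFinD !lee_fin => y0 H.
  have wl : w = (l * K)%R by rewrite /l divfK// gt_eqF.
  rewrite wl in H *; rewrite (_ : (l * K) ^+ 2 = K * (l ^+ 2 * K))%R; last by ring.
  by rewrite ler_pM2l//; nra.
by move=> _ _; rewrite gt0_muley ?lte_fin// leey.
Qed.

End integral_tools.

(** * Arcs and periodic functions *)

Section arcs.
Context {R : realType}.
Notation mu := (@lebesgue_measure R).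
Implicit Types (a b c s t : R).

Lemma twopi_gt0 : 0 < 2 * pi :> R.
Proof. by rewrite mulr_gt0 ?pi_gt0. Qed.

Lemma periodic_int (T : Type) (f : R -> T) (p : R) : (forall x, f (x + p) = f x) ->
  forall (k : int) x, f (x + k%:~R * p) = f x.
Proof.
move=> fp.
have fn (n : nat) x : f (x + n%:R * p) = f x.
  elim: n x => [|n IH] x; first by rewrite mul0r addr0.
  by rewrite -natr1 mulrDl mul1r addrA fp IH.
case=> n x; first exact: fn.
rewrite NegzE mulrNz mulNr -[RHS](_ : f (x - n.+1%:R * p + n.+1%:R * p) = _).
  by rewrite fn.
by rewrite subrK.
Qed.

Lemma periodic_repr (p a x : R) : 0 < p ->
  exists k : int, a <= x + k%:~R * p < a + p.
Proof.
move=> p0; exists (- Num.floor ((x - a) / p)).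
have := Num.Theory.floor_itv ((x - a) / p) => /andP[h1 h2].
move: h1 h2; rewrite ler_pdivlMr// ltr_pdivrMr// intrD => h1 h2.
rewrite mulrNz; apply/andP; split; first lra.
by move: h2; rewrite mulrDl mul1r; lra.
Qed.

(** A translation by periods brings [c] to some [c'] in [[0, p[]. Then [[c', c' + p]] is cut at [p],
    and its second piece is moved back by one period to [[0, c']]. *)
Lemma integral_periodic (p c : R) (f : R -> \bar R) : 0 < p ->
  measurable_fun setT f -> (forall x, (0 <= f x)%E) -> (forall x, f (x + p) = f x) ->
  (\int[mu]_(x in `[c, (c + p)%R]) f x = \int[mu]_(x in `[0%R, p]) f x)%E.
Proof.
move=> p0 mf f0 fp.
have [k /andP[k1 k2]] := periodic_repr 0 c p0.
rewrite add0r in k2.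
set c' := c + k%:~R * p in k1 k2.
have -> : (\int[mu]_(x in `[c, (c + p)%R]) f x = \int[mu]_(x in `[c', (c' + p)%R]) f x)%E.
  transitivity (\int[mu]_(x in `[c, (c + p)%R]) f (x + k%:~R * p)%R)%E.
    by apply: eq_integral => x _; rewrite (periodic_int fp).
  by rewrite (integral_itv_shift (k%:~R * p) c (c + p) true false)// addrAC.
rewrite (@integral_itv_split _ c' p (c' + p)) ?lerDr// ?ltW//.
rewrite (@integral_itv_split _ 0 c' p)//; last exact: ltW.
rewrite addeC; congr (_ + _)%E.
rewrite -{1}(add0r p) -(integral_itv_shift p 0 c' true false)//.
by apply: eq_integral => x _; rewrite fp.
Qed.

Lemma cisD2pi s : cis (s + 2 * pi) = cis s.
Proof. by rewrite /cis mulr_natl cosD2pi sinD2pi. Qed.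

Lemma cos_eq1 t : 0 <= t < 2 * pi -> cos t = 1 -> t = 0.
Proof.
move=> /andP[t0 t2] ct; apply/eqP; apply: contraT => tn0.
have : 0 < sin (t / 2) by apply: sin_gt0_pi; apply/andP; split; lra.
move: ct; have {1}-> : t = (t / 2) *+ 2 by rewrite -mulr_natr divfK. rewrite cos_mulr2n => ct st.
have := cos2Dsin2 (t / 2) => h.
suff : sin (t / 2) ^+ 2 = 0 by move=> /eqP; rewrite sqrf_eq0 gt_eqF.
by move: ct; rewrite -mulr_natr; lra.
Qed.

Lemma cis_inj_period a s t : a <= s < a + 2 * pi -> a <= t < a + 2 * pi ->
  cis s = cis t -> s = t.
Proof.
wlog st : s t / t <= s.
  move=> H ha hb hc; have [h|/ltW h] := leP t s; first exact: H.
  by symmetry; apply: H.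
move=> /andP[s1 s2] /andP[t1 t2] [ec es].
have : cos (s - t) = 1 by rewrite cosB ec es -!expr2 cos2Dsin2.
move/cos_eq1 => h; apply/eqP; rewrite -subr_eq0; apply/eqP; apply: h.
by apply/andP; split; lra.
Qed.

Lemma cis_eq s t : cis s = cis t -> exists k : int, s = t + k%:~R * (2 * pi).
Proof.
move=> e; have [k hk] := periodic_repr s t twopi_gt0.
exists k; apply: (@cis_inj_period s) => //.
  by rewrite lexx ltrDl twopi_gt0.
by rewrite (periodic_int cisD2pi).
Qed.

Lemma circle_cis s : circle (cis s).
Proof. by rewrite /circle/= /cabs/= cos2Dsin2 sqrtr1. Qed.

Definition arc a b (x y : bool) : set R[i] :=
  @cis R @` [set` Interval (BSide x a) (BSide y b)].

(** Countably many translates of one interval: this is where the measurability of everything defined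
    by an arc comes from. *)
Lemma arc_preimage a b x y :
  @cis R @^-1` arc a b x y =
  \bigcup_(k : int) ((fun s => s + k%:~R * (2 * pi)) @^-1` [set` Interval (BSide x a) (BSide y b)]).
Proof.
apply/seteqP; split=> s /=.
  by move=> [t Jt /cis_eq[k tk]]; exists k => //=; rewrite -tk.
by move=> [k _ /= J]; exists (s + k%:~R * (2 * pi)) => //; rewrite (periodic_int cisD2pi).
Qed.

Lemma measurable_arc_preimage a b x y : measurable (@cis R @^-1` arc a b x y).
Proof.
rewrite arc_preimage; apply: countable_bigcupT_measurable => // k.
rewrite -[X in measurable X]setTI; apply: (_ : measurable_fun setT _) => //.
exact: measurable_funD.
Qed.

Lemma measurable_params a b x y : measurable (params (arc a b x y)).
Proof.
have -> : params (arc a b x y) = `[0, (2 * pi)[%classic `&` @cis R @^-1` arc a b x y.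
  by apply/seteqP; split => s /=; rewrite in_itv.
by apply: measurableI => //; exact: measurable_arc_preimage.
Qed.

(** The set [params] cuts the circle at angle 0, which may lie inside the arc. Extended by zero off
    the arc, [f] stays periodic, so the period [[0, 2 pi[] can be replaced by one starting at [a],
    in which the arc is a single interval. End points are null, so a closed interval serves for all
    [x] and [y]. *)
Lemma integral_params a b x y (f : R -> \bar R) : a < b -> b <= a + 2 * pi ->
  measurable_fun setT f -> (forall s, (0 <= f s)%E) -> (forall s, f (s + 2 * pi) = f s) ->
  (\int[mu]_(s in params (arc a b x y)) f s = \int[mu]_(s in `[a, b]) f s)%E.
Proof.
move=> ab ba mf f0 fp.
pose E := @cis R @^-1` arc a b x y.
have mE : measurable E by exact: measurable_arc_preimage.
pose g := f \_ E.
have mg : measurable_fun setT g.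
  by apply/(measurable_restrict _ _) => //; exact: measurable_funTS.
have g0 s : (0 <= g s)%E by rewrite /g patchE; case: ifP.
have gp s : g (s + 2 * pi) = g s.
  rewrite /g !patchE fp; congr (if _ then _ else _).
  by apply/idP/idP; rewrite !inE /E/= cisD2pi.
have -> : (\int[mu]_(s in params (arc a b x y)) f s = \int[mu]_(s in `[0%R, (2 * pi)%R[) g s)%E.
  have -> : params (arc a b x y) = `[0, (2 * pi)[%classic `&` E.
    by apply/seteqP; split => s /=; rewrite in_itv.
  by rewrite integral_mkcondr.
rewrite integral_itv_bndo_bndc; last exact: measurable_funTS.
rewrite -(integral_periodic a twopi_gt0 mg g0 gp).
rewrite (@integral_itv_bndoo _ a (a + 2 * pi)); last exact: measurable_funTS.
(* If [b = a + 2 pi], the end point [b] lies outside the open period, so the interval is open there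
   whatever [y] is. *)
pose y' := if b < a + 2 * pi then y else true.
rewrite -integral_mkcondr.
have -> : `]a, (a + 2 * pi)[%classic `&` E = [set` Interval (BRight a) (BSide y' b)].
  apply/seteqP; split => s /=; rewrite in_itv/= /E/=.
    move=> [/andP[as_ sa] [t Jt e]].
    move: Jt; rewrite /= in_itv/= => /andP[l1 l2].
    have at_ : a <= t := lteifW l1.
    have tb : t <= b := lteifW l2.
    have [ta|ta] := ltP t (a + 2 * pi).
      have ts : t = s.
        by apply: (@cis_inj_period a) => //; [rewrite at_|rewrite (ltW as_)].
      rewrite -ts in as_ sa *.
      rewrite in_itv/= as_/= /y'; case: ifPn => // bb.
      by rewrite -leNgt in bb; rewrite /=; apply: lt_le_trans ta bb.
    (* This [t] is the same point of the circle as [a], which [a < s] excludes. *)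
    have ts : t = a + 2 * pi by apply/eqP; rewrite eq_le ta (le_trans tb).
    have : a = s.
      apply: (@cis_inj_period a); rewrite ?lexx ?ltrDl ?twopi_gt0 ?(ltW as_)//.
      by rewrite -e ts cisD2pi.
    by move=> as2; move: as_; rewrite as2 ltxx.
  move=> /andP[as_ sb].
  have sb' : s <= b := lteifW sb.
  have sa2 : s < a + 2 * pi.
    move: sb; rewrite /y'; case: ifPn; first by move=> /(le_lt_trans sb').
    by rewrite /= => _ /lt_le_trans; apply.
  split; first by rewrite in_itv/= as_.
  exists s => //=; rewrite in_itv/= lteifS//=.
  by move: sb; rewrite /y'; case: ifPn => // _ /= sb; exact: lteifS.
rewrite (@integral_itv_bndoo _ _ _ _ false y'); last exact: measurable_funTS.
by rewrite integral_itv_bndoo//; exact: measurable_funTS.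
Qed.

Lemma arc_lengthE a b x y : a < b -> b <= a + 2 * pi ->
  arc_length (arc a b x y) = (b - a) / (2 * pi).
Proof.
move=> ab ba; rewrite /arc_length; congr (_ / _).
have mp := measurable_params a b x y.
have := @integral_params a b x y (cst 1%:E) ab ba.
move=> /(_ _ _ _)/=; rewrite !integral_cst// !mul1e => -> //.
  by have := @lebesgue_measure_itv R `[a, b]; rewrite /= lte_fin ab => -> .
Qed.

Lemma sup_arcs_bound (Phi : set R[i] -> \bar R) : (sup_arcs Phi < +oo)%E ->
  exists2 C : R, 0 <= C &
    forall a b x y, a < b -> b <= a + 2 * pi -> (Phi (arc a b x y) <= C%:E)%E.
Proof.
move=> fin; exists (Num.max 0 (fine (sup_arcs Phi))); first by rewrite le_max lexx.
move=> a b x y ab ba.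
have h : (Phi (arc a b x y) <= sup_arcs Phi)%E.
  by apply: ereal_sup_ubound; exists (arc a b x y) => //; exists a, b, x, y.
apply: (le_trans h); move: fin; case: (sup_arcs Phi) => [r _| |] //=.
  by rewrite lee_fin le_max lexx orbT.
by rewrite leNye.
Qed.

Lemma sup_arcsP (Phi : set R[i] -> \bar R) (phi : R -> R -> \bar R) :
  (forall a b x y, a < b -> b <= a + 2 * pi -> Phi (arc a b x y) = phi a (b - a)) ->
  ((sup_arcs Phi < +oo)%E <->
   exists2 C : R, 0 <= C & forall a L, 0 < L -> L <= 2 * pi -> (phi a L <= C%:E)%E).
Proof.
move=> H; split.
  move=> /sup_arcs_bound[C C0 HC]; exists C => // a L L0 L2.
  by rewrite -[L](addKr a) [- a + _]addrC -(H _ _ true true) ?HC ?ltrDl ?lerD2l.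
move=> [C C0 HC].
apply: (@le_lt_trans _ _ C%:E); last by rewrite ltry.
apply: ge_ereal_sup => _ [I [a [b [x [y [ab ba ->]]]]] <-].
by rewrite (H a b x y ab ba); apply: HC; [rewrite subr_gt0|rewrite lerBlDl].
Qed.

End arcs.

(** * Powers and trigonometric functions *)

(** Writing [1 / f] as [f] times a power of [f ^+ 2] reduces inversion to the measurable power
    function; the factor [f] produces the convention [0^-1 = 0]. *)
Lemma measurable_funV d (T : measurableType d) (R : realType) (D : set T) (f : T -> R) :
  measurable_fun D f -> measurable_fun D (fun x => (f x)^-1).
Proof.
move=> mf.
have -> : (fun x => (f x)^-1) = (fun x => f x * ((f x) ^+ 2) `^ (-1)).
  apply/funext => x; have [->|fx0] := eqVneq (f x) 0; first by rewrite mul0r invr0.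
  by rewrite powR_inv1 ?sqr_ge0// expr2 invfM mulrA divff// mul1r.
apply: measurable_funM => //.
apply: (measurableT_comp (measurable_powR (-1))).
exact: measurable_funX.
Qed.

Lemma measurable_fun_powR d (T : measurableType d) (R : realType) (D : set T) (f : T -> R) (c : R) :
  measurable_fun D f -> measurable_fun D (fun x => f x `^ c).
Proof. by move=> mf; exact: (measurableT_comp (measurable_powR c)). Qed.

Lemma measurable_fun_norm d (T : measurableType d) (R : realType) (D : set T) (f : T -> R) :
  measurable_fun D f -> measurable_fun D (fun x => `|f x|).
Proof. by move=> mf; apply: measurableT_comp => //; exact: normr_measurable. Qed.

Lemma measurable_fun_cos d (T : measurableType d) (R : realType) (D : set T) (f : T -> R) :
  measurable_fun D f -> measurable_fun D (fun x => cos (f x)).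
Proof.
by move=> mf; apply: measurableT_comp => //; apply: continuous_measurable_fun; exact: continuous_cos.
Qed.

Lemma measurable_fun_sin d (T : measurableType d) (R : realType) (D : set T) (f : T -> R) :
  measurable_fun D f -> measurable_fun D (fun x => sin (f x)).
Proof.
by move=> mf; apply: measurableT_comp => //; apply: continuous_measurable_fun; exact: continuous_sin.
Qed.

Lemma measurable_fun_oppr d (T : measurableType d) (R : realType) (D : set T) (f : T -> R) :
  measurable_fun D f -> measurable_fun D (fun x => - f x).
Proof. by move=> mf; apply: measurableT_comp => //; exact: oppr_measurable. Qed.

Lemma measurable_addr (R : realType) (c : R) : measurable_fun setT (+%R c).
Proof.
have : measurable_fun setT (fun x : R => c + x).
  by apply: measurable_funD; [exact: measurable_cst|exact: measurable_id].
exact.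
Qed.

Ltac measr := repeat first [ assumption | exact: measurable_cst | exact: measurable_id
  | exact: normr_measurable | exact: measurable_fst | exact: measurable_snd
  | match goal with
    | |- measurable_fun _ (fun z => (fst z).1) => exact: (measurableT_comp measurable_fst measurable_fst)
    | |- measurable_fun _ (fun z => (fst z).2) => exact: (measurableT_comp measurable_snd measurable_fst)
    | |- measurable_fun _ (fun _ => (_, _)) => apply: measurable_fun_pair
    | |- measurable_fun _ (fun _ => if _ then _ else _) => apply: measurable_fun_ifT
    | |- measurable_fun _ (fun _ => (_ < _)%R) => apply: measurable_fun_ltr
    | |- measurable_fun _ (fun _ => (_ <= _)%R) => apply: measurable_fun_ler
    | |- measurable_fun _ (fun _ => Num.max _ _) => apply: measurable_maxr
    | |- measurable_fun _ (+%R _) => exact: measurable_addr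
    | |- measurable_fun _ (fun _ => (_)%:E) => apply/measurable_EFinP
    | |- measurable_fun _ (fun _ => (_ - _)%R) => apply: measurable_funB
    | |- measurable_fun _ (fun _ => (_ + _)%R) => apply: measurable_funD
    | |- measurable_fun _ (fun _ => (_ * _)%R) => apply: measurable_funM
    | |- measurable_fun _ (fun _ => (- _)%R) => apply: measurable_fun_oppr
    | |- measurable_fun _ (fun _ => (_ ^+ _)%R) => apply: measurable_funX
    | |- measurable_fun _ (fun _ => (_ ^-1)%R) => apply: measurable_funV
    | |- measurable_fun _ (fun _ => (_ `^ _)%R) => apply: measurable_fun_powR
    | |- measurable_fun _ (fun _ => (`| _ |)%R) => apply: measurable_fun_norm
    | |- measurable_fun _ (fun _ => Num.sqrt _) =>
        apply: (measurableT_comp (continuous_measurable_fun (@sqrt_continuous _)))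
    | |- measurable_fun _ (fun _ => cos _) => apply: measurable_fun_cos
    | |- measurable_fun _ (fun _ => sin _) => apply: measurable_fun_sin
    | |- measurable_fun _ cos => apply: continuous_measurable_fun; exact: continuous_cos
    | |- measurable_fun _ sin => apply: continuous_measurable_fun; exact: continuous_sin
    | H : measurable_fun setT ?u |- measurable_fun _ (fun _ => ?u _) => apply: (measurableT_comp H)
    | H : measurable_fun setT (fun z => ?g (fst z) (snd z))
      |- measurable_fun _ (fun w => ?g (@?A w) (@?B w)) =>
        let h := constr:(fun w => (A w, B w)) in apply: (measurableT_comp H (g := h)); cbv beta
    end ].

Section power_integrals.
Context {R : realType}.
Notation mu := (@lebesgue_measure R).

Lemma integral_setU_le (A B : set R) (f : R -> \bar R) :
  measurable A -> measurable B -> measurable_fun setT f -> (forall x, (0 <= f x)%E) ->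
  (\int[mu]_(x in A `|` B) f x <= \int[mu]_(x in A) f x + \int[mu]_(x in B) f x)%E.
Proof.
move=> mA mB mf f0.
have -> : A `|` B = (A `\` B) `|` B.
  apply/seteqP; split => x /=; last by move=> [[]|]; [left|right].
  by have [Bx|nBx] := pselect (B x); [right|case; [left|right]].
rewrite ge0_integral_setU//; last 3 first.
- exact: measurableD.
- exact: measurable_funTS.
- by apply/disj_setPS => x [[_ nB] Bx].
by apply: leeD2r; apply: ge0_subset_integral_nomeas => //; exact: subDsetl.
Qed.

Lemma ftc2 (f F : R -> R) (a b : R) : a <= b ->
  (forall x : R, a <= x <= b -> is_derive x 1 F (f x)) ->
  (forall x : R, a <= x <= b -> {for x, continuous f}) ->
  (\int[mu]_(x in `[a, b]) (f x)%:E = (F b - F a)%:E)%E.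
Proof.
rewrite le_eqVlt => /predU1P[<- _ _|ab dF cf].
  by rewrite set_itv1 integral_set1 subrr.
have cF x : a <= x <= b -> {for x, continuous F}.
  by move=> /dF [dFx _]; apply: differentiable_continuous; exact/derivable1_diffP.
rewrite (@continuous_FTC2 _ f F)//.
- by apply: continuous_in_subspaceT => x; rewrite inE/= in_itv/=; exact: cf.
- split.
  + by move=> x; rewrite in_itv/= => /andP[/ltW ax /ltW xb]; case: (dF x) => //; rewrite ax.
  + by apply: cvg_at_right_filter; apply: cF; rewrite lexx ltW.
  + by apply: cvg_at_left_filter; apply: cF; rewrite lexx ltW.
- move=> x; rewrite in_itv/= => /andP[/ltW ax /ltW xb].
  by rewrite derive1E; case: (dF x) => //; rewrite ax.
Qed.

Lemma is_derive_powR (c x : R) : 0 < x -> is_derive x 1 (fun y => y `^ c) (c * x `^ (c - 1)).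
Proof.
move=> x0; have xI : x \in `]0, +oo[ by rewrite in_itv/= x0.
apply: DeriveDef; first exact: derivable_powR.
by rewrite -derive1E powR_derive1.
Qed.

Lemma continuous_powR (c x : R) : 0 < x -> {for x, continuous (fun y => y `^ c)}.
Proof.
move=> x0; apply: differentiable_continuous; apply/derivable1_diffP.
by case: (is_derive_powR c x0).
Qed.

Lemma integral_powR (c a b : R) : 0 < a -> a <= b -> c + 1 != 0 ->
  (\int[mu]_(x in `[a, b]) (x `^ c)%:E = ((b `^ (c + 1) - a `^ (c + 1)) / (c + 1))%:E)%E.
Proof.
move=> a0 ab c1.
have dF (x : R) : a <= x <= b ->
    is_derive x 1 (fun x => (c + 1)^-1 * x `^ (c + 1)) (x `^ c).
  move=> /andP[ax _]; have x0 : 0 < x by exact: lt_le_trans ax.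
  have h := is_derive_powR (c + 1) x0.
  apply: is_derive_eq.
  by rewrite addrK /GRing.scale/= mulrA mulVf// mul1r.
rewrite (ftc2 ab dF).
- by rewrite -mulrBr mulrC.
- by move=> x /andP[ax _]; apply: continuous_powR; exact: lt_le_trans ax.
Qed.

(** The bound is the integral over [[a, +oo[], hence uniform in [b]. *)
Lemma integral_powR_lt (c a b : R) : 0 < a -> c < -1 ->
  (\int[mu]_(x in `[a, b]) (x `^ c)%:E <= (a `^ (c + 1) / (- c - 1))%:E)%E.
Proof.
move=> a0 c1.
have c1' : 0 < - c - 1 by lra.
have [ab|ba] := leP a b; last first.
  rewrite set_itv_ge ?bnd_simp -?ltNge// integral_set0 lee_fin.
  by rewrite divr_ge0 ?powR_ge0// ltW.
rewrite integral_powR//; last by rewrite lt_eqF//; lra.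
rewrite lee_fin -[X in X / _]opprK -[c + 1]opprK invrN mulrNN opprB opprD.
by rewrite ler_pM2r ?invr_gt0// gerBl powR_ge0.
Qed.

(** The primitive is available only away from 0, so []0, b]] is exhausted by the intervals
    [[b / (n + 1), b]] and monotone convergence is used. *)
Lemma integral_powR_gt (c b : R) : 0 <= b -> -1 < c ->
  (\int[mu]_(x in `]0%R, b]) (x `^ c)%:E <= (b `^ (c + 1) / (c + 1))%:E)%E.
Proof.
move=> b0 c1; have c1' : 0 < c + 1 by lra.
move: b0; rewrite le_eqVlt => /predU1P[<-|b0].
  by rewrite set_itvoc0 integral_set0 lee_fin divr_ge0 ?powR_ge0// ltW.
pose F (n : nat) : set (measurableTypeR R) := `[b / n.+1%:R, b]%classic.
have -> : `]0, b]%classic = \bigcup_n F n.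
  apply/seteqP; split => x /=.
    rewrite in_itv/= => /andP[x0 xb].
    have := archi_boundP (ltW (divr_gt0 b0 x0)); set n := Num.bound _ => h.
    exists n => //; rewrite /F/= in_itv/= xb andbT.
    rewrite ler_pdivrMr// -ler_pdivrMl// mulrC; apply: (le_trans (ltW h)).
    by rewrite ler_nat.
  move=> [n _]; rewrite /F/= !in_itv/= => /andP[h ->]; rewrite andbT.
  by apply: lt_le_trans h; rewrite divr_gt0.
have := @ge0_nondecreasing_set_cvg_integral _ (measurableTypeR R) R F (fun x => (x `^ c)%:E) (@lebesgue_measure R).
move=> /(_ _ _ _ _)/cvg_lim <- //.
- apply: lime_le.
    apply: ereal_nondecreasing_is_cvgn => m n mn.
    apply: ge0_subset_integral_nomeas; first by move=> x; rewrite lee_fin powR_ge0.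
    apply: subset_itvr; rewrite bnd_simp ler_pM2l// lef_pV2 ?posrE//.
    by rewrite ler_nat ltnS.
  apply: nearW => n; rewrite /F integral_powR//.
  + rewrite lee_fin ler_pM2r ?invr_gt0// gerBl powR_ge0//.
  + by rewrite divr_gt0.
  + by rewrite ler_pdivrMr// ler_peMr ?ler1n// ltW.
  + by rewrite gt_eqF.
- move=> m n mn; apply/subsetPset; apply: subset_itvr.
  by rewrite bnd_simp ler_pM2l// lef_pV2 ?posrE// ler_nat ltnS.
- by move=> n; exact: measurable_itv.
- by move=> n; apply: measurable_funTS; measr.
- by move=> n x _; rewrite lee_fin powR_ge0.
Qed.

(** Cut at [h = t]. Below, drop [h ^+ 2] from the denominator: the exponent [s - 1 > -1] is
    integrable at 0 and gives [1 / s]. Above, drop [t ^+ 2]: the exponent [s - 3 < -1] is integrable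
    at infinity and gives [1 / (2 - s)]. *)
Lemma kernel_integral (s t r : R) : 0 < s -> s < 1 -> 0 < t -> 0 <= r ->
  (\int[mu]_(h in `]0%R, r]) (h `^ (s - 1) / (h ^+ 2 + t ^+ 2))%:E
   <= ((s^-1 + (2 - s)^-1) * t `^ (s - 2))%:E)%E.
Proof.
move=> s0 s1 t0 r0.
have f0 h : (0 <= (h `^ (s - 1) / (h ^+ 2 + t ^+ 2))%:E)%E.
  by rewrite lee_fin divr_ge0 ?powR_ge0// addr_ge0// sqr_ge0.
have mf : measurable_fun setT (fun h : R => (h `^ (s - 1) / (h ^+ 2 + t ^+ 2))%:E).
  by measr.
apply: (@le_trans _ _ (\int[mu]_(h in `]0%R, t] `|` `[t, (t + r)%R]) (h `^ (s - 1) / (h ^+ 2 + t ^+ 2))%:E)%E).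
  apply: ge0_subset_integral_nomeas => // x /=; rewrite !in_itv/= => /andP[x0 xr].
  by have [xt|xt] := leP x t; [left; rewrite x0|right; rewrite (ltW xt)/=; lra].
apply: le_trans (integral_setU_le _ _ mf f0) _ => //.
rewrite mulrDl EFinD; apply: leeD.
  apply: (@le_trans _ _ (\int[mu]_(h in `]0%R, t]) ((t ^- 2)%:E * (h `^ (s - 1))%:E))%E).
    apply: ge0_le_integral_nomeas => // h /=; rewrite in_itv/= => /andP[h0 ht].
    rewrite -EFinM lee_fin mulrC ler_pM2r ?powR_gt0// lef_pV2 ?posrE ?addr_gt0 ?exprn_gt0//.
    by rewrite lerDr sqr_ge0.
  rewrite ge0_integralZl//; last 3 first.
  - by apply: measurable_funTS; measr.
  - by move=> x _; rewrite lee_fin powR_ge0.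
  - by rewrite lee_fin invr_ge0 sqr_ge0.
  apply: (@le_trans _ _ ((t ^- 2)%:E * (t `^ (s - 1 + 1) / (s - 1 + 1))%:E)%E).
    apply: lee_wpmul2l; first by rewrite lee_fin invr_ge0 sqr_ge0.
    by apply: integral_powR_gt; lra.
  rewrite -EFinM lee_fin subrK -powR_invn ?(ltW t0)// mulrA -powRD; last by rewrite (gt_eqF t0) implybT.
  by rewrite [leLHS]mulrC [_ + s]addrC.
apply: (@le_trans _ _ (\int[mu]_(h in `[t, (t + r)%R]) (h `^ (s - 3))%:E)%E).
  apply: ge0_le_integral_nomeas => // h /=; rewrite in_itv/= => /andP[th _].
  have h0 : 0 < h by exact: lt_le_trans th.
  rewrite lee_fin (_ : s - 3 = (s - 1) - 2%:R); last by ring.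
  rewrite [leRHS]powRB; last by rewrite (gt_eqF h0) implybT.
  rewrite powR_mulrn ?(ltW h0)// ler_pM2l ?powR_gt0// lef_pV2 ?posrE ?addr_gt0 ?exprn_gt0//.
  by rewrite lerDl sqr_ge0.
apply: le_trans (integral_powR_lt _ t0 _) _; first lra.
rewrite lee_fin mulrC (_ : s - 3 + 1 = s - 2); last by ring.
by rewrite (_ : - (s - 3) - 1 = 2 - s)//; ring.
Qed.

End power_integrals.

(** * Comparison of chord and angle *)

Section trig.
Context {R : realType}.
Implicit Types (s t x : R).

Lemma one_subr_cos t : 1 - cos t = 2 * sin (t / 2) ^+ 2.
Proof.
have {1}-> : t = (t / 2) *+ 2 by rewrite -mulr_natr divfK.
by rewrite cos_mulr2n cos2sin2 -mulr_natr; ring.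
Qed.

Lemma sin_ge_cosM x : 0 <= x <= pi / 2 -> x * cos x <= sin x.
Proof.
move=> /andP[]; rewrite le_eqVlt => /predU1P[<- _|x0 xp]; first by rewrite mul0r sin0.
have := @MVT R sin cos 0 x x0 _ _.
have h (y : R) : y \in `]0, x[ -> is_derive y 1 sin (cos y) by move=> _; exact: is_derive_sin.
move=> /(_ h) [|c].
  by apply: continuous_subspaceT; exact: continuous_sin.
rewrite in_itv/= => /andP[c0 cx]; rewrite sin0 !subr0 => ->.
rewrite mulrC ler_pM2r//; have [->//|cx'] := eqVneq c x.
have h1 : c \in `[0, (pi : R)] by rewrite in_itv/= (ltW c0)/=; lra.
have h2 : x \in `[0, (pi : R)] by rewrite in_itv/= (ltW x0)/=; lra.
by rewrite ltW// ltr_cos.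
Qed.

(** By the previous lemma at [x / 2], [sin x = 2 sin (x / 2) cos (x / 2) >= x cos (x / 2) ^+ 2], and
    [cos (x / 2) ^+ 2 = (1 + cos x) / 2 >= 1 / 2]. *)
Lemma sin_ge_half x : 0 <= x <= pi / 2 -> x / 2 <= sin x.
Proof.
move=> /andP[x0 xp].
have h : x / 2 * cos (x / 2) <= sin (x / 2) by apply: sin_ge_cosM; apply/andP; split; lra.
have c0 : 0 <= cos (x / 2) by apply: cos_ge0_pihalf; apply/andP; split; lra.
have cx : 0 <= cos x by apply: cos_ge0_pihalf; apply/andP; split; lra.
have e : sin x = 2 * (cos (x / 2) * sin (x / 2)).
  have {1}-> : x = (x / 2) *+ 2 by rewrite -mulr_natr divfK.
  by rewrite sin_mulr2n -mulr_natl.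
have e2 : cos x = 2 * cos (x / 2) ^+ 2 - 1.
  have {1}-> : x = (x / 2) *+ 2 by rewrite -mulr_natr divfK.
  by rewrite cos_mulr2n -mulr_natl.
rewrite e; nra.
Qed.

Lemma abs_sin_le x : `|sin x| <= `|x|.
Proof.
wlog x0 : x / 0 < x.
  move=> H; have [x0|x0|->] := ltgtP x 0; last by rewrite sin0.
    by rewrite -(normrN x) -(normrN (sin x)) -sinN; apply: H; rewrite oppr_gt0.
  exact: H.
have := @MVT R sin cos 0 x x0 _ _.
have h (y : R) : y \in `]0, x[ -> is_derive y 1 sin (cos y) by move=> _; exact: is_derive_sin.
move=> /(_ h) [|c _].
  by apply: continuous_subspaceT; exact: continuous_sin.
rewrite sin0 !subr0 => ->; rewrite normrM ler_piMl//; exact: cos_max.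
Qed.

Lemma one_subr_cos_ge t : `|t| <= pi -> t ^+ 2 / 8 <= 1 - cos t.
Proof.
move=> tp.
wlog t0 : t tp / 0 <= t.
  move=> H; have [t0|t0] := leP 0 t; first exact: H.
  by rewrite -cosN -sqrrN; apply: H; rewrite ?normrN// oppr_ge0 ltW.
rewrite ger0_norm// in tp.
rewrite one_subr_cos.
have : t / 2 / 2 <= sin (t / 2) by apply: sin_ge_half; apply/andP; split; lra.
by nra.
Qed.

Lemma one_subr_cos_le t : 1 - cos t <= t ^+ 2 / 2.
Proof.
rewrite one_subr_cos; have := abs_sin_le (t / 2).
rewrite -ler_sqr ?nnegrE// !real_normK ?num_real//.
by rewrite exprMn; lra.
Qed.

(* The chord [cabs (cis s - cis t)] is a function of [s - t]. *)
Definition chord t : R := Num.sqrt (2 * (1 - cos t)).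

Lemma cabs_cisB s t : cabs (cis s - cis t) = chord (s - t).
Proof.
rewrite /cabs /cis /= /chord cosB; congr Num.sqrt.
have := cos2Dsin2 s; have := cos2Dsin2 t; lra.
Qed.

Lemma chordN t : chord (- t) = chord t. Proof. by rewrite /chord cosN. Qed.

Lemma chordD2pi t : chord (t + 2 * pi) = chord t.
Proof. by rewrite /chord [2 * pi]mulr_natl cosD2pi. Qed.

Lemma chord_le t : chord t <= `|t|.
Proof.
rewrite -[leRHS]sqrtr_sqr ler_sqrt ?sqr_ge0 ?exprn_ge0//.
  by have := one_subr_cos_le t; lra.
Qed.

Lemma chord_ge t : `|t| <= pi -> `|t| / 2 <= chord t.
Proof.
move=> /one_subr_cos_ge h; rewrite -[leLHS]ger0_norm ?divr_ge0// -sqrtr_sqr ler_sqrt.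
  by rewrite exprMn real_normK ?num_real//; lra.
by have := cos_le1 t; lra.
Qed.

Lemma measurable_chord : measurable_fun setT (@chord : R -> R).
Proof.
have -> : (@chord : R -> R) = fun t => (2 * (1 - cos t)) `^ (2^-1).
  by apply/funext => t; rewrite powR12_sqrt// mulr_ge0// subr_ge0 cos_le1.
measr.
Qed.

End trig.

(** * Hoelder representatives *)

(** Distances are limited to one period, the largest length of an arc; periodicity takes care of the
    others. *)
Definition holder_periodic (R : realType) (al : R) (u : R -> R) : Prop :=
  (forall s, u (s + 2 * pi) = u s) /\
  exists2 C : R, 0 <= C & forall s t, `|s - t| <= 2 * pi -> `|u s - u t| <= C * `|s - t| `^ al.

Section holder.
Context {R : realType}.
Notation mu := (@lebesgue_measure R).

Lemma holder_continuous (al : R) (u : R -> R) : 0 < al ->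
  holder_periodic al u -> continuous u.
Proof.
move=> al0 [_ [C C0 H]] t; apply/cvgrPdist_le => /= e e0.
have C1 : 0 < C + 1 by rewrite ltr_wpDl.
pose d := (e / (C + 1)) `^ al^-1.
have d0 : 0 < d by rewrite powR_gt0// divr_gt0.
near=> s.
have h2 : `|t - s| <= 2 * pi.
  by near: s; apply: cvgr_dist_le; [exact: cvg_id|exact: twopi_gt0].
apply: (le_trans (H _ _ h2)).
apply: (@le_trans _ _ ((C + 1) * d `^ al)).
  apply: ler_pM; rewrite ?powR_ge0 ?lerDl//.
  by apply: ge0_ler_powR => //; rewrite ?nnegrE// ltW.
rewrite /d -powRrM mulVf ?gt_eqF// powRr1; last by rewrite divr_ge0// ltW.
by rewrite mulrC divfK// gt_eqF.
Unshelve. all: by end_near. Qed.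

Lemma holder_measurable (al : R) (u : R -> R) : 0 < al ->
  holder_periodic al u -> measurable_fun setT u.
Proof. by move=> al0 /(holder_continuous al0) cu; exact: continuous_measurable_fun. Qed.

Lemma integral_cst_itv (a b k : R) : a <= b ->
  (\int[mu]_(x in `[a, b]) k%:E = (k * (b - a))%:E)%E.
Proof.
move=> ab; rewrite integral_cst//= EFinM; congr (_ * _)%E.
have := @lebesgue_measure_itv R `[a, b]; rewrite /= lte_fin => ->.
by move: ab; rewrite le_eqVlt => /predU1P[->|->//]; rewrite ltxx subrr.
Qed.

End holder.

(** * Campanato's theorem: from mean-square oscillation to Hoelder continuity *)

Section campanato.
Context {R : realType}.
Notation mu := (@lebesgue_measure R).
Variables (al C0 : R) (u : R -> R) (m : R -> R -> R).
Hypothesis al0 : 0 < al.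
Hypothesis C0_ge0 : 0 <= C0.
Hypothesis mu_u : measurable_fun setT u.
Hypothesis m2pi : forall a L, m (a + 2 * pi) L = m a L.
Hypothesis Hm : forall a L : R, 0 < L -> L <= 2 * pi ->
  (\int[mu]_(s in `[a, (a + L)%R]) ((u s - m a L) ^+ 2)%:E <= (C0 * L `^ (1 + 2 * al))%:E)%E.

Let C1 := 4 * Num.sqrt C0.

Let C1_ge0 : 0 <= C1. Proof. by rewrite mulr_ge0// sqrtr_ge0. Qed.

Let mean_close (a L a' L' : R) : 0 < L' -> L <= 2 * pi -> L <= 4 * L' -> a <= a' -> a' + L' <= a + L ->
  `|m a L - m a' L'| <= C1 * L `^ al.
Proof.
move=> L'0 L2 LL aa' aL.
have LL' : L' <= L by lra.
have L0 : 0 < L by exact: lt_le_trans LL'.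
have msq k : measurable_fun setT (fun s => ((u s - k) ^+ 2)%:E).
  by measr.
have msq2 k : measurable_fun setT (fun s => (2%:E * ((u s - k) ^+ 2)%:E)%E).
  by apply: measurable_funeM.
have sq0 k s : (0 <= ((u s - k) ^+ 2)%:E)%E by rewrite lee_fin sqr_ge0.
have h : ((m a L - m a' L') ^+ 2 * L' <= 4 * C0 * L `^ (1 + 2 * al)).
  rewrite -lee_fin -[X in _ * X](_ : a' + L' - a' = _); last by ring.
  rewrite -integral_cst_itv; last by rewrite lerDl ltW.
  apply: (@le_trans _ _ (\int[mu]_(s in `[a', (a' + L')%R])
    (2%:E * ((u s - m a L) ^+ 2)%:E + 2%:E * ((u s - m a' L') ^+ 2)%:E)%E)%E).
    apply: ge0_le_integral_nomeas => s _; first by rewrite lee_fin sqr_ge0.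
    rewrite -!EFinM -EFinD lee_fin.
    by have := sqr_ge0 (u s - m a L + (u s - m a' L')); lra.
  rewrite ge0_integralD//; last 4 first.
  - by move=> s _; apply: mule_ge0.
  - by apply: measurable_funTS; exact: msq2.
  - by move=> s _; apply: mule_ge0.
  - by apply: measurable_funTS; exact: msq2.
  rewrite !ge0_integralZl//; try by apply: measurable_funTS; exact: msq.
  rewrite (_ : 4 * C0 * _ = 2 * (C0 * L `^ (1 + 2 * al)) + 2 * (C0 * L `^ (1 + 2 * al))); last by ring.
  rewrite -[leRHS]/(2%:E * (C0 * L `^ (1 + 2 * al))%:E + 2%:E * (C0 * L `^ (1 + 2 * al))%:E)%E; apply: leeD; apply: lee_wpmul2l; rewrite ?lee_fin//.
    apply: le_trans (Hm a L0 L2); apply: ge0_subset_integral_nomeas => //.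
    by apply: subset_itv; rewrite bnd_simp.
  apply: le_trans (Hm a' L'0 (le_trans LL' L2)) _.
  rewrite lee_fin ler_wpM2l//; apply: ge0_ler_powR; rewrite ?nnegrE ?(ltW L0) ?(ltW L'0)//.
  by rewrite addr_ge0// mulr_ge0// ltW.
rewrite -[leLHS]sqrtr_sqr -[leRHS]ger0_norm; last by rewrite mulr_ge0// powR_ge0.
rewrite -[leRHS]sqrtr_sqr ler_sqrt; last by rewrite sqr_ge0.
rewrite /C1 !exprMn sqr_sqrtr//.
have -> : (L `^ al) ^+ 2 = L `^ (2 * al).
  by rewrite -powR_mulrn ?powR_ge0// -powRrM mulrC.
rewrite -(ler_pM2r L'0); apply: (le_trans h).
rewrite powRD; last by rewrite (gt_eqF L0) implybT.
rewrite powRr1 ?(ltW L0)//.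
have X0 : 0 <= C0 * L `^ (2 * al) by rewrite mulr_ge0// powR_ge0.
rewrite (_ : 4 * C0 * _ = C0 * L `^ (2 * al) * (4 * L)); last by ring.
rewrite (_ : 4 ^+ 2 * C0 * _ * _ = C0 * L `^ (2 * al) * (4 * (4 * L'))); last by ring.
by apply: ler_wpM2l => //; rewrite ler_pM2l.
Qed.

Let Ln (n : nat) : R := 2 * pi / 2 ^+ n.

Let Ln_gt0 n : 0 < Ln n.
Proof. by rewrite divr_gt0 ?twopi_gt0// exprn_gt0. Qed.

Let LnS n : Ln n = 2 * Ln n.+1.
Proof. by rewrite /Ln exprS; field; rewrite expf_neq0. Qed.

Let Ln_le n : Ln n <= 2 * pi.
Proof.
elim: n => [|n]; first by rewrite /Ln expr0 divr1.
by rewrite LnS; have := Ln_gt0 n.+1; lra.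
Qed.

Let q : R := 2^-1 `^ al.

Let q_gt0 : 0 < q. Proof. by rewrite powR_gt0. Qed.

Let q_lt1 : q < 1.
Proof.
have -> : 1 = 1 `^ al :> R by rewrite powR1.
by apply: gt0_ltr_powR => //; rewrite ?nnegrE// invf_lt1// ltr1n.
Qed.

Let Ln_pow n : Ln n `^ al = (2 * pi) `^ al * q ^+ n.
Proof.
elim: n => [|n IH]; first by rewrite /Ln !expr0 divr1 mulr1.
have -> : Ln n.+1 = Ln n * 2^-1 by rewrite (LnS n); field.
by rewrite powRM ?(ltW (Ln_gt0 n))// IH exprSr mulrA.
Qed.

(** The sum of the geometric series [C1 * q ^+ k]: it bounds the total drift of the dyadic means
    from one scale down to 0. *)
Let K0 := C1 / (1 - q).

Let K0_ge0 : 0 <= K0.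
Proof. by rewrite divr_ge0// subr_ge0 ltW. Qed.

Let lo th n := m th (Ln n) - K0 * Ln n `^ al.
Let hi th n := m th (Ln n) + K0 * Ln n `^ al.

Let step th n : `|m th (Ln n) - m th (Ln n.+1)| <= (1 - q) * K0 * Ln n `^ al.
Proof.
have -> : (1 - q) * K0 = C1 by rewrite /K0 mulrC divfK// gt_eqF// subr_gt0.
apply: mean_close => //.
- by rewrite (LnS n); have := Ln_gt0 n.+1; lra.
- by rewrite (LnS n); have := Ln_gt0 n.+1; lra.
Qed.

Let LnqS n : Ln n.+1 `^ al = q * Ln n `^ al.
Proof. by rewrite !Ln_pow exprS mulrCA. Qed.

(** The bound in [step] equals [K0 * (Ln n]^ al - Ln n.+1 [^ al)], which makes [lo] nondecreasing
    and [hi] nonincreasing: the intervals [[lo, hi]] are nested. *)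
Let lohi th n k : lo th n <= hi th k.
Proof.
have lo_nd j : lo th j <= lo th j.+1.
  have := step th j; rewrite /lo LnqS ler_norml => /andP[_ h].
  by move: h; set X := _ `^ _; lra.
have hi_ni j : hi th j.+1 <= hi th j.
  have := step th j; rewrite /hi LnqS ler_norml => /andP[h _].
  by move: h; set X := _ `^ _; lra.
have lo_mono j l : (j <= l)%N -> lo th j <= lo th l.
  by elim: l => [|l IH]; [rewrite leqn0 => /eqP ->|rewrite leq_eqVlt ltnS => /predU1P[->//|/IH h]; exact: le_trans h _].
have hi_mono j l : (j <= l)%N -> hi th l <= hi th j.
  by elim: l => [|l IH]; [rewrite leqn0 => /eqP ->|rewrite leq_eqVlt ltnS => /predU1P[->//|/IH h]; exact: le_trans _ h].
apply: (le_trans (lo_mono _ (maxn n k) (leq_maxl _ _))).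
apply: le_trans (hi_mono _ (maxn n k) (leq_maxr _ _)).
by rewrite /lo /hi lerD2l; apply: (@le_trans _ _ 0); rewrite ?oppr_le0 mulr_ge0// powR_ge0.
Qed.

(** The limit of the means over shrinking intervals with left end [th]. As a supremum it lies in all
    the nested intervals at once, which yields the rate of convergence directly. *)
Let v th := sup (range (lo th)).

Let v_close th n : `|v th - m th (Ln n)| <= K0 * Ln n `^ al.
Proof.
rewrite ler_distl; apply/andP; split.
  apply: ub_le_sup; last by exists n.
  by exists (hi th 0) => _ [k _ <-]; exact: lohi.
by apply: ge_sup; [exists (lo th 0); exists 0%N|move=> _ [k _ <-]; exact: lohi].
Qed.

Let scale (L : R) : 0 < L -> L <= 2 * pi -> exists n, Ln n.+1 < L /\ L <= Ln n.
Proof.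
move=> L0 L2.
have ex : exists n, Ln n < L.
  exists (Num.bound (2 * pi / L)); rewrite /Ln ltr_pdivrMr ?exprn_gt0// [ltRHS]mulrC -ltr_pdivrMr//.
  apply: lt_trans (archi_boundP _) _; first by rewrite divr_ge0 ?(ltW L0)// ltW// twopi_gt0.
  by rewrite -natrX ltr_nat ltn_expl.
have := ex_minnP ex; case=> [[|n] h1 h2].
  by move: h1; rewrite /Ln expr0 divr1 ltNge L2.
exists n; split => //; rewrite leNgt; apply/negP => /h2; by rewrite ltnn.
Qed.

Let K2 := 2 `^ al * (K0 + C1).

Let K2_ge0 : 0 <= K2. Proof. by rewrite mulr_ge0 ?powR_ge0 ?addr_ge0. Qed.

Let v_mean th (L : R) : 0 < L -> L <= 2 * pi -> `|v th - m th L| <= K2 * L `^ al.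
Proof.
move=> L0 L2; have [n [Ln1 Ln2]] := scale L0 L2.
have h1 := v_close th n.
have h2 : `|m th (Ln n) - m th L| <= C1 * Ln n `^ al.
  apply: mean_close => //; last by rewrite lerD2l.
  by rewrite LnS; lra.
have h3 : Ln n `^ al <= 2 `^ al * L `^ al.
  rewrite -powRM// ?(ltW L0)//; apply: ge0_ler_powR; rewrite ?nnegrE ?(ltW al0) ?(ltW (Ln_gt0 n))//.
    by rewrite mulr_ge0// ltW.
  by rewrite LnS; lra.
rewrite (_ : v th - m th L = (v th - m th (Ln n)) + (m th (Ln n) - m th L)); last by ring.
apply: (le_trans (ler_normD _ _)); apply: (le_trans (lerD h1 h2)).
rewrite -mulrDl /K2 -[leRHS]mulrA mulrCA; apply: ler_wpM2l => //.
by rewrite addr_ge0.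
Qed.

Let K3 := 2 * (2 `^ al * (K2 + C1) + K2).

Let K3_ge0 : 0 <= K3.
Proof. by rewrite mulr_ge0// addr_ge0// mulr_ge0 ?powR_ge0// addr_ge0. Qed.

(** With [d = t - s], the interval [[s, s + 2 d]] contains [[t, t + d]], so both values are compared
    with the means over these two. The length [2 d] must not exceed a period, hence the restriction
    to distance [pi]. *)
Let v_holder_pi (s t : R) : s < t -> t - s <= pi -> `|v s - v t| <= K3 / 2 * (t - s) `^ al.
Proof.
move=> st ts; set d := t - s; have d0 : 0 < d by rewrite subr_gt0.
have dp : 2 * d <= 2 * pi by rewrite ler_pM2l.
have d20 : 0 < 2 * d by rewrite mulr_gt0.
have h1 := v_mean s d20 dp.
have h3 : `|v t - m t d| <= K2 * d `^ al.
  by apply: v_mean => //; have := @pi_gt0 R; rewrite -/d in ts; lra.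
have h2 : `|m s (2 * d) - m t d| <= C1 * (2 * d) `^ al.
  by apply: mean_close => //; rewrite ?(ltW st)//; rewrite /d; lra.
have e : (2 * d) `^ al = 2 `^ al * d `^ al by rewrite powRM// ltW.
rewrite (_ : v s - v t = (v s - m s (2 * d)) + (m s (2 * d) - m t d) - (v t - m t d)); last by ring.
apply: (le_trans (ler_normB _ _)).
apply: (le_trans (lerD (le_trans (ler_normD _ _) (lerD h1 h2)) h3)).
rewrite e /K3; set X := d `^ al; set Y := 2 `^ al.
by apply: eq_leW; field.
Qed.

(** Passing through the midpoint doubles the admissible distance and costs the factor 2 in [K3]. *)
Let v_holder (s t : R) : `|s - t| <= 2 * pi -> `|v s - v t| <= K3 * `|s - t| `^ al.
Proof.
wlog st : s t / s <= t.
  move=> H h; have [st|/ltW ts] := leP s t; first exact: H.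
  by rewrite distrC [X in _ * X `^ _]distrC; apply: H => //; rewrite distrC.
move: st; rewrite le_eqVlt => /predU1P[->|st].
  by move=> _; rewrite !subrr normr0 mulr_ge0// powR_ge0.
rewrite distrC (gtr0_norm (_ : 0 < t - s)) ?subr_gt0// => h.
pose r := (s + t) / 2.
have sr : s < r by rewrite /r; lra.
have rt : r < t by rewrite /r; lra.
have h1 : `|v s - v r| <= K3 / 2 * (r - s) `^ al by apply: v_holder_pi => //; rewrite /r; lra.
have h2 : `|v r - v t| <= K3 / 2 * (t - r) `^ al by apply: v_holder_pi => //; rewrite /r; lra.
have mono x : 0 <= x -> x <= t - s -> K3 / 2 * x `^ al <= K3 / 2 * (t - s) `^ al.
  move=> x0 xts; apply: ler_wpM2l; first by rewrite divr_ge0.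
  by apply: ge0_ler_powR; rewrite ?nnegrE ?(ltW al0)//; exact: le_trans xts.
have -> : v s - v t = (v s - v r) + (v r - v t) by ring.
apply: (le_trans (ler_normD _ _)).
apply: (le_trans (lerD (le_trans h1 (mono _ _ _)) (le_trans h2 (mono _ _ _)))); rewrite ?subr_ge0 ?(ltW sr) ?(ltW rt) ?lerD2l ?lerD2r ?lerN2 ?(ltW sr) ?(ltW rt)//.
by rewrite -mulrDl -splitr.
Qed.

Let v2pi th : v (th + 2 * pi) = v th.
Proof. have e : lo (th + 2 * pi) = lo th by apply/funext => n; rewrite /lo m2pi.
by rewrite /v e. Qed.

Let holder_v : holder_periodic al v.
Proof. by split; [exact: v2pi|exists K3; [exact: K3_ge0|exact: v_holder]]. Qed.

Let mv : measurable_fun setT v. Proof. exact: (holder_measurable al0 holder_v). Qed.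

Let K4 := 2 * C0 + 2 * (K2 + K3) ^+ 2.

Let K4_ge0 : 0 <= K4. Proof. by rewrite addr_ge0// mulr_ge0// sqr_ge0. Qed.

Let E a L := (\int[mu]_(s in `[a, (a + L)%R]) ((u s - v s) ^+ 2)%:E)%E.

(** Both [u] and [v] are compared with the constant [m a L], [u] in mean square and [v] uniformly
    through its value at [a]. *)
Let E_le (a L : R) : 0 < L -> L <= 2 * pi -> (E a L <= (K4 * L `^ (1 + 2 * al))%:E)%E.
Proof.
move=> L0 L2; rewrite /E.
have msq : measurable_fun setT (fun s => (2%:E * ((u s - m a L) ^+ 2)%:E)%E).
  by apply: measurable_funeM; measr.
apply: (@le_trans _ _ (\int[mu]_(s in `[a, (a + L)%R])
  (2%:E * ((u s - m a L) ^+ 2)%:E + (2 * ((K2 + K3) * L `^ al) ^+ 2)%:E)%E)%E).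
  apply: ge0_le_integral_nomeas => s /=; first by rewrite lee_fin sqr_ge0.
  rewrite in_itv/= => /andP[as_ sa]; rewrite -EFinM -EFinD lee_fin.
  have h1 := v_mean a L0 L2.
  have h2 : `|v a - v s| <= K3 * L `^ al.
    have asL : `|a - s| <= L by rewrite distrC ger0_norm ?subr_ge0//; lra.
    apply: (le_trans (v_holder (le_trans asL L2))); apply: ler_wpM2l => //.
    by apply: ge0_ler_powR; rewrite ?nnegrE ?(ltW al0) ?(ltW L0).
  have h3 : `|m a L - v s| <= (K2 + K3) * L `^ al.
    have -> : m a L - v s = (v a - v s) - (v a - m a L) by ring.
    by apply: (le_trans (ler_normB _ _)); rewrite mulrDl addrC; apply: lerD.
  have h4 : (m a L - v s) ^+ 2 <= ((K2 + K3) * L `^ al) ^+ 2.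
    by rewrite -(real_normK (num_real (m a L - v s))); rewrite ler_sqr ?nnegrE// mulr_ge0 ?powR_ge0// addr_ge0.
  have := sqr_ge0 ((u s - m a L) - (m a L - v s)).
  by lra.
rewrite ge0_integralD//; last 3 first.
- by move=> s _; apply: mule_ge0 => //; rewrite lee_fin sqr_ge0.
- exact: measurable_funTS.
- by move=> s _; rewrite lee_fin mulr_ge0// sqr_ge0.
rewrite ge0_integralZl//; last 2 first.
- by apply: measurable_funTS; measr.
- by move=> s _; rewrite lee_fin sqr_ge0.
rewrite integral_cst_itv; last by rewrite lerDl ltW.
have -> : K4 * L `^ (1 + 2 * al) = 2 * (C0 * L `^ (1 + 2 * al)) + 2 * ((K2 + K3) * L `^ al) ^+ 2 * (a + L - a).
  rewrite exprMn -(powR_mulrn 2 (powR_ge0 L al)) -powRrM powRD; last by rewrite (gt_eqF L0) implybT.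
  by rewrite powRr1 ?(ltW L0)// /K4 (mulrC al); ring.
rewrite -[leRHS]/(2%:E * (C0 * L `^ (1 + 2 * al))%:E + (2 * ((K2 + K3) * L `^ al) ^+ 2 * (a + L - a))%:E)%E.
by apply: leeD => //; apply: lee_wpmul2l => //; exact: Hm.
Qed.

Let p := 2^-1 `^ (2 * al).

(* [E] is additive in the arc and [1 + 2 al > 1], so each halving of the arc
   gains a factor [p < 1]; hence [E = 0]. *)
Let E_iter n (a L : R) : 0 < L -> L <= 2 * pi -> (E a L <= (K4 * L `^ (1 + 2 * al) * p ^+ n)%:E)%E.
Proof.
elim: n a L => [|n IH] a L L0 L2; first by rewrite expr0 mulr1; exact: E_le.
have L20 : 0 < L / 2 by rewrite divr_gt0.
rewrite /E (@integral_itv_split _ a (a + L / 2) (a + L)); [|lra|lra| |]; last 2 first.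
- by measr.
- by move=> s; rewrite lee_fin sqr_ge0.
have := IH a (L / 2) L20; have := IH (a + L / 2) (L / 2) L20.
rewrite /E -addrA -splitr => h2 h1.
have L22 : L / 2 <= 2 * pi by lra.
have := leeD (h1 L22) (h2 L22) => /le_trans; apply.
rewrite -EFinD lee_fin (powRM _ (ltW L0)); last by rewrite invr_ge0.
rewrite [2^-1 `^ (1 + 2 * al)]powRD; last by rewrite invr_eq0 pnatr_eq0 implybT.
rewrite powRr1 ?invr_ge0// -/p exprS.
by apply: eq_leW; field.
Qed.

Let E_eq0 a : E a (2 * pi) = 0%E.
Proof.
have E0 : (0 <= E a (2 * pi))%E by apply: integral_ge0 => s _; rewrite lee_fin sqr_ge0.
have h n := @E_iter n a _ (@twopi_gt0 R) (lexx _).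
apply/eqP; rewrite eq_le E0 andbT.
move: E0 h; case: (E a (2 * pi)) => [e| |] //; last by move=> _ /(_ 0%N).
rewrite !lee_fin => e0; set K := K4 * _ => h.
have p0 : 0 <= p by exact: powR_ge0.
have p1 : `|p| < 1.
  rewrite ger0_norm//; have -> : 1 = 1 `^ (2 * al) :> R by rewrite powR1.
  by apply: gt0_ltr_powR; rewrite ?mulr_gt0 ?nnegrE// invf_lt1// ltr1n.
have c0 : K * p ^+ n @[n --> \oo] --> K * 0.
  by apply: cvgMr; exact: cvg_expr.
rewrite mulr0 in c0.
have <- : limn (fun n => K * p ^+ n) = 0 by apply/cvg_lim.
by apply: limr_ge; [apply/cvg_ex; exists 0|apply: nearW => n; exact: h].
Qed.

Lemma campanato : exists2 w, holder_periodic al w & {ae mu, forall s, u s = w s}.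
Proof.
exists v => //.
have null a : mu.-negligible (`[a, (a + 2 * pi)%R] `&` [set s | u s <> v s]).
  have mf : measurable_fun (`[a, (a + 2 * pi)%R]%classic : set (measurableTypeR R)) (fun s => ((u s - v s) ^+ 2)%:E).
    by apply: measurable_funTS; measr.
  have i0 : (\int[mu]_(s in `[a, (a + 2 * pi)%R]) `|((u s - v s) ^+ 2)%:E| = 0)%E.
    rewrite -(E_eq0 a); apply: eq_integral => s _; rewrite gee0_abs// lee_fin sqr_ge0//.
  have h := proj1 (ae_eq_integral_abs (lebesgue_measure : {measure set (measurableTypeR R) -> \bar R}) (measurable_itv _) mf) i0.
  apply: negligibleS h => s [] /= sI suv h; apply: suv.
  by move: (h sI) => -[] /eqP; rewrite sqrf_eq0 subr_eq0 => /eqP.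
(* The line is covered by periods starting at the nonnegative ([N1]) and the negative ([N2])
   multiples of [2 pi]. *)
have N1 : mu.-negligible (\bigcup_(n : nat) (`[n%:R * (2 * pi), (n%:R * (2 * pi) + 2 * pi)%R] `&` [set s | u s <> v s])).
  by apply: negligible_bigcup => n; exact: null.
have N2 : mu.-negligible (\bigcup_(n : nat) (`[(- (n.+1%:R * (2 * pi))), (- (n.+1%:R * (2 * pi)) + 2 * pi)%R] `&` [set s | u s <> v s])).
  by apply: negligible_bigcup => n; exact: null.
apply: negligibleS (negligibleU N1 N2) => s /= uv.
have [k /andP[k1 k2]] := periodic_repr 0 s (@twopi_gt0 R).
rewrite add0r in k2.
case: k k1 k2 => n; last first.
  rewrite NegzE mulrNz mulNr => k1 k2; left; exists n.+1 => //; split => //=.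
  by rewrite in_itv/=; lra.
move=> k1 k2; case: n k1 k2 => [|n] k1 k2.
  left; exists 0%N => //; split => //=; rewrite in_itv/= mul0r.
  by rewrite mul0r in k1 k2; lra.
by right; exists n => //; split => //=; rewrite in_itv/= -[n.+1%:R]/(n.+1%:~R); lra.
Qed.

End campanato.

(** * The Poisson kernel *)

Section continuity_tools.
Context {R : realType}.
Implicit Types (f g : R -> R) (x : R).

Lemma cts_cst (c x : R) : continuous_at x (fun _ : R => c).
Proof. exact: cvg_cst. Qed.

Lemma cts_id x : continuous_at x (fun y : R => y).
Proof. exact: cvg_id. Qed.

Lemma cts_mul f g x : continuous_at x f -> continuous_at x g ->
  continuous_at x (fun y => f y * g y).
Proof. by move=> cf cg; exact: cvgM. Qed.

Lemma cts_add f g x : continuous_at x f -> continuous_at x g ->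
  continuous_at x (fun y => f y + g y).
Proof. by move=> cf cg; exact: cvgD. Qed.

Lemma cts_opp f x : continuous_at x f -> continuous_at x (fun y => - f y).
Proof. by move=> cf; exact: cvgN. Qed.

Lemma cts_inv f x : f x != 0 -> continuous_at x f -> continuous_at x (fun y => (f y)^-1).
Proof. by move=> f0 cf; exact: cvgV. Qed.

Lemma cts_exp f (n : nat) x : continuous_at x f -> continuous_at x (fun y => f y ^+ n).
Proof.
move=> cf; elim: n => [|n IH]; first exact: cvg_cst.
have -> : (fun y => f y ^+ n.+1) = (fun y => f y * f y ^+ n) by apply/funext => y; rewrite exprS.
exact: cts_mul.
Qed.

Lemma cts_cos f x : continuous_at x f -> continuous_at x (fun y => cos (f y)).
Proof. by move=> cf; apply: (continuous_comp cf); exact: continuous_cos. Qed.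

Lemma cts_sin f x : continuous_at x f -> continuous_at x (fun y => sin (f y)).
Proof. by move=> cf; apply: (continuous_comp cf); exact: continuous_sin. Qed.

Lemma cts_norm f x : continuous_at x f -> continuous_at x (fun y => `|f y|).
Proof. by move=> cf; apply: (continuous_comp cf); exact: norm_continuous. Qed.

Lemma is_derive_continuous f (x d : R) : is_derive x 1 f d -> {for x, continuous f}.
Proof. by case=> df _; apply: differentiable_continuous; exact/derivable1_diffP. Qed.

Lemma measurable_Rintegral_in d (T : measurableType d) (B : set R) (k : T -> R -> R) :
  measurable B -> measurable_fun [set: T * R] (fun z => k z.1 z.2) ->
  measurable_fun setT (fun z => \int[@lebesgue_measure R]_(y in B) k z y).
Proof.
move=> mB mk; rewrite /Rintegral; apply: measurableT_comp => //.
under eq_fun do rewrite integralE.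
apply: emeasurable_funB; apply: measurable_integral_in => //.
- have h : measurable_fun [set: T * R] ((fun z : T * R => (k z.1 z.2)%:E)^\+)%E.
    by apply: measurable_funepos; exact/measurable_EFinP.
  by apply: eq_measurable_fun h => z _; rewrite unlock.
- have h : measurable_fun [set: T * R] ((fun z : T * R => (k z.1 z.2)%:E)^\-)%E.
    by apply: measurable_funeneg; exact/measurable_EFinP.
  by apply: eq_measurable_fun h => z _; rewrite unlock.
Qed.

End continuity_tools.

Ltac cts1 := lazymatch goal with
  | |- continuous_at _ (fun _ => ?c) => exact: cts_cst
  | |- continuous_at _ (fun y => y) => exact: cts_id
  | |- continuous_at _ (fun _ => (_ + _)%R) => apply: cts_add
  | |- continuous_at _ (fun _ => (- _)%R) => apply: cts_opp
  | |- continuous_at _ (fun _ => (_ * _)%R) => apply: cts_mul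
  | |- continuous_at _ (fun _ => (_ ^+ _)%R) => apply: cts_exp
  | |- continuous_at _ (fun _ => (_ ^-1)%R) => apply: cts_inv
  | |- continuous_at _ (fun _ => cos _) => apply: cts_cos
  | |- continuous_at _ (fun _ => sin _) => apply: cts_sin
  | |- continuous_at _ cos => exact: continuous_cos
  | |- continuous_at _ sin => exact: continuous_sin
  | |- continuous_at _ (fun _ => `|_|) => apply: cts_norm
  end.
Ltac cts := cbv beta delta [prop_for]; repeat cts1; try assumption;
  try match goal with H : continuous ?u |- continuous_at _ ?u => exact: H end.

(** * The kernel, its gradient, and its integrals *)

Section poisson_kernel.
Context {R : realType}.
Notation mu := (@lebesgue_measure R).
Implicit Types (x y t r th : R) (u : R -> R).

(** With [z = x + i y] and [zeta = e^(it)], [den] is [|zeta - z|^2], [Pk] is the Poisson kernel, and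
    [Pkx], [Pky] are its partial derivatives in [x] and [y]. *)
Definition den x y t : R := (cos t - x) ^+ 2 + (sin t - y) ^+ 2.
Definition Pk x y t : R := (1 - x ^+ 2 - y ^+ 2) / den x y t.
Definition Pkx x y t : R :=
  2 * ((1 - x ^+ 2 - y ^+ 2) * (cos t - x) - x * den x y t) / den x y t ^+ 2.
Definition Pky x y t : R :=
  2 * ((1 - x ^+ 2 - y ^+ 2) * (sin t - y) - y * den x y t) / den x y t ^+ 2.

(** The reverse triangle inequality [|zeta - z| >= 1 - |z|]; the inner product of [z] and [zeta] is
    bounded by [|z|] through Lagrange's identity. *)
Lemma den_ge (rho x y t : R) : 0 <= rho <= 1 -> x ^+ 2 + y ^+ 2 <= rho ^+ 2 ->
  (1 - rho) ^+ 2 <= den x y t.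
Proof.
move=> /andP[r0 r1] xy.
have cs := cos2Dsin2 t; rewrite /den.
set c := cos t in cs *; set s := sin t in cs *.
pose n := Num.sqrt (x ^+ 2 + y ^+ 2).
have n0 : 0 <= n by exact: sqrtr_ge0.
have nE : n ^+ 2 = x ^+ 2 + y ^+ 2 by rewrite sqr_sqrtr// addr_ge0// sqr_ge0.
have nr : n <= rho by rewrite -ler_sqr ?nnegrE// nE.
have mn : x * c + y * s <= n.
  apply: le_trans (ler_norm _) _; rewrite -ler_sqr ?nnegrE// real_normK ?num_real// nE.
  rewrite -subr_ge0 (_ : _ - _ = (x * s - y * c) ^+ 2 + (x ^+ 2 + y ^+ 2) * (1 - (c ^+ 2 + s ^+ 2))); last by ring.
  by rewrite cs subrr mulr0 addr0 sqr_ge0.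
have h : (1 - rho) ^+ 2 <= (1 - n) ^+ 2 by rewrite ler_sqr ?nnegrE; lra.
apply: (le_trans h).
have -> : (c - x) ^+ 2 + (s - y) ^+ 2 = (c ^+ 2 + s ^+ 2) - 2 * (x * c + y * s) + (x ^+ 2 + y ^+ 2) by ring.
rewrite cs -nE; have -> : (1 - n) ^+ 2 = 1 - 2 * n + n ^+ 2 by ring.
lra.
Qed.

Lemma den_gt0 x y t : x ^+ 2 + y ^+ 2 < 1 -> 0 < den x y t.
Proof.
move=> xy; pose n := Num.sqrt (x ^+ 2 + y ^+ 2).
have n0 : 0 <= n by exact: sqrtr_ge0.
have nE : n ^+ 2 = x ^+ 2 + y ^+ 2 by rewrite sqr_sqrtr// addr_ge0// sqr_ge0.
have n1 : n < 1 by rewrite -ltr_sqr ?nnegrE// nE expr1n.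
apply: lt_le_trans (@den_ge n x y t _ _).
- by rewrite exprn_gt0// subr_gt0.
- by rewrite n0 ltW.
- by rewrite nE.
Qed.

Lemma den_ge0 x y t : 0 <= den x y t.
Proof. by rewrite addr_ge0// sqr_ge0. Qed.

(** The kernel is the real part of the holomorphic function [(zeta + z) / (zeta - z)], whose
    derivative [2 zeta / (zeta - z)^2] has modulus [2 / |zeta - z|^2]. *)
Lemma Pk_grad_sq x y t : x ^+ 2 + y ^+ 2 < 1 ->
  Pkx x y t ^+ 2 + Pky x y t ^+ 2 = (2 / den x y t) ^+ 2.
Proof.
move=> xy; have d0 := den_gt0 t xy; have dn : den x y t != 0 by rewrite gt_eqF.
have cs := cos2Dsin2 t.
rewrite /Pkx /Pky.
have e : ((1 - x ^+ 2 - y ^+ 2) * (cos t - x) - x * den x y t) ^+ 2 +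
   ((1 - x ^+ 2 - y ^+ 2) * (sin t - y) - y * den x y t) ^+ 2 = den x y t ^+ 2.
  apply/eqP; rewrite -subr_eq0.
  rewrite (_ : _ - _ = den x y t * (1 - (cos t ^+ 2 + sin t ^+ 2)) * (1 - x ^+ 2 - y ^+ 2)); last first.
    by rewrite /den; ring.
  by rewrite cs subrr mulr0 mul0r.
rewrite !exprMn -mulrDl -mulrDr e; field.
by rewrite dn.
Qed.

Lemma Pkx_le x y t : x ^+ 2 + y ^+ 2 < 1 -> `|Pkx x y t| <= 2 / den x y t.
Proof.
move=> xy; rewrite -ler_sqr ?nnegrE ?divr_ge0 ?den_ge0// real_normK ?num_real//.
by rewrite -Pk_grad_sq// lerDl sqr_ge0.
Qed.

Lemma Pky_le x y t : x ^+ 2 + y ^+ 2 < 1 -> `|Pky x y t| <= 2 / den x y t.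
Proof.
move=> xy; rewrite -ler_sqr ?nnegrE ?divr_ge0 ?den_ge0// real_normK ?num_real//.
by rewrite -Pk_grad_sq// lerDr sqr_ge0.
Qed.

Lemma Pk_cts x y t : x ^+ 2 + y ^+ 2 < 1 -> {for t, continuous (Pk x y)}.
Proof.
by move=> xy; have dn := lt0r_neq0 (den_gt0 t xy); rewrite /Pk /den in dn *; cts.
Qed.

Lemma Pkx_cts x y t : x ^+ 2 + y ^+ 2 < 1 -> {for t, continuous (Pkx x y)}.
Proof.
move=> xy; have dn := lt0r_neq0 (den_gt0 t xy); have dn2 := expf_neq0 2 dn.
by rewrite /Pkx /den in dn2 *; cts.
Qed.

Lemma Pky_cts x y t : x ^+ 2 + y ^+ 2 < 1 -> {for t, continuous (Pky x y)}.
Proof.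
move=> xy; have dn := lt0r_neq0 (den_gt0 t xy); have dn2 := expf_neq0 2 dn.
by rewrite /Pky /den in dn2 *; cts.
Qed.

(** This is [2 pi] times the Poisson extension of [u]; the normalizing factor is restored in
    [poissonE]. *)
Definition PI u x y : R := \int[mu]_(t in `[0%R, (2 * pi)%R]) (u t * Pk x y t).
Definition PIx u x y : R := \int[mu]_(t in `[0%R, (2 * pi)%R]) (u t * Pkx x y t).
Definition PIy u x y : R := \int[mu]_(t in `[0%R, (2 * pi)%R]) (u t * Pky x y t).

Lemma cts_integrable (a b : R) (f : R -> R) : continuous f ->
  mu.-integrable `[a, b] (EFin \o f).
Proof.
move=> cf; apply: continuous_compact_integrable; first exact: segment_compact.
exact: continuous_subspaceT.
Qed.

Lemma measurable_den : measurable_fun [set: (R * R) * R] (fun z => den z.1.1 z.1.2 z.2).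
Proof. by rewrite /den; measr. Qed.

Lemma measurable_PIx u : measurable_fun setT u ->
  measurable_fun [set: R * R] (fun z => PIx u z.1 z.2).
Proof.
move=> mu_; apply: (@measurable_Rintegral_in R _ (R * R)%type _ (fun z t => u t * Pkx z.1 z.2 t)) => //.
by have m := measurable_den; rewrite /Pkx; measr.
Qed.

Lemma measurable_PIy u : measurable_fun setT u ->
  measurable_fun [set: R * R] (fun z => PIy u z.1 z.2).
Proof.
move=> mu_; apply: (@measurable_Rintegral_in R _ (R * R)%type _ (fun z t => u t * Pky z.1 z.2 t)) => //.
by have m := measurable_den; rewrite /Pky; measr.
Qed.

Lemma is_derive_Pk_path (x y : R -> R) (dx dy s t : R) :
  is_derive s 1 x dx -> is_derive s 1 y dy -> x s ^+ 2 + y s ^+ 2 < 1 ->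
  is_derive s 1 (fun s => Pk (x s) (y s) t) (dx * Pkx (x s) (y s) t + dy * Pky (x s) (y s) t).
Proof.
move=> hx hy xy; have d0 := den_gt0 t xy; have dn : den (x s) (y s) t != 0 by rewrite gt_eqF.
rewrite /Pk.
have hd : is_derive s 1 (fun s => den (x s) (y s) t)
    (- (2 * (cos t - x s) * dx) - 2 * (sin t - y s) * dy).
  rewrite /den; apply: is_derive_eq.
  by rewrite /GRing.scale/=; ring.
apply: is_derive_eq.
rewrite /Pkx /Pky /GRing.scale/=.
by field; rewrite dn.
Qed.

(** The derivative [2 zeta / (zeta - z)^2] of [(zeta + z) / (zeta - z)] in [z] is also the
    derivative in [t] of [2 i / (zeta - z)]. The real part of the latter is the periodic primitive
    used here, and minus its imaginary part is the one used for [Pky]. *)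
Lemma integral_Pkx x y : x ^+ 2 + y ^+ 2 < 1 ->
  \int[mu]_(t in `[0%R, (2 * pi)%R]) Pkx x y t = 0.
Proof.
move=> xy.
have dF t : 0 <= t <= 2 * pi -> is_derive t 1 (fun t => 2 * (sin t - y) / den x y t) (Pkx x y t).
  move=> _; have d0 := den_gt0 t xy; have dn : den x y t != 0 by rewrite gt_eqF.
  have hd : is_derive t 1 (fun t => den x y t) (2 * (cos t - x) * - sin t + 2 * (sin t - y) * cos t).
    by rewrite /den; apply: is_derive_eq; rewrite /GRing.scale/=; ring.
  apply: is_derive_eq.
  rewrite /Pkx /GRing.scale/= -[X in X - x ^+ 2](cos2Dsin2 t) /den.
  by field; move: dn; rewrite /den.
rewrite /Rintegral (ftc2 (ltW twopi_gt0) dF); last by move=> t _; exact: Pkx_cts.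
rewrite /= /den -[2 * pi]add0r [2 * pi]mulr_natl.
by rewrite sinD2pi cosD2pi subrr.
Qed.

Lemma integral_Pky x y : x ^+ 2 + y ^+ 2 < 1 ->
  \int[mu]_(t in `[0%R, (2 * pi)%R]) Pky x y t = 0.
Proof.
move=> xy.
have dF t : 0 <= t <= 2 * pi -> is_derive t 1 (fun t => - (2 * (cos t - x) / den x y t)) (Pky x y t).
  move=> _; have d0 := den_gt0 t xy; have dn : den x y t != 0 by rewrite gt_eqF.
  have hd : is_derive t 1 (fun t => den x y t) (2 * (cos t - x) * - sin t + 2 * (sin t - y) * cos t).
    by rewrite /den; apply: is_derive_eq; rewrite /GRing.scale/=; ring.
  apply: is_derive_eq.
  rewrite /Pky /GRing.scale/= -[X in X - x ^+ 2](cos2Dsin2 t) /den.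
  by field; move: dn; rewrite /den.
rewrite /Rintegral (ftc2 (ltW twopi_gt0) dF); last by move=> t _; exact: Pky_cts.
rewrite /= /den -[2 * pi]add0r [2 * pi]mulr_natl.
by rewrite sinD2pi cosD2pi subrr.
Qed.

(** * The extension along a path inside a smaller disc: rays, circles and straight lines are
    instances *)

Section path.
Variables (u x y dx dy : R -> R) (a b rho : R).
Hypothesis cu : continuous u.
Hypothesis hx : forall s, a < s < b -> is_derive s 1 x (dx s).
Hypothesis hy : forall s, a < s < b -> is_derive s 1 y (dy s).
Hypothesis dx1 : forall s, a < s < b -> `|dx s| <= 1.
Hypothesis dy1 : forall s, a < s < b -> `|dy s| <= 1.
Hypothesis rho0 : 0 <= rho.
Hypothesis rho1 : rho < 1.
Hypothesis xy : forall s, a < s < b -> x s ^+ 2 + y s ^+ 2 <= rho ^+ 2.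

Let xy1 s : a < s < b -> x s ^+ 2 + y s ^+ 2 < 1.
Proof. by move=> /xy h; apply: le_lt_trans h _; rewrite expr_lt1. Qed.

(** The majorant for differentiation under the integral: along the path each of the two partial
    derivatives of the kernel is at most [2 / (1 - rho) ^+ 2], by [den_ge]. *)
Let G t := `|u t| * (4 / (1 - rho) ^+ 2).

Let G_int : mu.-integrable `[0%R, (2 * pi)%R] (EFin \o G).
Proof.
by apply: cts_integrable => t; rewrite /G; cts.
Qed.

Let dP s t := u t * (dx s * Pkx (x s) (y s) t + dy s * Pky (x s) (y s) t).

Let dP_le s t : a < s < b -> `|dP s t| <= G t.
Proof.
move=> sab; rewrite /dP /G normrM; apply: ler_wpM2l => //.
have d := @den_ge rho _ _ t (introT andP (conj rho0 (ltW rho1))) (xy sab).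
have d1 : 0 < (1 - rho) ^+ 2 by rewrite exprn_gt0// subr_gt0.
have h0 : 2 / den (x s) (y s) t <= 2 / (1 - rho) ^+ 2.
  by rewrite ler_pM2l// lef_pV2 ?posrE// (lt_le_trans d1).
have h1 : `|dx s * Pkx (x s) (y s) t| <= 2 / (1 - rho) ^+ 2.
  rewrite normrM; apply: (@le_trans _ _ (1 * `|Pkx (x s) (y s) t|)).
    by apply: ler_wpM2r => //; exact: dx1.
  by rewrite mul1r; apply: le_trans (Pkx_le t (xy1 sab)) h0.
have h2 : `|dy s * Pky (x s) (y s) t| <= 2 / (1 - rho) ^+ 2.
  rewrite normrM; apply: (@le_trans _ _ (1 * `|Pky (x s) (y s) t|)).
    by apply: ler_wpM2r => //; exact: dy1.
  by rewrite mul1r; apply: le_trans (Pky_le t (xy1 sab)) h0.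
apply: (le_trans (ler_normD _ _)); apply: (le_trans (lerD h1 h2)).
by rewrite -mulrDl -natrD.
Qed.

Let int_dP s : a < s < b ->
  \int[mu]_(t in `[0%R, (2 * pi)%R]) dP s t = dx s * PIx u (x s) (y s) + dy s * PIy u (x s) (y s).
Proof.
move=> sab.
have cx : continuous (Pkx (x s) (y s)) by move=> t; exact: Pkx_cts (xy1 sab).
have cy : continuous (Pky (x s) (y s)) by move=> t; exact: Pky_cts (xy1 sab).
rewrite /PIx /PIy -!RintegralZl//; try by apply: cts_integrable => t; cts.
rewrite -RintegralD//; try by apply: cts_integrable => t; cts.
by apply: eq_Rintegral => t _; rewrite /dP; ring.
Qed.

Lemma is_derive_PI_path s : a < s < b ->
  is_derive s 1 (fun s => PI u (x s) (y s))
    (dx s * PIx u (x s) (y s) + dy s * PIy u (x s) (y s)).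
Proof.
move=> sab.
pose f s t := u t * Pk (x s) (y s) t.
have Is : `]a, b[%classic s by rewrite /= in_itv.
have fder s' t : a < s' < b -> is_derive s' 1 (fun s => f s t) (dP s' t).
  move=> s'ab; have h := is_derive_Pk_path t (hx s'ab) (hy s'ab) (xy1 s'ab).
  by rewrite /f /dP; apply: is_derive_eq; rewrite /GRing.scale/=; ring.
have p1 s' t : a < s' < b -> partial1of2 f s' t = dP s' t.
  by move=> s'ab; rewrite partial1of2E; have [_ ->] := fder s' t s'ab.
have h := @cvg_differentiation_under_integral R _ _ mu f `[0%R, (2 * pi)%R]%classic (measurable_itv _) s a b Is.
have {}h := h _ _ G _ G_int.
have {}h : h^-1 *: (PI u (x (h + s)) (y (h + s)) - PI u (x s) (y s)) @[h --> 0^'] -->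
    \int[mu]_(t in `[0%R, (2 * pi)%R]) partial1of2 f s t.
  apply: h.
  - move=> s' /=; rewrite in_itv/= => s'ab.
    have cP : continuous (Pk (x s') (y s')) by move=> t; exact: Pk_cts (xy1 s'ab).
    by apply: cts_integrable => t; rewrite /f; cts.
  - move=> s' t /=; rewrite in_itv/= => s'ab _.
    by have [] := fder s' t s'ab.
  - by move=> t; rewrite /G mulr_ge0// divr_ge0// sqr_ge0.
  - by move=> s' t /=; rewrite in_itv/= => s'ab _; rewrite p1//; exact: dP_le.
have e : \int[mu]_(t in `[0%R, (2 * pi)%R]) partial1of2 f s t =
   dx s * PIx u (x s) (y s) + dy s * PIy u (x s) (y s).
  by rewrite -int_dP//; apply: eq_Rintegral => t _; exact: p1.
rewrite e in h.
have der : derivable (fun s => PI u (x s) (y s)) s 1.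
  apply/cvg_ex; exists (dx s * PIx u (x s) (y s) + dy s * PIy u (x s) (y s)).
  by under eq_fun do rewrite scaler1.
apply: DeriveDef => //; rewrite -derive1E /derive1.
exact/cvg_lim.
Qed.

Hypothesis cdx : forall s, a < s < b -> {for s, continuous dx}.
Hypothesis cdy : forall s, a < s < b -> {for s, continuous dy}.

Lemma continuous_PI_path s : a < s < b ->
  {for s, continuous (fun s => dx s * PIx u (x s) (y s) + dy s * PIy u (x s) (y s))}.
Proof.
move=> sab.
have Is : s \in `]a, b[%classic by rewrite inE/= in_itv.
have h := @continuity_under_integral R _ _ mu dP `[0%R, (2 * pi)%R]%classic (measurable_itv _) a b.
have {}h : {for s, continuous (fun s => \int[mu]_(t in `[0%R, (2 * pi)%R]) dP s t)}.
  apply: (h _ _ G) => //.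
  - move=> s' /=; rewrite in_itv/= => s'ab.
    have cx : continuous (Pkx (x s') (y s')) by move=> t; exact: Pkx_cts (xy1 s'ab).
    have cy : continuous (Pky (x s') (y s')) by move=> t; exact: Pky_cts (xy1 s'ab).
    by apply: cts_integrable => t; rewrite /dP; cts.
  - apply: aeW => t _ s'; rewrite inE/= in_itv/= => s'ab.
    have cx := is_derive_continuous (hx s'ab).
    have cy := is_derive_continuous (hy s'ab).
    have cdx' := cdx s'ab; have cdy' := cdy s'ab.
    have dn : den (x s') (y s') t ^+ 2 != 0 by rewrite expf_neq0// gt_eqF// den_gt0// xy1.
    by rewrite /dP /Pkx /Pky /den; cts.
  - by move=> s' /=; rewrite in_itv/= => s'ab; apply: aeW => t _; exact: dP_le.
cbv beta delta [prop_for continuous_at]; rewrite -(int_dP sab).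
apply: cvg_trans h; apply: near_eq_cvg.
near=> s'; apply: int_dP.
have : s' \in `]a, b[ by near: s'; apply: near_in_itvoo; rewrite in_itv.
by rewrite in_itv.
Unshelve. all: by end_near. Qed.

(** The fundamental theorem of calculus along the path, then Cauchy-Schwarz in the plane: the speed
    is at most 1, so the derivative is at most the length of the gradient. *)
Lemma path_increment (p q : R) : a < p -> p <= q -> q < b ->
  (forall s, a < s < b -> dx s ^+ 2 + dy s ^+ 2 <= 1) ->
  ((`|PI u (x q) (y q) - PI u (x p) (y p)|)%:E <=
   \int[mu]_(s in `[p, q]) (Num.sqrt (PIx u (x s) (y s) ^+ 2 + PIy u (x s) (y s) ^+ 2))%:E)%E.
Proof.
move=> ap pq qb dxy.
have I s : p <= s <= q -> a < s < b.
  by move=> /andP[s1 s2]; rewrite (lt_le_trans ap s1) (le_lt_trans s2 qb).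
have cf s (h : p <= s <= q) := continuous_PI_path (I s h).
rewrite -abse_EFin -(ftc2 pq (fun s h => is_derive_PI_path (I s h)) cf).
apply: le_trans.
  apply: le_abse_integral => //; apply/measurable_EFinP.
  apply: subspace_continuous_measurable_fun => //.
  by apply: continuous_in_subspaceT => s; rewrite inE/= in_itv/=; exact: cf.
apply: ge0_le_integral_nomeas => s /=; first by [].
rewrite in_itv/= => /I sab; rewrite lee_fin.
set X := PIx _ _ _; set Y := PIy _ _ _.
rewrite -ler_sqr ?nnegrE ?sqrtr_ge0// sqr_sqrtr ?addr_ge0 ?sqr_ge0// real_normK ?num_real//.
have h1 := sqr_ge0 (dx s * Y - dy s * X).
have h2 : 0 <= (1 - (dx s ^+ 2 + dy s ^+ 2)) * (X ^+ 2 + Y ^+ 2).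
  by rewrite mulr_ge0 ?subr_ge0 ?addr_ge0 ?sqr_ge0// dxy.
by move: h1 h2; lra.
Qed.

End path.

(** Along the ray from 0 to [z] the derivative vanishes, because [Pkx] and [Pky] have mean zero; at
    the centre the kernel is 1. *)
Lemma integral_Pk x y : x ^+ 2 + y ^+ 2 < 1 -> PI (fun=> 1) x y = 2 * pi.
Proof.
move=> xy.
pose n := Num.sqrt (x ^+ 2 + y ^+ 2).
have n0 : 0 <= n by exact: sqrtr_ge0.
have nE : n ^+ 2 = x ^+ 2 + y ^+ 2 by rewrite sqr_sqrtr// addr_ge0// sqr_ge0.
have n1 : n < 1 by rewrite -ltr_sqr ?nnegrE// nE expr1n.
have [x1 y1] : `|x| <= 1 /\ `|y| <= 1.
  by split; rewrite -ler_sqr ?nnegrE// real_normK ?num_real// expr1n;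
     [have := sqr_ge0 y|have := sqr_ge0 x]; lra.
(* The derivatives are taken on the open interval []- e, 1 + e[], which contains [[0, 1]]; this [e]
   still keeps the ray inside the disc, as [(1 + e) * n < 1]. *)
pose e : R := (1 - n) / 2.
have e0 : 0 < e by rewrite divr_gt0// subr_gt0.
pose F (s : R) := PI (fun=> 1) (s * x) (s * y).
have dF s : - e < s < 1 + e -> is_derive s 1 F 0.
  move=> sab.
  have h := @is_derive_PI_path (fun=> 1) (fun s => s * x) (fun s => s * y) (fun=> x) (fun=> y) (- e) (1 + e) ((1 + e) * n) _ _ _ _ _ _ _ _ s sab.
  have {}h : is_derive s 1 F (x * PIx (fun=> 1) (s * x) (s * y) + y * PIy (fun=> 1) (s * x) (s * y)).
    apply: h => //.
    - by move=> t; exact: cvg_cst.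
    - by move=> t _; apply: is_derive_eq; rewrite /GRing.scale/=; ring.
    - by move=> t _; apply: is_derive_eq; rewrite /GRing.scale/=; ring.
    - by rewrite mulr_ge0// addr_ge0// ltW.
    - by rewrite /e; nra.
    - move=> t /andP[t1 t2]; rewrite !exprMn -mulrDr -nE; apply: ler_wpM2r; first exact: sqr_ge0.
      by rewrite -(real_normK (num_real t)) ler_sqr ?nnegrE//; [rewrite ler_norml; apply/andP; split; rewrite /e in t1 t2 *; lra|rewrite addr_ge0// ltW].
  have xy' : (s * x) ^+ 2 + (s * y) ^+ 2 < 1.
    rewrite !exprMn -mulrDr -nE -exprMn -real_normK ?num_real// expr_lt1// ltr_norml.
    have h1 : (1 + e) * n < 1 by rewrite /e; nra.
    case/andP: sab => s1 s2; apply/andP; split.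
      by apply: (@lt_le_trans _ _ (- e * n)); [nra|apply: ler_wpM2r => //; exact: ltW].
    by apply: le_lt_trans h1; apply: ler_wpM2r => //; exact: ltW.
  apply: is_derive_eq.
  rewrite /PIx /PIy.
  under eq_Rintegral do rewrite mul1r.
  under [X in _ + _ * X]eq_Rintegral do rewrite mul1r.
  by rewrite integral_Pkx// integral_Pky// !mulr0 addr0.
have := @MVT R F (fun=> 0) 0 1 ltr01 _ _.
case.
- by move=> s; rewrite in_itv/= => /andP[s0 s1]; apply: dF; apply/andP; split; lra.
- apply: continuous_in_subspaceT => s; rewrite inE/= in_itv/= => /andP[s0 s1].
  by apply: is_derive_continuous (dF s _); apply/andP; split; lra.
move=> c _; rewrite mul0r => /eqP; rewrite subr_eq0 /F !mul1r => /eqP ->.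
rewrite /PI !mul0r.
under eq_Rintegral => t _.
  rewrite /Pk /den !subr0 cos2Dsin2 expr0n/= !subr0 divr1 mulr1; over.
by rewrite /Rintegral integral_cst_itv ?(ltW twopi_gt0)//= subr0 mul1r.
Qed.

End poisson_kernel.

(** * Chords and translations *)

Section double_integrals.
Context {R : realType}.
Notation mu := (@lebesgue_measure R).
Local Open Scope ereal_scope.

Lemma le_dintegral (A B : set R) (f g : R -> R -> R) :
  (forall x y, A x -> B y -> (0 <= f x y)%R) ->
  (forall x y, A x -> B y -> (f x y <= g x y)%R) ->
  \int[mu]_(x in A) \int[mu]_(y in B) (f x y)%:E <= \int[mu]_(x in A) \int[mu]_(y in B) (g x y)%:E.
Proof.
move=> f0 fg; apply: ge0_le_integral_nomeas => x Ax.
  by apply: integral_ge0 => y By; rewrite lee_fin f0.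
by apply: ge0_le_integral_nomeas => y By; rewrite lee_fin ?f0// fg.
Qed.

Lemma dintegralZ (A B : set R) (k : R) (f : R -> R -> R) :
  measurable A -> measurable B -> (0 <= k)%R -> (forall x y, (0 <= f x y)%R) ->
  measurable_fun [set: R * R] (fun z => f z.1 z.2) ->
  \int[mu]_(x in A) \int[mu]_(y in B) (k * f x y)%:E
  = k%:E * \int[mu]_(x in A) \int[mu]_(y in B) (f x y)%:E.
Proof.
move=> mA mB k0 f0 mf.
have mfx x : measurable_fun setT (fun y => (f x y)%:E).
  apply/measurable_EFinP; exact: (measurable_section1 x mf).
rewrite -ge0_integralZl//.
- apply: eq_integral => x _.
  rewrite -ge0_integralZl//; last by move=> y _; rewrite lee_fin.
  by apply: measurable_funTS; exact: mfx.
- by apply: measurable_funTS; apply: measurable_integral_in => //; measr.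
- by move=> x _; apply: integral_ge0 => y _; rewrite lee_fin.
Qed.

Lemma measurable_dsection (B : set R) (f : R -> R -> R) : measurable B ->
  measurable_fun [set: R * R] (fun z => f z.1 z.2) -> (forall x y, (0 <= f x y)%R) ->
  measurable_fun setT (fun x => \int[mu]_(y in B) (f x y)%:E).
Proof.
by move=> mB mf f0; apply: measurable_integral_in => //; exact/measurable_EFinP.
Qed.

Lemma dtonelli (A B : set R) (f : R -> R -> R) : measurable A -> measurable B ->
  measurable_fun [set: R * R] (fun z => f z.1 z.2) -> (forall x y, (0 <= f x y)%R) ->
  \int[mu]_(x in A) \int[mu]_(y in B) (f x y)%:E = \int[mu]_(y in B) \int[mu]_(x in A) (f x y)%:E.
Proof.
by move=> mA mB mf f0; apply: tonelli_in => //; exact/measurable_EFinP.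
Qed.

Lemma ge0_dintegralD (A B : set R) (f g : R -> R -> \bar R) : measurable A -> measurable B ->
  measurable_fun [set: R * R] (fun z => f z.1 z.2) -> (forall x y, 0 <= f x y) ->
  measurable_fun [set: R * R] (fun z => g z.1 z.2) -> (forall x y, 0 <= g x y) ->
  \int[mu]_(x in A) \int[mu]_(y in B) (f x y + g x y)
  = \int[mu]_(x in A) \int[mu]_(y in B) f x y + \int[mu]_(x in A) \int[mu]_(y in B) g x y.
Proof.
move=> mA mB mf f0 mg g0.
have sec (h : R -> R -> \bar R) x : measurable_fun [set: R * R] (fun z => h z.1 z.2) -> measurable_fun B (h x).
  by move=> mh; apply: measurable_funTS; exact: (measurable_section1 x mh).
rewrite -ge0_integralD//.
- by apply: eq_integral => x _; rewrite -ge0_integralD//; exact: sec.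
- by move=> x _; apply: integral_ge0.
- by apply: measurable_funTS; exact: measurable_integral_in.
- by move=> x _; apply: integral_ge0.
- by apply: measurable_funTS; exact: measurable_integral_in.
Qed.

Lemma dintegralD (A B : set R) (f g : R -> R -> R) : measurable A -> measurable B ->
  measurable_fun [set: R * R] (fun z => f z.1 z.2) -> (forall x y, (0 <= f x y)%R) ->
  measurable_fun [set: R * R] (fun z => g z.1 z.2) -> (forall x y, (0 <= g x y)%R) ->
  \int[mu]_(x in A) \int[mu]_(y in B) (f x y + g x y)%:E
  = \int[mu]_(x in A) \int[mu]_(y in B) (f x y)%:E + \int[mu]_(x in A) \int[mu]_(y in B) (g x y)%:E.
Proof.
move=> mA mB mf f0 mg g0.
by apply: (ge0_dintegralD mA mB (f := fun x y => (f x y)%:E) (g := fun x y => (g x y)%:E)) => *;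
  rewrite ?lee_fin//; exact/measurable_EFinP.
Qed.

End double_integrals.

(** * The chord condition against the translation condition *)

Section conditions.
Context {R : realType}.
Notation mu := (@lebesgue_measure R).
Variables (sg al : R).
Hypothesis sg0 : 0 < sg.
Hypothesis sg1 : sg < 1.
Hypothesis al0 : 0 < al.
Hypothesis al1 : al < 1.
Implicit Types (u : R -> R) (a L s t : R).

(** Here [L] is the angle of the arc, so [L / (2 * pi)] is its normalized length; the integration in
    [s] is put outside, as in the other two conditions. *)
Definition translation_cond u := exists2 C : R, 0 <= C & forall a L, 0 < L -> L <= 2 * pi ->
  (\int[mu]_(s in `[a, (a + L)%R]) \int[mu]_(t in `]0%R, (L / (2 * pi))%R])
    ((u (s + t) - u s) ^+ 2 * t `^ (sg - 2))%:E <= (C * L `^ (sg + 2 * al))%:E)%E.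

Definition chord_cond u := exists2 C : R, 0 <= C & forall a L, 0 < L -> L <= 2 * pi ->
  (\int[mu]_(s in `[a, (a + L)%R]) \int[mu]_(t in `[a, (a + L)%R])
    ((u s - u t) ^+ 2 * chord (s - t) `^ (sg - 2))%:E <= (C * L `^ (sg + 2 * al))%:E)%E.

Lemma rho_gt0 L : 0 < L -> 0 < L / (2 * pi).
Proof. by move=> L0; rewrite divr_gt0// twopi_gt0. Qed.

Lemma rho_le1 L : L <= 2 * pi -> L / (2 * pi) <= 1.
Proof. by move=> L2; rewrite ler_pdivrMr ?twopi_gt0// mul1r. Qed.

Lemma rho_le L : 0 < L -> L / (2 * pi) <= L / 4.
Proof.
move=> L0; rewrite ler_pM2l// lef_pV2 ?posrE ?twopi_gt0//.
by have := @pi_ge2 R; lra.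
Qed.

Lemma powR_subr2_le (x y : R) : 0 < x -> x <= y -> y `^ (sg - 2) <= x `^ (sg - 2).
Proof.
move=> x0 xy; have y0 : 0 < y by exact: lt_le_trans xy.
rewrite -opprB !powRN lef_pV2 ?posrE ?powR_gt0//.
have s2 : 0 <= 2 - sg by rewrite subr_ge0 (le_trans (ltW sg1))// ler1n.
by apply: ge0_ler_powR => //; rewrite nnegrE ltW.
Qed.

Lemma measurable_chord_kernel u : measurable_fun setT u ->
  measurable_fun [set: R * R] (fun z => (u z.1 - u z.2) ^+ 2 * chord (z.1 - z.2) `^ (sg - 2)).
Proof.
by move=> mu_; have m := @measurable_chord R; measr.
Qed.

(** For [s] in the first half of an arc of angle [L] and [t <= L / 4], the point [s + t] stays in
    that arc. The two halves of [[a, a + L]] are therefore treated as the first halves of the arcs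
    of angle [L] that start at [a] and at [a + L / 2], whence [2 * C]. *)
Lemma chord_translation u : measurable_fun setT u -> chord_cond u -> translation_cond u.
Proof.
move=> mu_ [C C0 HC]; exists (2 * C); first by rewrite mulr_ge0.
move=> a L L0 L2.
have rL := rho_le L0; have p2 := @pi_ge2 R.
have mk := measurable_chord_kernel mu_.
have k0 s t : 0 <= (u s - u t) ^+ 2 * chord (s - t) `^ (sg - 2).
  by rewrite mulr_ge0 ?sqr_ge0// powR_ge0.
have half b : (\int[mu]_(s in `[b, (b + L / 2)%R]) \int[mu]_(t in `]0%R, (L / (2 * pi))%R])
    ((u (s + t) - u s) ^+ 2 * t `^ (sg - 2))%:E <= (C * L `^ (sg + 2 * al))%:E)%E.
  apply: le_trans (HC b L L0 L2).
  apply: (@le_trans _ _ (\int[mu]_(s in `[b, (b + L / 2)%R]) \int[mu]_(t in `[b, (b + L)%R])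
    ((u s - u t) ^+ 2 * chord (s - t) `^ (sg - 2))%:E)%E); last first.
    apply: ge0_subset_integral_nomeas; first by move=> s; apply: integral_ge0 => t _; rewrite lee_fin.
    by apply: subset_itvl; rewrite bnd_simp; lra.
  apply: ge0_le_integral_nomeas => s /=.
    by move=> _; apply: integral_ge0 => t _; rewrite lee_fin mulr_ge0 ?sqr_ge0// powR_ge0.
  rewrite in_itv/= => /andP[bs sb].
  pose H t' := ((u s - u t') ^+ 2 * chord (s - t') `^ (sg - 2))%:E.
  have mH : measurable_fun setT H.
    apply/measurable_EFinP; exact: (measurable_section1 s mk).
  apply: (@le_trans _ _ (\int[mu]_(t in `]0%R, (L / (2 * pi))%R]) H (t + s)%R)%E).
    apply: ge0_le_integral_nomeas => t /=; first by rewrite lee_fin mulr_ge0 ?sqr_ge0// powR_ge0.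
    rewrite in_itv/= => /andP[t0 tr].
    rewrite /H lee_fin [t + s]addrC -sqrrN opprB; apply: ler_wpM2l; first exact: sqr_ge0.
    rewrite (_ : s - (s + t) = - t); last by ring.
    rewrite chordN.
    have tpi : `|t| <= pi by rewrite ger0_norm ?(ltW t0)//; have := rho_le1 L2; lra.
    have := chord_ge tpi; have := chord_le t; rewrite gtr0_norm// => h1 h2.
    by apply: powR_subr2_le => //; lra.
  rewrite (integral_itv_shift s 0 _ false false)//; last by move=> t; rewrite lee_fin.
  apply: ge0_subset_integral_nomeas; first by move=> t; rewrite lee_fin.
  by move=> t /=; rewrite !in_itv/= => /andP[h1 h2]; apply/andP; split; lra.
rewrite (@integral_itv_split _ a (a + L / 2) (a + L)); [|lra|lra| |]; last 2 first.
- apply: measurable_dsection => //; last by move=> s t; rewrite mulr_ge0 ?sqr_ge0// powR_ge0.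
  by measr.
- by move=> s; apply: integral_ge0 => t _; rewrite lee_fin mulr_ge0 ?sqr_ge0// powR_ge0.
have h2 := half (a + L / 2); rewrite -addrA -splitr in h2.
apply: le_trans; first exact: (leeD (half a) h2).
by rewrite -EFinD lee_fin; lra.
Qed.

(** For negative shifts, replacing [s] by [s + t] turns [u (s - t) - u s] into a forward increment
    based in [[a - L, a + L]]. These two arcs and the original one add up to [3 * C]. *)
Lemma two_sided u : measurable_fun setT u -> translation_cond u ->
  exists2 C : R, 0 <= C & forall a L, 0 < L -> L <= 2 * pi ->
  (\int[mu]_(s in `[a, (a + L)%R]) \int[mu]_(t in `[(- (L / (2 * pi)))%R, (L / (2 * pi))%R])
    ((u (s + t) - u s) ^+ 2 * `|t| `^ (sg - 2))%:E <= (C * L `^ (sg + 2 * al))%:E)%E.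
Proof.
move=> mu_ [C C0 HC]; exists (3 * C); first by rewrite mulr_ge0.
move=> a L L0 L2.
have r0 := rho_gt0 L0; have rL := rho_le L0; set r := L / (2 * pi) in HC r0 rL *.
have F0 s t : 0 <= (u (s + t) - u s) ^+ 2 * `|t| `^ (sg - 2).
  by rewrite mulr_ge0 ?sqr_ge0// powR_ge0.
have Fs0 s t : (0 <= ((u (s + t) - u s) ^+ 2 * `|t| `^ (sg - 2))%:E)%E by rewrite lee_fin.
have mFs s : measurable_fun setT (fun t => ((u (s + t) - u s) ^+ 2 * `|t| `^ (sg - 2))%:E).
  by measr.
have mG : measurable_fun [set: R * R] (fun z => (u (z.1 - z.2) - u z.1) ^+ 2 * z.2 `^ (sg - 2)) by measr.
have G0 s t : 0 <= (u (s - t) - u s) ^+ 2 * t `^ (sg - 2).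
  by rewrite mulr_ge0 ?sqr_ge0// powR_ge0.
have mH : measurable_fun [set: R * R] (fun z => (u (z.1 + z.2) - u z.1) ^+ 2 * z.2 `^ (sg - 2)) by measr.
have H0 s t : 0 <= (u (s + t) - u s) ^+ 2 * t `^ (sg - 2).
  by rewrite mulr_ge0 ?sqr_ge0// powR_ge0.
apply: (@le_trans _ _ (\int[mu]_(s in `[a, (a + L)%R])
  (\int[mu]_(t in `]0%R, r]) ((u (s + t) - u s) ^+ 2 * t `^ (sg - 2))%:E +
   \int[mu]_(t in `]0%R, r]) ((u (s - t) - u s) ^+ 2 * t `^ (sg - 2))%:E))%E).
  apply: ge0_le_integral_nomeas => s _; first by apply: integral_ge0 => t _; rewrite lee_fin.
  rewrite (@integral_itv_split _ (- r) 0 r _ _ _ (mFs s) (Fs0 s)); [|lra|lra].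
  rewrite [leLHS]addeC; apply: leeD.
    rewrite -integral_itv_obnd_cbnd; last exact: measurable_funTS.
    apply: ge0_le_integral_nomeas => t /=; first by rewrite lee_fin.
    by rewrite in_itv/= => /andP[t0 _]; rewrite ger0_norm// ltW.
  rewrite -{1}oppr0 (integral_itv_opp 0 r (mFs s) (Fs0 s)).
  rewrite -integral_itv_obnd_cbnd; last by apply: measurable_funTS; measr.
  apply: ge0_le_integral_nomeas => t /=; first by rewrite lee_fin.
  by rewrite in_itv/= => /andP[t0 _]; rewrite normrN ger0_norm// ltW.
rewrite ge0_integralD//; last 4 first.
- by move=> s _; apply: integral_ge0 => t _; rewrite lee_fin.
- by apply: measurable_funTS; exact: measurable_dsection.
- by move=> s _; apply: integral_ge0 => t _; rewrite lee_fin.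
- by apply: measurable_funTS; exact: measurable_dsection.
have -> : 3 * C * L `^ (sg + 2 * al) = C * L `^ (sg + 2 * al) + (C * L `^ (sg + 2 * al) + C * L `^ (sg + 2 * al)) by ring.
rewrite EFinD; apply: leeD; first exact: HC.
rewrite (dtonelli (measurable_itv _) (measurable_itv _) mG G0).
apply: (@le_trans _ _ (\int[mu]_(t in `]0%R, r]) \int[mu]_(s in `[(a - L)%R, (a + L)%R])
   ((u (s + t) - u s) ^+ 2 * t `^ (sg - 2))%:E)%E).
  apply: ge0_le_integral_nomeas => t /=; first by move=> _; apply: integral_ge0 => s _; rewrite lee_fin.
  rewrite in_itv/= => /andP[t0 tr].
  pose H s := ((u (s + t) - u s) ^+ 2 * t `^ (sg - 2))%:E.
  have mHt : measurable_fun setT H.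
    apply/measurable_EFinP; exact: (measurable_section2 t mH).
  have -> : (\int[mu]_(s in `[a, (a + L)%R]) ((u (s - t) - u s) ^+ 2 * t `^ (sg - 2))%:E
    = \int[mu]_(s in `[a, (a + L)%R]) H (s + (- t))%R)%E.
    by apply: eq_integral => s _; rewrite /H subrK -sqrrN opprB.
  rewrite (integral_itv_shift (- t) a _ true false)//; last by move=> s; rewrite lee_fin.
  apply: ge0_subset_integral_nomeas; first by move=> s; rewrite lee_fin.
  by move=> s /=; rewrite !in_itv/= => /andP[h1 h2]; apply/andP; split; lra.
rewrite -(dtonelli (measurable_itv _) (measurable_itv _) mH H0).
rewrite (@integral_itv_split _ (a - L) a (a + L)); [|lra|lra| |]; last 2 first.
- exact: measurable_dsection.
- by move=> s; apply: integral_ge0 => t _; rewrite lee_fin.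
rewrite EFinD; apply: leeD; last exact: HC.
by have := HC (a - L) L L0 L2; rewrite subrK.
Qed.

Lemma holder_sq_le u (K L s t : R) : 0 <= K -> 0 < L -> L <= 2 * pi ->
  (forall s t, `|s - t| <= 2 * pi -> `|u s - u t| <= K * `|s - t| `^ al) ->
  `|s - t| <= L -> (u s - u t) ^+ 2 <= K ^+ 2 * L `^ (2 * al).
Proof.
move=> K0 L0 L2 HK st.
have h2 : `|u s - u t| <= K * L `^ al.
  apply: le_trans (HK _ _ (le_trans st L2)) _; apply: ler_wpM2l => //.
  by apply: ge0_ler_powR; rewrite ?nnegrE ?(ltW al0) ?(ltW L0).
rewrite (_ : K ^+ 2 * L `^ (2 * al) = (K * L `^ al) ^+ 2); last first.
  by rewrite exprMn -(powR_mulrn 2 (powR_ge0 L al)) -powRrM (mulrC al).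
by rewrite -(real_normK (num_real (u s - u t))) ler_sqr ?nnegrE// mulr_ge0 ?powR_ge0.
Qed.

(** Homogeneity of the far part: increments of size [L^al] at distances at least [(L / (2 pi)) / 2],
    integrated over a square of side [L], have exactly the order allowed by the conditions. *)
Lemma far_scale (K L : R) : 0 < L ->
  K ^+ 2 * L `^ (2 * al) * (L / (2 * pi) / 2) `^ (sg - 2) * L * L
  = K ^+ 2 * (4 * pi) `^ (2 - sg) * L `^ (sg + 2 * al).
Proof.
move=> L0; rewrite [L `^ (sg + _)]powRD; last by rewrite (gt_eqF L0) implybT.
rewrite (_ : L / (2 * pi) / 2 = L / (4 * pi)); last by rewrite -mulrA -invfM; congr (_ * _^-1); ring.
rewrite [(L / (4 * pi)) `^ _]powRM ?(ltW L0) ?invr_ge0 ?mulr_ge0 ?pi_ge0//.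
rewrite (_ : L `^ (sg - 2) = L `^ sg / L ^+ 2); last first.
  by rewrite powRB ?powR_mulrn ?(ltW L0)// (gt_eqF L0) implybT.
rewrite (_ : (4 * pi)^-1 `^ (sg - 2) = (4 * pi) `^ (2 - sg)); last first.
  by rewrite -powR_inv1 ?mulr_ge0 ?pi_ge0// -powRrM mulN1r opprB.
by field; rewrite gt_eqF.
Qed.

Lemma translation_chord u : holder_periodic al u -> translation_cond u -> chord_cond u.
Proof.
move=> hu; have mu_ := holder_measurable al0 hu.
move=> /(two_sided mu_)[C C0 HC].
case: hu => u2pi [K K0 HK].
pose M := K ^+ 2 * (4 * pi) `^ (2 - sg).
exists (4 * C + M); first by rewrite addr_ge0 ?mulr_ge0 ?sqr_ge0// powR_ge0.
move=> a L L0 L2.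
have r0 := rho_gt0 L0; have rL := rho_le L0; have r1 := rho_le1 L2.
set r := L / (2 * pi) in HC r0 rL r1 *.
have pn : (pi : R) != 0 by rewrite gt_eqF// pi_gt0.
pose k s t := (u s - u t) ^+ 2 * chord (s - t) `^ (sg - 2).
have k0 s t : 0 <= k s t by rewrite mulr_ge0 ?sqr_ge0// powR_ge0.
have mk : measurable_fun [set: R * R] (fun z => k z.1 z.2) by exact: measurable_chord_kernel.
(* The near pairs: the chord is at least half the angle, so these have angular distance less than
   [r], the range of [two_sided]. For the other pairs [k] is at most the constant [m]. *)
pose N s t := if chord (s - t) < r / 2 then k s t else 0.
have N0 s t : 0 <= N s t by rewrite /N; case: ifP.
have mN : measurable_fun [set: R * R] (fun z => N z.1 z.2).
  by have mc := @measurable_chord R; rewrite /N; measr.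
pose m := K ^+ 2 * L `^ (2 * al) * (r / 2) `^ (sg - 2).
have m0 : 0 <= m by rewrite !mulr_ge0 ?sqr_ge0 ?powR_ge0.
have mF : measurable_fun [set: R * R] (fun z => (u (z.1 + z.2) - u z.1) ^+ 2 * `|z.2| `^ (sg - 2)) by measr.
have F0 s t : 0 <= (u (s + t) - u s) ^+ 2 * `|t| `^ (sg - 2).
  by rewrite mulr_ge0 ?sqr_ge0// powR_ge0.
apply: (@le_trans _ _ (\int[mu]_(s in `[a, (a + L)%R]) \int[mu]_(t in `[a, (a + L)%R]) (N s t + m)%:E)%E).
  apply: le_dintegral => s t /=; first by move=> _ _; exact: k0.
  rewrite !in_itv/= => /andP[s1 s2] /andP[t1 t2]; rewrite -/(k s t) /N.
  case: ifPn => [_|]; first by rewrite lerDl.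
  rewrite -leNgt add0r /k /m => h; apply: ler_pM; rewrite ?sqr_ge0 ?powR_ge0//; last first.
    by apply: powR_subr2_le => //; rewrite divr_gt0.
  have st : `|s - t| <= L by rewrite ler_norml; apply/andP; split; lra.
  exact: holder_sq_le.
rewrite dintegralD//.
have -> : (4 * C + M) * L `^ (sg + 2 * al) = 4 * (C * L `^ (sg + 2 * al)) + m * L * L.
  by rewrite mulrDl mulrA /m /M /r far_scale.
rewrite EFinD; apply: leeD; last first.
  under eq_integral do rewrite integral_cst_itv ?lerDl ?(ltW L0)// addrAC subrr add0r.
  by rewrite integral_cst_itv ?lerDl ?(ltW L0)// addrAC subrr add0r.
apply: (@le_trans _ _ (\int[mu]_(s in `[a, (a + L)%R]) \int[mu]_(t in `[(- r)%R, r])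
  (4 * ((u (s + t) - u s) ^+ 2 * `|t| `^ (sg - 2)))%:E)%E); last first.
  by rewrite dintegralZ// EFinM; apply: lee_wpmul2l => //; exact: HC.
apply: ge0_le_integral_nomeas => s _; first by apply: integral_ge0 => t _; rewrite lee_fin.
have mNs : measurable_fun setT (fun t => (N s t)%:E).
  apply/measurable_EFinP; exact: (measurable_section1 s mN).
have Ns0 t : (0 <= (N s t)%:E)%E by rewrite lee_fin.
(* The inner integral is enlarged to a full period so that it can be centred at [s]. This costs
   nothing, since [N] vanishes away from the diagonal of the circle. *)
apply: (@le_trans _ _ (\int[mu]_(t in `[a, (a + 2 * pi)%R]) (N s t)%:E)%E).
  apply: ge0_subset_integral_nomeas => //.
  by apply: subset_itvl; rewrite bnd_simp lerD2l.
have Np t : (N s (t + 2 * pi))%:E = (N s t)%:E.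
  rewrite /N /k u2pi -(chordD2pi (s - (t + 2 * pi))).
  by rewrite (_ : s - (t + 2 * pi) + 2 * pi = s - t)//; ring.
rewrite (integral_periodic a twopi_gt0 mNs Ns0 Np) -(integral_periodic (s - pi) twopi_gt0 mNs Ns0 Np).
have -> : (\int[mu]_(t in `[(s - pi)%R, (s - pi + 2 * pi)%R]) (N s t)%:E
   = \int[mu]_(t in `[(- pi)%R, pi]) (N s (t + s))%:E)%E.
  rewrite (integral_itv_shift s (- pi) pi true false (f := fun t => (N s t)%:E))//.
  have -> : s - pi + 2 * pi = pi + s by ring.
  by have -> : s - pi = - pi + s by ring.
apply: (@le_trans _ _ (\int[mu]_(t in `[(- pi)%R, pi])
   ((fun t => (4 * ((u (s + t) - u s) ^+ 2 * `|t| `^ (sg - 2)))%:E) \_ `[(- r)%R, r]) t)%E).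
  apply: ge0_le_integral_nomeas => t /=; first by [].
  rewrite in_itv/= => tpi; have tpi' : `|t| <= pi by rewrite ler_norml.
  have hc := chord_ge tpi'.
  rewrite patchE /N [t + s]addrC (_ : s - (s + t) = - t); last by ring.
  rewrite chordN; case: ifPn => [h|_]; last by case: ifP => // _; rewrite lee_fin mulr_ge0.
  rewrite ifT; last first.
    have : `|t| <= r by lra.
    by rewrite inE/= in_itv/= ler_norml.
  rewrite lee_fin /k (_ : s - (s + t) = - t); last by ring.
  rewrite chordN -(sqrrN (u s - _)) opprB mulrCA; apply: ler_wpM2l; first exact: sqr_ge0.
  (* On the diagonal the chord is 0, and 0 raised to a nonzero power is 0. Off it,
     [chord >= |t| / 2] costs [2^(2 - sg) <= 4]. *)
  have [->|tn0] := eqVneq t 0.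
    rewrite normr0 /chord cos0 subrr mulr0 sqrtr0 powR0 ?mulr0//.
    by rewrite lt_eqF// subr_lt0 (lt_trans sg1)// ltr1n.
  have tp : 0 < `|t| by rewrite normr_gt0.
  apply: le_trans (powR_subr2_le (x := `|t| / 2) _ _) _ => //; first by rewrite divr_gt0.
  rewrite powRM ?invr_ge0// mulrC; apply: ler_wpM2r; first exact: powR_ge0.
  rewrite -powR_inv1// -powRrM mulN1r opprB -[leRHS](_ : 2 `^ 2%:R = _).
    by apply: ler_powR; [rewrite ler1n|rewrite gerBl ltW].
  by rewrite powR_mulrn// expr2 -natrM.
rewrite -integral_mkcondr; apply: ge0_subset_integral_nomeas; last exact: subIsetr.
by move=> t; rewrite lee_fin mulr_ge0.
Qed.

End conditions.

(** * From translations to the gradient *)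

Section gradient.
Context {R : realType}.
Notation mu := (@lebesgue_measure R).
Implicit Types (u : R -> R) (r s t th h a L : R).

(** The squared distance [|e^(it) - r|^2]. *)
Definition Dk r t : R := 1 - 2 * r * cos t + r ^+ 2.

Lemma den_polar r th t : den (r * cos th) (r * sin th) t = Dk r (t - th).
Proof.
rewrite /den /Dk cosB; have := cos2Dsin2 t; have := cos2Dsin2 th.
set c := cos th; set s := sin th; set c' := cos t; set s' := sin t => e1 e2.
rewrite -[X in X - 2 * r * _]e2 -[r ^+ 2]mulr1 -[X in r ^+ 2 * X]e1; ring.
Qed.

Lemma polar_sq r th : (r * cos th) ^+ 2 + (r * sin th) ^+ 2 = r ^+ 2.
Proof. by rewrite !exprMn -mulrDr cos2Dsin2 mulr1. Qed.

Lemma polar_lt1 r th : 0 <= r < 1 -> (r * cos th) ^+ 2 + (r * sin th) ^+ 2 < 1.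
Proof. by case/andP=> r0 r1; rewrite polar_sq expr_lt1. Qed.

Lemma Dk_gt0 r t : 0 <= r < 1 -> 0 < Dk r t.
Proof.
by move=> hr; have := den_gt0 t (polar_lt1 0 hr); rewrite den_polar subr0.
Qed.

(** One has [Dk r t = (1 - r) ^+ 2 + 2 r (1 - cos t)]. For [r >= 1/2] the second term is at least
    [t ^+ 2 / 8]. For [r < 1/2] the first is at least [1/4], while
    [(1 - r) ^+ 2 + t ^+ 2 <= 1 + 16], and [68 = 4 * 17]. *)
Lemma Dk_ge r t : 0 <= r <= 1 -> `|t| <= pi -> ((1 - r) ^+ 2 + t ^+ 2) / 68 <= Dk r t.
Proof.
move=> /andP[r0 r1] tp; have h := one_subr_cos_ge tp.
have p4 : (pi : R) <= 4 by have := @pihalf_lt2 R; lra.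
have t16 : t ^+ 2 <= 16.
  rewrite -(real_normK (num_real t)) (_ : 16 = 4 ^+ 2); last by rewrite expr2 -natrM.
  by rewrite ler_sqr ?nnegrE// (le_trans tp).
rewrite ler_pdivrMr//.
have -> : Dk r t = (1 - r) ^+ 2 + 2 * r * (1 - cos t) by rewrite /Dk; ring.
have c0 : 0 <= 1 - cos t by rewrite subr_ge0 cos_le1.
set q := (1 - r) ^+ 2; have q0 : 0 <= q by exact: sqr_ge0.
have [rh|rh] := leP (1 / 2) r.
  have : 1 - cos t <= 2 * r * (1 - cos t) by nra.
  by lra.
have q1 : 1 / 4 <= q by rewrite /q; nra.
have : 0 <= 2 * r * (1 - cos t) by rewrite !mulr_ge0.
have : q <= 1 by rewrite /q; nra.
by lra.
Qed.

Lemma DkD2pi r t : Dk r (t + 2 * pi) = Dk r t.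
Proof. by rewrite /Dk [2 * pi]mulr_natl cosD2pi. Qed.

Lemma measurable_Dk r : measurable_fun setT (Dk r).
Proof. by rewrite /Dk; measr. Qed.

Lemma Dk_cts r t : continuous_at t (Dk r).
Proof. by rewrite /Dk; cts. Qed.

(* Subtracting [u th] is free for the derivatives of the Poisson kernel, as they
   have mean zero, and turns the kernel bound into a bound on increments. *)
Lemma recenter u (k q : R -> R) th : continuous u -> (forall s, u (s + 2 * pi) = u s) ->
  continuous k -> measurable_fun setT q -> (forall t, 0 <= q t) -> (forall t, q (t + 2 * pi) = q t) ->
  (forall t, `|k t| <= q (t - th)) ->
  ((`|\int[mu]_(t in `[0%R, (2 * pi)%R]) (u t * k t) - u th * \int[mu]_(t in `[0%R, (2 * pi)%R]) k t|)%:E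
   <= \int[mu]_(t in `[(- pi)%R, pi]) (`|u (th + t) - u th| * q t)%:E)%E.
Proof.
move=> cu u2 ck mq q0 q2 kq.
have mu_ : measurable_fun setT u by exact: continuous_measurable_fun.
have cuk : continuous (fun t => (u t - u th) * k t) by move=> t; cts.
rewrite -RintegralZl//; last exact: cts_integrable.
rewrite -RintegralB//; last 2 first.
- by apply: cts_integrable => t; cts.
- by apply: cts_integrable => t; cts.
have -> : \int[mu]_(t in `[0%R, (2 * pi)%R]) (u t * k t - u th * k t) =
    \int[mu]_(t in `[0%R, (2 * pi)%R]) ((u t - u th) * k t).
  by apply: eq_Rintegral => t _; rewrite mulrBl.
rewrite EFin_normr_Rintegral//; last exact: cts_integrable.
apply: le_trans; first by apply: le_abse_integral => //; apply/measurable_EFinP; apply: measurable_funTS; exact: continuous_measurable_fun.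
pose H t := (`|u t - u th| * q (t - th))%:E.
have mH : measurable_fun setT H.
  have m1 : measurable_fun setT (fun t : R => q (t - th)).
    by apply: (measurableT_comp mq); measr.
  by rewrite /H; measr.
have H0 t : (0 <= H t)%E by rewrite lee_fin mulr_ge0.
have H2 t : H (t + 2 * pi) = H t.
  by rewrite /H u2 (_ : t + 2 * pi - th = t - th + 2 * pi) ?q2//; ring.
apply: (@le_trans _ _ (\int[mu]_(t in `[0%R, (2 * pi)%R]) H t)%E).
  apply: ge0_le_integral_nomeas => t _; first exact: abse_ge0.
  by rewrite lee_fin normrM; apply: ler_wpM2l.
rewrite -(integral_periodic (th - pi) twopi_gt0 mH H0 H2).
have -> : (\int[mu]_(t in `[(th - pi)%R, (th - pi + 2 * pi)%R]) H t
   = \int[mu]_(t in `[(- pi)%R, pi]) H (t + th)%R)%E.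
  rewrite (integral_itv_shift th (- pi) pi true false)//.
  have -> : th - pi + 2 * pi = pi + th by ring.
  by have -> : th - pi = - pi + th by ring.
by apply: ge0_le_integral_nomeas => // t _; rewrite /H addrK [t + th]addrC.
Qed.

Lemma PIx_le u r th : continuous u -> (forall s, u (s + 2 * pi) = u s) -> 0 <= r < 1 ->
  ((`|PIx u (r * cos th) (r * sin th)|)%:E
   <= \int[mu]_(t in `[(- pi)%R, pi]) (`|u (th + t) - u th| * (2 / Dk r t))%:E)%E.
Proof.
move=> cu u2 hr; have xy := polar_lt1 th hr.
have := @recenter u (Pkx (r * cos th) (r * sin th)) (fun t => 2 / Dk r t) th cu u2.
rewrite integral_Pkx// mulr0 subr0; apply.
- by move=> t; exact: Pkx_cts.
- by have := measurable_Dk r => ?; measr.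
- by move=> t; rewrite divr_ge0// ltW// Dk_gt0.
- by move=> t; rewrite DkD2pi.
- by move=> t; rewrite -den_polar; exact: Pkx_le.
Qed.

Lemma PIy_le u r th : continuous u -> (forall s, u (s + 2 * pi) = u s) -> 0 <= r < 1 ->
  ((`|PIy u (r * cos th) (r * sin th)|)%:E
   <= \int[mu]_(t in `[(- pi)%R, pi]) (`|u (th + t) - u th| * (2 / Dk r t))%:E)%E.
Proof.
move=> cu u2 hr; have xy := polar_lt1 th hr.
have := @recenter u (Pky (r * cos th) (r * sin th)) (fun t => 2 / Dk r t) th cu u2.
rewrite integral_Pky// mulr0 subr0; apply.
- by move=> t; exact: Pky_cts.
- by have := measurable_Dk r => ?; measr.
- by move=> t; rewrite divr_ge0// ltW// Dk_gt0.
- by move=> t; rewrite DkD2pi.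
- by move=> t; rewrite -den_polar; exact: Pky_le.
Qed.

Lemma PI_sub_le u r th : continuous u -> (forall s, u (s + 2 * pi) = u s) -> 0 <= r < 1 ->
  ((`|PI u (r * cos th) (r * sin th) - 2 * pi * u th|)%:E
   <= \int[mu]_(t in `[(- pi)%R, pi]) (`|u (th + t) - u th| * ((1 - r ^+ 2) / Dk r t))%:E)%E.
Proof.
move=> cu u2 hr; have xy := polar_lt1 th hr.
have r1 : 0 <= 1 - r ^+ 2 by case/andP: hr => r0 r1; rewrite subr_ge0 expr_le1// ltW.
have := @recenter u (Pk (r * cos th) (r * sin th)) (fun t => (1 - r ^+ 2) / Dk r t) th cu u2.
have -> : \int[mu]_(t in `[0%R, (2 * pi)%R]) Pk (r * cos th) (r * sin th) t = 2 * pi.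
  have E := integral_Pk xy; rewrite /PI in E; rewrite -[RHS]E.
  by apply: eq_Rintegral => t _; rewrite mul1r.
rewrite [u th * _]mulrC; apply.
- by move=> t; exact: Pk_cts.
- by have := measurable_Dk r => ?; measr.
- by move=> t; rewrite divr_ge0// ltW// Dk_gt0.
- by move=> t; rewrite DkD2pi.
- move=> t; rewrite -den_polar /Pk -addrA -opprD polar_sq ger0_norm//.
  by rewrite divr_ge0// den_ge0.
Qed.

(** Up to the factor [2 / (1 - r ^+ 2)], the integrand is the Poisson kernel at [r], whose integral
    is [2 pi]. *)
Lemma integral_Dk r : 0 <= r < 1 ->
  (\int[mu]_(t in `[(- pi)%R, pi]) (2 / Dk r t)%:E = (4 * pi / (1 - r ^+ 2))%:E)%E.
Proof.
move=> hr; have xy := polar_lt1 0 hr.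
have r1 : 0 < 1 - r ^+ 2 by case/andP: hr => r0 r1; rewrite subr_gt0 expr_lt1.
have mD := measurable_Dk r.
have mH : measurable_fun setT (fun t => (2 / Dk r t)%:E) by measr.
have H0 t : (0 <= (2 / Dk r t)%:E)%E by rewrite lee_fin divr_ge0// ltW// Dk_gt0.
have H2 t : (2 / Dk r (t + 2 * pi))%:E = (2 / Dk r t)%:E by rewrite DkD2pi.
have e : `[(- pi)%R, pi] = `[(- pi)%R, (- pi + 2 * pi)%R] :> interval R.
  by congr (Interval (BSide _ _) (BSide _ _)); ring.
rewrite e (integral_periodic (- pi) twopi_gt0 mH H0 H2).
have cD : continuous (fun t => 2 / Dk r t).
  move=> t; have dn := lt0r_neq0 (Dk_gt0 t hr); have cDk : continuous_at t (Dk r) by exact: Dk_cts.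
  by apply: cts_mul; [exact: cts_cst|exact: cts_inv].
have := integral_Pk xy; rewrite /PI.
have -> : \int[mu]_(t in `[0%R, (2 * pi)%R]) (1 * Pk (r * cos 0) (r * sin 0) t) =
   \int[mu]_(t in `[0%R, (2 * pi)%R]) ((1 - r ^+ 2) / 2 * (2 / Dk r t)).
  apply: eq_Rintegral => t _; rewrite mul1r /Pk den_polar subr0 -addrA -opprD polar_sq.
  by field; rewrite lt0r_neq0// Dk_gt0.
rewrite RintegralZl//; last exact: cts_integrable.
move=> E.
have fin : (\int[mu]_(t in `[0%R, (2 * pi)%R]) (2 / Dk r t)%:E)%E \is a fin_num.
  exact: (integrable_fin_num _ (cts_integrable 0 (2 * pi) cD)).
rewrite -(fineK fin); congr (_%:E).
have -> : fine (\int[mu]_(t in `[0%R, (2 * pi)%R]) (2 / Dk r t)%:E)%E = \int[mu]_(t in `[0%R, (2 * pi)%R]) (2 / Dk r t) by [].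
set X := \int[mu]_(t in `[0%R, (2 * pi)%R]) (2 / Dk r t) in E *.
have -> : 4 * pi = (1 - r ^+ 2) * X.
  by rewrite (_ : 4 * pi = 2 * (2 * pi)); [rewrite -E; field|ring].
by field; rewrite lt0r_neq0.
Qed.

(** The squared euclidean gradient, at [r e^(is)], of [2 pi] times the extension of [u]. *)
Definition GU u r s : R :=
  PIx u (r * cos s) (r * sin s) ^+ 2 + PIy u (r * cos s) (r * sin s) ^+ 2.

Lemma GU_ge0 u r s : 0 <= GU u r s.
Proof. by rewrite addr_ge0// sqr_ge0. Qed.

Lemma GUD2pi u r s : GU u r (s + 2 * pi) = GU u r s.
Proof. by rewrite /GU [2 * pi]mulr_natl cosD2pi sinD2pi. Qed.

Lemma measurable_GU u : measurable_fun setT u ->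
  measurable_fun [set: R * R] (fun z => GU u z.1 z.2).
Proof.
move=> mu_; have m1 := measurable_PIx mu_; have m2 := measurable_PIy mu_.
by rewrite /GU; measr.
Qed.

End gradient.

(** * The gradient bounded by increments of the boundary function *)

Section carleson_estimate.
Context {R : realType}.
Notation mu := (@lebesgue_measure R).
Variables (sg al : R).
Hypothesis sg0 : 0 < sg.
Hypothesis sg1 : sg < 1.
Hypothesis al0 : 0 < al.
Hypothesis al1 : al < 1.
Implicit Types (u : R -> R) (a L s t : R).

(** At depth [h] the radius is [1 - h]: this is the density [(1 - |z|^2)^sg] times the Jacobian of
    polar coordinates, with an absolute value to keep it nonnegative for every real [h]. *)
Definition weight (h : R) : R := (1 - (1 - h) ^+ 2) `^ sg * `|1 - h|.

Definition carleson_cond u := exists2 C : R, 0 <= C & forall a L, 0 < L -> L <= 2 * pi ->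
  (\int[mu]_(s in `[a, (a + L)%R]) \int[mu]_(h in `]0%R, (L / (2 * pi))%R])
    (GU u (1 - h) s * weight h)%:E <= (C * L `^ (sg + 2 * al))%:E)%E.

Lemma sqr_le_split (w b : R) : 0 <= w -> 0 <= b ->
  w ^+ 2 <= 2 * (Num.max 0 (w - b)) ^+ 2 + 2 * b ^+ 2.
Proof.
move=> w0 b0; case: (leP 0 (w - b)) => h; first by have := sqr_ge0 (w - b - b); lra.
by rewrite expr0n mulr0 add0r; nra.
Qed.

(** Beyond distance [rho] the integrand is at most [136 K t^(al - 2)] on either side, by the Hoelder
    bound and [Dk_ge] ([136 = 2 * 68]); both sides together give the tail [b], with [272 = 2 * 136].
    Within [rho], Cauchy-Schwarz is used with the weight [2 / Dk], of mass at most [4 pi / (1 - r)],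
    and [Dk_ge] is applied once more. The remaining factors 2 come from squaring the sum of the two
    parts. *)
Lemma gradient_split (u : R -> R) (K r s rho w : R) : continuous u ->
  0 <= K -> (forall s t, `|s - t| <= 2 * pi -> `|u s - u t| <= K * `|s - t| `^ al) ->
  0 <= r < 1 -> 0 < rho -> rho <= 1 -> 0 <= w ->
  (w%:E <= \int[mu]_(t in `[(- pi)%R, pi]) (`|u (s + t) - u s| * (2 / Dk r t))%:E)%E ->
  ((w ^+ 2)%:E <= (8 * pi / (1 - r) * 136)%:E *
     \int[mu]_(t in `[(- rho)%R, rho]) ((u (s + t) - u s) ^+ 2 / ((1 - r) ^+ 2 + t ^+ 2))%:E
     + (2 * (272 * K / (1 - al) * rho `^ (al - 1)) ^+ 2)%:E)%E.
Proof.
move=> cu K0 HK hr rho0 rho1 w0 hw.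
case/andP: (hr) => r0 r1.
have p2 := @pi_ge2 R.
have h0 : 0 < 1 - r by rewrite subr_gt0.
have mu_ : measurable_fun setT u by exact: continuous_measurable_fun.
have mD := measurable_Dk r.
pose H t := `|u (s + t) - u s| * (2 / Dk r t).
have mH : measurable_fun setT (fun t => (H t)%:E) by rewrite /H; measr.
have k0 t : 0 <= 2 / Dk r t by rewrite divr_ge0// ltW// Dk_gt0.
have H0 t : (0 <= (H t)%:E)%E by rewrite lee_fin mulr_ge0.
have al' : 0 < 1 - al by rewrite subr_gt0.
set b := 272 * K / (1 - al) * rho `^ (al - 1).
have b0 : 0 <= b := mulr_ge0 (divr_ge0 (mulr_ge0 (ler0n _ 272) K0) (ltW al')) (powR_ge0 _ _).
have far t : rho <= t <= pi -> `|u (s + t) - u s| * (2 / Dk r t) <= 136 * K * t `^ (al - 2)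
   /\ `|u (s - t) - u s| * (2 / Dk r t) <= 136 * K * t `^ (al - 2).
  move=> /andP[t1 t2]; have t0 : 0 < t by exact: lt_le_trans t1.
  have tp : `|t| <= pi by rewrite ger0_norm// ltW.
  have hD : 2 / Dk r t <= 136 * t `^ (- 2%:R).
    rewrite powR_invn ?(ltW t0)// ler_pdivrMr ?Dk_gt0//.
    have hh : t ^+ 2 / 68 <= Dk r t.
      apply: le_trans (Dk_ge _ tp); last by rewrite r0 ltW.
      by rewrite ler_pM2r// lerDr sqr_ge0.
    rewrite mulrAC ler_pdivlMr ?exprn_gt0//; lra.
  have e : 136 * K * t `^ (al - 2) = (K * t `^ al) * (136 * t `^ (- 2%:R)).
    by rewrite powRD; [ring|rewrite (gt_eqF t0) implybT].
  rewrite e; split; apply: ler_pM => //.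
    have := HK (s + t) s; rewrite addrAC subrr add0r (gtr0_norm t0); apply; lra.
  by have := HK (s - t) s; rewrite addrAC subrr add0r normrN (gtr0_norm t0); apply; lra.
have farI : (\int[mu]_(t in `[rho, pi]) (136 * K * t `^ (al - 2))%:E <= (b / 2)%:E)%E.
  under eq_integral do rewrite EFinM.
  rewrite ge0_integralZl//; last 3 first.
  - by apply: measurable_funTS; measr.
  - by move=> t _; rewrite lee_fin powR_ge0.
  - by rewrite lee_fin mulr_ge0.
  apply: (@le_trans _ _ ((136 * K)%:E * (rho `^ (al - 2 + 1) / (- (al - 2) - 1))%:E)%E).
    apply: lee_wpmul2l; first by rewrite lee_fin mulr_ge0.
    by apply: integral_powR_lt => //; lra.
  rewrite -EFinM lee_fin /b (_ : al - 2 + 1 = al - 1); last by ring.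
  rewrite (_ : - (al - 2) - 1 = 1 - al); last by ring.
  by apply: eq_leW; field; rewrite gt_eqF.
have near_le : (w%:E <= \int[mu]_(t in `[(- rho)%R, rho]) (H t)%:E + b%:E)%E.
  apply: (le_trans hw).
  rewrite (@integral_itv_split _ (- pi) (- rho) pi); [|lra|lra|exact: mH|exact: H0].
  rewrite (@integral_itv_split _ (- rho) rho pi); [|lra|lra|exact: mH|exact: H0].
  rewrite addeCA; apply: leeD => //.
  rewrite [b]splitr EFinD; apply: leeD.
    rewrite (integral_itv_opp rho pi mH H0); apply: le_trans farI.
    apply: ge0_le_integral_nomeas => t /=; first by move=> _; exact: H0.
    rewrite in_itv/= => /far[_ h]; rewrite lee_fin; apply: le_trans h.
    by rewrite /H /Dk cosN.
  apply: le_trans farI; apply: ge0_le_integral_nomeas => t /=; first by move=> _; exact: H0.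
  by rewrite in_itv/= => /far[h _]; rewrite lee_fin.
(* Cauchy-Schwarz is stated for a nonnegative number, and [w - b] may be negative; its positive part
   obeys the same bound. *)
have near2 : ((Num.max 0 (w - b))%:E <= \int[mu]_(t in `[(- rho)%R, rho]) (H t)%:E)%E.
  have I0 : (0 <= \int[mu]_(t in `[(- rho)%R, rho]) (H t)%:E)%E by apply: integral_ge0.
  move: near_le I0; case: (\int[mu]_(t in `[(- rho)%R, rho]) (H t)%:E)%E => [x| |] //.
    rewrite -EFinD !lee_fin ge_max => h1 ->/=; lra.
  by move=> _ _; rewrite leey.
have Kpos : 0 < 4 * pi / (1 - r) by rewrite divr_gt0// mulr_gt0// pi_gt0.
have kint : (\int[mu]_(t in `[(- rho)%R, rho]) (2 / Dk r t)%:E <= (4 * pi / (1 - r))%:E)%E.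
  apply: (@le_trans _ _ (\int[mu]_(t in `[(- pi)%R, pi]) (2 / Dk r t)%:E)%E).
    by apply: ge0_subset_integral_nomeas => //; apply: subset_itv; rewrite bnd_simp; lra.
  rewrite integral_Dk// lee_fin ler_pM2l ?mulr_gt0 ?pi_gt0//.
  rewrite lef_pV2 ?posrE//; last by rewrite subr_gt0 expr_lt1.
  by nra.
have cs := @cauchy_schwarz_weighted _ _ _ mu `[(- rho)%R, rho]%classic (fun t => `|u (s + t) - u s|) (fun t => 2 / Dk r t)
  (4 * pi / (1 - r)) (Num.max 0 (w - b)).
have {}cs : (((Num.max 0 (w - b)) ^+ 2)%:E <= (4 * pi / (1 - r))%:E *
   \int[mu]_(t in `[(- rho)%R, rho]) (`|u (s + t) - u s| ^+ 2 * (2 / Dk r t))%:E)%E.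
  apply: cs => //.
  - by apply: measurable_funTS; measr.
  - by apply: measurable_funTS; measr.
  - by rewrite le_max lexx.
have J0 : (0 <= \int[mu]_(t in `[(- rho)%R, rho]) ((u (s + t) - u s) ^+ 2 / ((1 - r) ^+ 2 + t ^+ 2))%:E)%E.
  by apply: integral_ge0 => t _; rewrite lee_fin divr_ge0 ?addr_ge0 ?sqr_ge0.
have cs2 : (\int[mu]_(t in `[(- rho)%R, rho]) (`|u (s + t) - u s| ^+ 2 * (2 / Dk r t))%:E <=
  136%:E * \int[mu]_(t in `[(- rho)%R, rho]) ((u (s + t) - u s) ^+ 2 / ((1 - r) ^+ 2 + t ^+ 2))%:E)%E.
  rewrite -ge0_integralZl//; last 2 first.
  - by apply: measurable_funTS; measr.
  - by move=> t _; rewrite lee_fin divr_ge0 ?addr_ge0 ?sqr_ge0.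
  apply: ge0_le_integral_nomeas => t /=; first by rewrite lee_fin mulr_ge0// sqr_ge0.
  rewrite in_itv/= => /andP[t1 t2].
  have tp : `|t| <= pi by rewrite ler_norml; apply/andP; split; lra.
  rewrite -EFinM lee_fin real_normK ?num_real// [leRHS]mulrCA; apply: ler_wpM2l; first exact: sqr_ge0.
  have q0 : 0 < (1 - r) ^+ 2 + t ^+ 2 by rewrite ltr_pwDl ?exprn_gt0// sqr_ge0.
  have := @Dk_ge _ r t _ tp; rewrite r0 (ltW r1) => /(_ erefl) hD.
  rewrite ler_pdivrMr ?Dk_gt0// mulrAC ler_pdivlMr//; lra.
apply: (@le_trans _ _ (2%:E * ((Num.max 0 (w - b)) ^+ 2)%:E + (2 * b ^+ 2)%:E)%E).
  by rewrite -EFinM -EFinD lee_fin; exact: sqr_le_split.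
apply: leeD => //.
rewrite (_ : 8 * pi / (1 - r) * 136 = 2 * (4 * pi / (1 - r) * 136)); last by ring.
rewrite [X in (_ <= X * _)%E]EFinM -muleA; apply: lee_wpmul2l; first by rewrite lee_fin.
apply: (le_trans cs); rewrite [X in (_ <= X * _)%E]EFinM -muleA; apply: lee_wpmul2l => //.
by rewrite lee_fin ltW.
Qed.

Lemma weight_ge0 (h : R) : 0 <= weight h.
Proof. by rewrite mulr_ge0 ?powR_ge0. Qed.

Lemma weight_le (h : R) : 0 < h -> h <= 1 -> weight h <= 2 * h `^ sg.
Proof.
move=> h0 h1; rewrite /weight ger0_norm ?subr_ge0// (_ : 1 - (1 - h) ^+ 2 = (2 - h) * h); last by ring.
rewrite powRM ?(ltW h0)//; last by lra.
apply: (@le_trans _ _ ((2 - h) `^ sg * h `^ sg)).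
  by rewrite ler_piMr ?mulr_ge0 ?powR_ge0//; lra.
apply: ler_wpM2r; first exact: powR_ge0.
apply: (@le_trans _ _ (2 - h)); last by lra.
by apply: ler1_powR; [lra|exact: ltW].
Qed.

Lemma weight_ge (h : R) : 0 < h -> h <= 1 / 2 -> h `^ sg <= 2 * weight h.
Proof.
move=> h0 h1; rewrite /weight (_ : 1 - (1 - h) ^+ 2 = (2 - h) * h); last by ring.
rewrite powRM ?(ltW h0)//; last by lra.
rewrite ger0_norm; last by lra.
have h2 : 1 <= (2 - h) `^ sg.
  by rewrite -[X in X <= _](powRr0 (2 - h)); apply: ler_powR; [lra|exact: ltW].
have : 0 <= h `^ sg by exact: powR_ge0.
set X := h `^ sg; set Y := _ `^ sg in h2 * => X0.
rewrite (_ : 2 * (Y * X * (1 - h)) = X * (Y * (2 * (1 - h)))); last by ring.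
by rewrite ler_peMr//; nra.
Qed.

Lemma measurable_weight : measurable_fun setT weight.
Proof. by rewrite /weight; measr. Qed.

Lemma translation_carleson u : holder_periodic al u -> translation_cond sg al u -> carleson_cond u.
Proof.
move=> hu; have mu_ := holder_measurable al0 hu; have cu := holder_continuous al0 hu.
move=> /(two_sided mu_)[C C0 HC].
case: hu => u2pi [K K0 HK].
have p2 := @pi_ge2 R; have p0 : 0 < (pi : R) by exact: pi_gt0.
pose Ks := sg^-1 + (2 - sg)^-1.
have Ks0 : 0 <= Ks by rewrite addr_ge0// invr_ge0 ?(ltW sg0)// subr_ge0 (le_trans (ltW sg1))// ler1n.
(* The factor 4 is 2 for the two partial derivatives times 2 from [weight_le]; the tail [2 * b ^+ 2]
   becomes [8 * b ^+ 2] for the same reason. *)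
pose c1 : R := 4 * (8 * pi * 136).
have c10 : 0 <= c1 by rewrite !mulr_ge0// ltW.
pose b' := 272 * K / (1 - al).
have b'0 : 0 <= b'.
  by apply: divr_ge0 (mulr_ge0 (ler0n _ 272) K0) _; rewrite subr_ge0 ltW.
exists (c1 * Ks * C + 16 * pi * b' ^+ 2).
  by apply: addr_ge0 (mulr_ge0 (mulr_ge0 c10 Ks0) C0) (mulr_ge0 (mulr_ge0 _ (ltW p0)) (sqr_ge0 _)).
move=> a L L0 L2.
have r0 := rho_gt0 L0; have r1 := rho_le1 L2.
set r := L / (2 * pi) in HC r0 r1 *.
pose b := b' * r `^ (al - 1).
have b20 : 0 <= 8 * b ^+ 2 := mulr_ge0 (ler0n _ _) (sqr_ge0 b).
(* The exponent [sg - 1] combines the weight [h^sg] with the factor [1 / h] of [gradient_split]. *)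
pose F s h t := (u (s + t) - u s) ^+ 2 * (h `^ (sg - 1) / (h ^+ 2 + t ^+ 2)).
have F0 s h t : 0 <= F s h t.
  by rewrite mulr_ge0 ?sqr_ge0// divr_ge0 ?powR_ge0// addr_ge0// sqr_ge0.
have mF3 : measurable_fun [set: (R * R) * R] (fun z => F z.1.1 z.1.2 z.2).
  by rewrite /F; measr.
pose I s h := (\int[mu]_(t in `[(- r)%R, r]) (F s h t)%:E)%E.
have I0 s h : (0 <= I s h)%E by apply: integral_ge0 => t _; rewrite lee_fin.
have mI : measurable_fun [set: R * R] (fun z => I z.1 z.2).
  apply: (@measurable_integral_in R _ (R * R)%type _ (fun z t => (F z.1 z.2 t)%:E)) => //.
  - exact/measurable_EFinP.
  - by move=> z t; rewrite lee_fin.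
have bound s h : 0 < h -> h <= r ->
  ((GU u (1 - h) s * weight h)%:E <= c1%:E * I s h + (8 * b ^+ 2 * h `^ sg)%:E)%E.
  move=> h0 hr.
  have h1 : h <= 1 by exact: le_trans r1.
  have hr' : 0 <= 1 - h < 1 by apply/andP; split; lra.
  have hx := gradient_split cu K0 HK hr' r0 r1 (normr_ge0 _) (PIx_le s cu u2pi hr').
  have hy := gradient_split cu K0 HK hr' r0 r1 (normr_ge0 _) (PIy_le s cu u2pi hr').
  rewrite !real_normK ?num_real// in hx hy.
  set J := (\int[mu]_(t in _) _)%E in hx hy.
  have J0 : (0 <= J)%E.
    by apply: integral_ge0 => t _; rewrite lee_fin divr_ge0 ?addr_ge0 ?sqr_ge0.
  have hG : ((GU u (1 - h) s)%:E <= 2%:E * ((8 * pi / h * 136)%:E * J + (2 * b ^+ 2)%:E))%E.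
    rewrite /GU EFinD (_ : 2%:E = 1%:E + 1%:E)%E//.
    have e1 : 1 - (1 - h) = h by ring.
    rewrite e1 in hx hy.
    have X0 : (0 <= (8 * pi / h * 136)%:E * J + (2 * b ^+ 2)%:E)%E.
      apply: adde_ge0; last by rewrite lee_fin mulr_ge0// sqr_ge0.
      by apply: mule_ge0 => //; rewrite lee_fin !mulr_ge0 ?invr_ge0 ?(ltW p0) ?(ltW h0).
    by rewrite ge0_muleDl ?lee_fin// !mul1e; apply: leeD.
  rewrite EFinM.
  apply: (@le_trans _ _ (2%:E * ((8 * pi / h * 136)%:E * J + (2 * b ^+ 2)%:E) * (2 * h `^ sg)%:E)%E).
    apply: (@lee_pmul _ _ _ _ _) => //; rewrite ?lee_fin ?GU_ge0 ?weight_ge0//.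
    exact: weight_le.
  have JI : ((h `^ (sg - 1))%:E * J = I s h)%E.
    rewrite /J -ge0_integralZl//.
    - apply: eq_integral => t _; rewrite -EFinM /F; congr (_%:E).
      by rewrite (_ : 1 - (1 - h) = h); [ring|ring].
    - by apply: measurable_funTS; measr.
    - by move=> t _; rewrite lee_fin divr_ge0 ?addr_ge0 ?sqr_ge0.
    - by rewrite lee_fin powR_ge0.
  have e2 : h `^ sg = h * h `^ (sg - 1) by rewrite mulr_powRB1// ltW.
  rewrite -JI; clear hx hy hG JI.
  move: J0; case: J => [j| |] // j0.
    suff : 2 * (8 * pi / h * 136 * j + 2 * b ^+ 2) * (2 * h `^ sg) <= c1 * (h `^ (sg - 1) * j) + 8 * b ^+ 2 * h `^ sg by [].
    apply: eq_leW.
    by rewrite /c1 e2; field; rewrite gt_eqF.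
  (* If [J] is infinite, the right-hand side is infinite as well. *)
  have c1p : 0 < c1 by rewrite /c1 !mulr_gt0.
  rewrite [X in (_ <= _ * X + _)%E]gt0_muley ?lte_fin ?powR_gt0//.
  by rewrite [X in (_ <= X + _)%E]gt0_muley ?lte_fin// addye// leey.
apply: (@le_trans _ _ (\int[mu]_(s in `[a, (a + L)%R]) \int[mu]_(h in `]0%R, r]) (c1%:E * I s h + (8 * b ^+ 2 * h `^ sg)%:E))%E).
  have p0' s h : (0 <= (GU u (1 - h) s * weight h)%:E)%E by rewrite lee_fin mulr_ge0 ?GU_ge0 ?weight_ge0.
  apply: ge0_le_integral_nomeas => s _; first by apply: integral_ge0.
  by apply: ge0_le_integral_nomeas => h /=; rewrite in_itv/= => // /andP[h0 hr]; exact: bound.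
have mIs s : measurable_fun setT (I s).
  exact: (measurable_section1 s mI).
have mcI s : measurable_fun setT (fun h => (c1%:E * I s h)%E) by apply: measurable_funeM.
have mh : measurable_fun setT (fun h : R => (8 * b ^+ 2 * h `^ sg)%:E) by measr.
have q0 h : (0 <= (8 * b ^+ 2 * h `^ sg)%:E)%E by rewrite lee_fin (mulr_ge0 b20)// powR_ge0.
have mII : measurable_fun setT (fun s => \int[mu]_(h in `]0%R, r]) I s h)%E.
  exact: measurable_integral_in.
apply: (@le_trans _ _ (\int[mu]_(s in `[a, (a + L)%R]) (c1%:E * \int[mu]_(h in `]0%R, r]) I s h + (8 * b ^+ 2 * r `^ sg * r)%:E))%E).
  apply: ge0_le_integral_nomeas => s _.
    by apply: integral_ge0 => h _; rewrite adde_ge0// mule_ge0// lee_fin.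
  rewrite ge0_integralD//; last 3 first.
  - by move=> h _; rewrite mule_ge0// lee_fin.
  - by apply: measurable_funTS; exact: mcI.
  - by apply: measurable_funTS; exact: mh.
  rewrite ge0_integralZl//; last by apply: measurable_funTS; exact: mIs.
  apply: leeD => //.
  apply: (@le_trans _ _ (\int[mu]_(h in `[0%R, r]) (8 * b ^+ 2 * r `^ sg)%:E)%E).
    apply: (@le_trans _ _ (\int[mu]_(h in `]0%R, r]) (8 * b ^+ 2 * r `^ sg)%:E)%E).
      apply: ge0_le_integral_nomeas => h /=; first by move=> _; exact: q0.
      rewrite in_itv/= => /andP[h0 hr]; rewrite lee_fin; apply: ler_wpM2l; first exact: b20.
      by apply: ge0_ler_powR; rewrite ?nnegrE ?(ltW sg0) ?(ltW h0) ?(ltW r0).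
    apply: ge0_subset_integral_nomeas; last exact: subset_itv_oc_cc.
    by move=> h; rewrite lee_fin (mulr_ge0 b20)// powR_ge0.
  by rewrite integral_cst_itv ?(ltW r0)// subr0.
rewrite ge0_integralD//; last 3 first.
- by move=> s _; rewrite mule_ge0 ?lee_fin//; apply: integral_ge0.
- by apply: measurable_funTS; apply: measurable_funeM; exact: mII.
- by move=> s _; rewrite lee_fin (mulr_ge0 (mulr_ge0 b20 (powR_ge0 _ _)))// ltW.
rewrite [X in (_ <= X%:E)%E]mulrDl [X in (_ <= X)%E]EFinD; apply: leeD; last first.
  rewrite integral_cst_itv ?lerDl ?(ltW L0)// lee_fin [a + L]addrC addrK.
  (* The tail integrates to [8 * b ^+ 2 * r^sg * r * L]; with [b = b' * r^(al - 1)] and [L = 2 pi r]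
     this is [16 pi b' ^+ 2 * r^(sg + 2 al)]. *)
  have eL : L = 2 * pi * r by rewrite /r [RHS]mulrC divfK// gt_eqF// twopi_gt0.
  have e1 : r `^ (sg + 2 * al) <= L `^ (sg + 2 * al).
    apply: ge0_ler_powR; rewrite ?nnegrE ?(ltW L0) ?(ltW r0)//; last by rewrite eL; nra.
    by rewrite addr_ge0 ?(ltW sg0)// mulr_ge0// ltW.
  apply: (@le_trans _ _ (16 * pi * b' ^+ 2 * r `^ (sg + 2 * al))); last first.
    apply: ler_wpM2l e1; exact: (mulr_ge0 (mulr_ge0 (ler0n _ _) (ltW p0)) (sqr_ge0 _)).
  rewrite [X in _ * X <= _]eL /b exprMn -(powR_mulrn 2 (powR_ge0 r _)) -powRrM.
  rewrite (_ : sg + 2 * al = sg + ((al - 1) * 2%:R + 2%:R)); last by ring.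
  rewrite powRD; last by rewrite (gt_eqF r0) implybT.
  rewrite [r `^ (_ + 2)]powRD; last by rewrite (gt_eqF r0) implybT.
  rewrite powR_mulrn ?(ltW r0)//.
  by apply: eq_leW; ring.
rewrite ge0_integralZl//; last 2 first.
- by apply: measurable_funTS; exact: mII.
- by move=> s _; apply: integral_ge0.
rewrite [X in (_ <= X)%E](_ : _ = c1%:E * (Ks * (C * L `^ (sg + 2 * al)))%:E)%E; last by rewrite -EFinM !mulrA.
apply: lee_wpmul2l; first by rewrite lee_fin.
apply: (@le_trans _ _ (\int[mu]_(s in `[a, (a + L)%R]) \int[mu]_(t in `[(- r)%R, r])
  (Ks * ((u (s + t) - u s) ^+ 2 * `|t| `^ (sg - 2)))%:E)%E); last first.
  rewrite dintegralZ//; last 2 first.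
  - by move=> s t; rewrite mulr_ge0 ?sqr_ge0// powR_ge0.
  - by measr.
  by rewrite [X in (_ <= X)%E]EFinM; apply: lee_wpmul2l; [rewrite lee_fin|exact: HC].
apply: ge0_le_integral_nomeas => s _; first by apply: integral_ge0.
rewrite /I dtonelli//; last first.
  by apply: (measurableT_comp mF3 (g := fun z : R * R => ((s, z.1), z.2))); measr.
apply: ge0_le_integral_nomeas => t _; first by apply: integral_ge0 => h _; rewrite lee_fin.
(* The kernel bound needs [t] nonzero; at [t = 0] the increment itself vanishes. *)
have [->|tn0] := eqVneq t 0.
  rewrite integral0_eq; first by rewrite lee_fin; exact: (mulr_ge0 Ks0 (mulr_ge0 (sqr_ge0 _) (powR_ge0 _ _))).
  by move=> h _; rewrite /F addr0 subrr expr0n mul0r.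
have mk : measurable_fun setT (fun h : R => (h `^ (sg - 1) / (h ^+ 2 + t ^+ 2))%:E) by measr.
rewrite /F; under eq_integral do rewrite EFinM.
rewrite ge0_integralZl//; last 3 first.
- by apply: measurable_funTS; exact: mk.
- by move=> h _; rewrite lee_fin divr_ge0 ?powR_ge0 ?addr_ge0 ?sqr_ge0.
- by rewrite lee_fin sqr_ge0.
rewrite [X in (_ <= X%:E)%E]mulrCA [X in (_ <= X)%E]EFinM; apply: lee_wpmul2l; first by rewrite lee_fin sqr_ge0.
under eq_integral do rewrite -(real_normK (num_real t)).
by apply: kernel_integral; rewrite ?normr_gt0// ltW.
Qed.

End carleson_estimate.

(** * From the gradient to translations *)

Section path_estimates.
Context {R : realType}.
Notation mu := (@lebesgue_measure R).
Implicit Types (u : R -> R) (r s t th h : R).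

(** The path is the arc of radius [r] from angle [s] to [s + t], run at speed [r <= 1];
    Cauchy-Schwarz with weight 1 gives the factor [t]. *)
Lemma angular_sq u r s t : continuous u -> 0 <= r < 1 -> 0 < t ->
  (((PI u (r * cos (s + t)) (r * sin (s + t)) - PI u (r * cos s) (r * sin s)) ^+ 2)%:E
   <= t%:E * \int[mu]_(y in `[0%R, t]) (GU u r (s + y))%:E)%E.
Proof.
move=> cu /andP[r0 r1] t0.
have mu_ : measurable_fun setT u by exact: continuous_measurable_fun.
have ca (y : R) : continuous_at y (+%R s) by exact: (@cts_add R (fun=> s) (fun x => x) y (@cts_cst R s y) (@cts_id R y)).
have cr y : `|- (r * sin y)| <= 1 /\ `|r * cos y| <= 1.
  rewrite normrN !normrM (ger0_norm r0); split.
    by rewrite mulr_ile1 ?(ltW r1)// ler_norml sin_geN1 sin_le1.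
  by rewrite mulr_ile1 ?(ltW r1)// ler_norml cos_geN1 cos_le1.
have h := @path_increment R u (fun y => r * cos (s + y)) (fun y => r * sin (s + y))
   (fun y => - (r * sin (s + y))) (fun y => r * cos (s + y)) (-1) (t + 1) r cu.
have {}h : ((`|PI u (r * cos (s + t)) (r * sin (s + t)) - PI u (r * cos s) (r * sin s)|)%:E <=
   \int[mu]_(y in `[0%R, t]) (Num.sqrt (GU u r (s + y)))%:E)%E.
  have -> : (\int[mu]_(y in `[0%R, t]) (Num.sqrt (GU u r (s + y)))%:E =
    \int[mu]_(y in `[0%R, t]) (Num.sqrt (PIx u (r * cos (s + y)) (r * sin (s + y)) ^+ 2 + PIy u (r * cos (s + y)) (r * sin (s + y)) ^+ 2))%:E)%E by [].
  have e0 : s = s + 0 by rewrite addr0.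
  rewrite {3 4}e0; apply: (h _ _ _ _ _ _ _ _ _ 0 t).
  - by move=> y _; apply: is_derive_eq; rewrite /GRing.scale/=; ring.
  - by move=> y _; apply: is_derive_eq; rewrite /GRing.scale/=; ring.
  - by move=> y _; have [] := cr (s + y).
  - by move=> y _; have [] := cr (s + y).
  - exact: r0.
  - exact: r1.
  - by move=> y _; rewrite polar_sq.
  - by move=> y _; have cay := ca y; cts.
  - by move=> y _; have cay := ca y; cts.
  - exact: ltrN10.
  - exact: ltW.
  - by rewrite ltrDl.
  - by move=> y _; rewrite sqrrN addrC polar_sq expr_le1// (ltW r1).
rewrite -real_normK ?num_real//.
have mG := measurable_GU mu_.
have cs := @cauchy_schwarz_weighted _ _ _ mu `[0%R, t]%classic (fun y => Num.sqrt (GU u r (s + y))) (fun=> 1) t _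
  (measurable_itv _) _ _ _ _ t0 (normr_ge0 _) _ _.
apply: le_trans; first apply: cs.
- by apply: measurable_funTS; measr.
- exact: measurable_cst.
- by move=> y _; exact: sqrtr_ge0.
- by [].
- by rewrite integral_cst_itv ?(ltW t0)// mul1r subr0.
- by under eq_integral do rewrite mulr1.
by under eq_integral do rewrite mulr1 sqr_sqrtr ?GU_ge0//.
Qed.

(** The product is at most the square of the larger of [h] and [t]. *)
Lemma powR_mul_le_sqr (q h t : R) : 0 < h -> 0 < t -> 0 <= q -> q <= 2 ->
  h `^ q * t `^ (2 - q) <= h ^+ 2 + t ^+ 2.
Proof.
move=> h0 t0 q0 q2.
have q2' : 0 <= 2 - q by rewrite subr_ge0.
have e (m : R) : 0 < m -> m `^ q * m `^ (2 - q) = m ^+ 2.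
  move=> m0; rewrite -powRD; last by rewrite (gt_eqF m0) implybT.
  by rewrite addrC subrK -powR_mulrn// ltW.
have [ht|th] := leP h t.
  apply: (@le_trans _ _ (t ^+ 2)); last by rewrite lerDr sqr_ge0.
  rewrite -(e t t0); apply: ler_wpM2r; first exact: powR_ge0.
  by apply: ge0_ler_powR; rewrite ?nnegrE ?(ltW h0) ?(ltW t0).
apply: (@le_trans _ _ (h ^+ 2)); last by rewrite lerDl sqr_ge0.
rewrite -(e h h0); apply: ler_wpM2l; first exact: powR_ge0.
by apply: ge0_ler_powR; rewrite ?nnegrE ?(ltW h0) ?(ltW t0) ?(ltW th).
Qed.

(** By [Dk_ge] and [powR_mul_le_sqr] with [q = 1 - al / 2], the Poisson kernel at depth [h] is at
    most [136 h^(al / 2) t^(-1 - al / 2)]. Against increments of size [K t^al] this leaves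
    [t^(al / 2 - 1)], integrable at 0. Giving up half of the exponent avoids a separate discussion
    of [t < h]; the rate serves only to let the depth tend to 0. *)
Lemma PI_boundary (al K : R) u : 0 < al -> al < 1 -> continuous u -> (forall s, u (s + 2 * pi) = u s) ->
  0 <= K -> (forall s t, `|s - t| <= 2 * pi -> `|u s - u t| <= K * `|s - t| `^ al) ->
  exists2 M, 0 <= M & forall s h, 0 < h -> h <= 1 ->
   `|PI u ((1 - h) * cos s) ((1 - h) * sin s) - 2 * pi * u s| <= M * h `^ (al / 2).
Proof.
move=> al0 al1 cu u2 K0 HK.
have mu_ : measurable_fun setT u by exact: continuous_measurable_fun.
have p0 : 0 < (pi : R) by exact: pi_gt0.
have a2 : 0 < al / 2 by rewrite divr_gt0.
pose k : R := pi `^ (al / 2) / (al / 2).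
have k0 : 0 <= k by rewrite divr_ge0 ?powR_ge0// ltW.
exists (2 * (136 * K * k)); first exact: (mulr_ge0 (ler0n _ _) (mulr_ge0 (mulr_ge0 (ler0n _ _) K0) k0)).
move=> s h h0 h1.
have hr : 0 <= 1 - h < 1 by apply/andP; split; lra.
have mD := measurable_Dk (1 - h).
have w0 t : 0 <= (1 - (1 - h) ^+ 2) / Dk (1 - h) t.
  by apply: divr_ge0; [nra|rewrite ltW// Dk_gt0].
pose H t := `|u (s + t) - u s| * ((1 - (1 - h) ^+ 2) / Dk (1 - h) t).
have H0 t : (0 <= (H t)%:E)%E by rewrite lee_fin mulr_ge0.
have mH : measurable_fun setT (fun t => (H t)%:E) by rewrite /H; measr.
have c0 : 0 <= 136 * K * h `^ (al / 2) by rewrite !mulr_ge0// powR_ge0.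
have pt t : 0 < t -> t <= pi ->
   H t <= 136 * K * h `^ (al / 2) * t `^ (al / 2 - 1) /\ H (- t) <= 136 * K * h `^ (al / 2) * t `^ (al / 2 - 1).
  move=> t0 tp.
  have tp' : `|t| <= pi by rewrite gtr0_norm.
  have hD := @Dk_ge _ (1 - h) t (introT andP (conj (proj1 (andP hr)) (ltW (proj2 (andP hr))))) tp'.
  rewrite (_ : 1 - (1 - h) = h) in hD; last by ring.
  have W : (1 - (1 - h) ^+ 2) / Dk (1 - h) t <= 136 * (h `^ (al / 2) * t `^ (al / 2 - 1)) / t `^ al.
    have D0 := Dk_gt0 t hr.
    have e1 : h `^ (1 - al / 2) * t `^ (2 - (1 - al / 2)) <= h ^+ 2 + t ^+ 2.
      by apply: powR_mul_le_sqr => //; lra.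
    have e2 : h = h `^ (1 - al / 2) * h `^ (al / 2).
      rewrite -powRD; last by rewrite (gt_eqF h0) implybT.
      by rewrite subrK powRr1// ltW.
    have e3 : t `^ (2 - (1 - al / 2)) * t `^ (al / 2 - 1) / t `^ al = 1.
      rewrite -powRD; last by rewrite (gt_eqF t0) implybT.
      rewrite (_ : 2 - (1 - al / 2) + (al / 2 - 1) = al); last by field.
      by rewrite divff// gt_eqF// powR_gt0.
    rewrite ler_pdivrMr//.
    apply: (@le_trans _ _ (2 * h)); first by nra.
    set B := h `^ (al / 2) in e2 *; set Z := t `^ (al / 2 - 1) in e3 *.
    apply: (@le_trans _ _ (136 * (B * Z) / t `^ al * ((h ^+ 2 + t ^+ 2) / 68))); last first.
      by apply: ler_wpM2l => //; rewrite divr_ge0 ?powR_ge0// !mulr_ge0// powR_ge0.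
    apply: (@le_trans _ _ (136 * (B * Z) / t `^ al * ((h `^ (1 - al / 2) * t `^ (2 - (1 - al / 2))) / 68))); last first.
      apply: ler_wpM2l; first by rewrite divr_ge0 ?powR_ge0// !mulr_ge0// powR_ge0.
      by apply: ler_wpM2r => //; rewrite invr_ge0.
    rewrite (_ : 136 * (B * Z) / t `^ al * ((h `^ (1 - al / 2) * t `^ (2 - (1 - al / 2))) / 68)
       = 2 * (h `^ (1 - al / 2) * B) * (t `^ (2 - (1 - al / 2)) * Z / t `^ al)); last first.
      by field; rewrite gt_eqF// powR_gt0.
    by rewrite e3 mulr1 -e2.
  have ta0 : 0 < t `^ al by exact: powR_gt0.
  have fin (v : R) : `|v| <= K * t `^ al ->
     `|v| * ((1 - (1 - h) ^+ 2) / Dk (1 - h) t) <= 136 * K * h `^ (al / 2) * t `^ (al / 2 - 1).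
    move=> hv; apply: (@le_trans _ _ (K * t `^ al * (136 * (h `^ (al / 2) * t `^ (al / 2 - 1)) / t `^ al))).
      exact: ler_pM.
    by apply: eq_leW; field; rewrite gt_eqF.
  split.
    by apply: fin; have := HK (s + t) s; rewrite addrAC subrr add0r (gtr0_norm t0); apply; lra.
  rewrite /H /Dk cosN -/(Dk _ _).
  by apply: fin; have := HK (s - t) s; rewrite addrAC subrr add0r normrN (gtr0_norm t0); apply; lra.
have I : (\int[mu]_(t in `]0%R, pi]) (136 * K * h `^ (al / 2) * t `^ (al / 2 - 1))%:E
    <= (136 * K * k * h `^ (al / 2))%:E)%E.
  under eq_integral do rewrite EFinM.
  rewrite ge0_integralZl//; last 2 first.
  - by apply: measurable_funTS; measr.
  - by move=> t _; rewrite lee_fin powR_ge0.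
  apply: (@le_trans _ _ ((136 * K * h `^ (al / 2))%:E * (pi `^ (al / 2 - 1 + 1) / (al / 2 - 1 + 1))%:E)%E).
    apply: lee_wpmul2l; first by rewrite lee_fin.
    by apply: integral_powR_gt; lra.
  by rewrite subrK -EFinM lee_fin -/k mulrAC.
rewrite -lee_fin; apply: le_trans; first exact: (PI_sub_le s cu u2 hr).
rewrite (@integral_itv_split _ (- pi) 0 pi); [|lra|lra|exact: mH|exact: H0].
have -> : 2 * (136 * K * k) * h `^ (al / 2) = 136 * K * k * h `^ (al / 2) + 136 * K * k * h `^ (al / 2) by ring.
rewrite EFinD; apply: leeD.
  rewrite -{1}oppr0 (integral_itv_opp 0 pi mH H0) -integral_itv_obnd_cbnd; last first.
    apply: measurable_funTS; apply: (measurableT_comp mH); exact: oppr_measurable.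
  apply: le_trans I; apply: ge0_le_integral_nomeas => t /=; first by move=> _; exact: H0.
  by rewrite in_itv/= => /andP[t0 tp]; rewrite lee_fin; have [] := pt t t0 tp.
rewrite -integral_itv_obnd_cbnd; last exact: measurable_funTS.
apply: le_trans I; apply: ge0_le_integral_nomeas => t /=; first by move=> _; exact: H0.
by rewrite in_itv/= => /andP[t0 tp]; rewrite lee_fin; have [] := pt t t0 tp.
Qed.

(** The gradient is integrated along the radius from depth [e] to depth [t]. The weight [h^(-b)] in
    Cauchy-Schwarz has mass at most [t^(1 - b) / (1 - b)], finite because [b < 1]. The bound does
    not depend on [e], which then tends to 0 by the assumed boundary rate. *)
Lemma radial_sq (M al b : R) u s t : 0 < al -> 0 <= M -> continuous u ->
  (forall s h, 0 < h -> h <= 1 ->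
   `|PI u ((1 - h) * cos s) ((1 - h) * sin s) - 2 * pi * u s| <= M * h `^ al) ->
  0 < b -> b < 1 -> 0 < t -> t < 1 ->
  (((PI u ((1 - t) * cos s) ((1 - t) * sin s) - 2 * pi * u s) ^+ 2)%:E <=
   (t `^ (1 - b) / (1 - b))%:E * \int[mu]_(h in `]0%R, t]) (GU u (1 - h) s * h `^ b)%:E)%E.
Proof.
move=> al0 M0 cu hM b0 b1 t0 t1.
have mu_ : measurable_fun setT u by exact: continuous_measurable_fun.
have mG := measurable_GU mu_.
pose Q h := PI u ((1 - h) * cos s) ((1 - h) * sin s).
have step e : 0 < e -> e <= t ->
  (((Q t - Q e) ^+ 2)%:E <= (t `^ (1 - b) / (1 - b))%:E * \int[mu]_(h in `]0%R, t]) (GU u (1 - h) s * h `^ b)%:E)%E.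
  move=> e0 et.
  have h := @path_increment R u (fun h => (1 - h) * cos s) (fun h => (1 - h) * sin s)
     (fun=> - cos s) (fun=> - sin s) (e / 2) 1 (1 - e / 2) cu.
  have {}h : ((`|Q t - Q e|)%:E <= \int[mu]_(h in `[e, t]) (Num.sqrt (GU u (1 - h) s))%:E)%E.
    apply: (h _ _ _ _ _ _ _ _ _ e t).
    - by move=> y _; apply: is_derive_eq; rewrite /GRing.scale/=; ring.
    - by move=> y _; apply: is_derive_eq; rewrite /GRing.scale/=; ring.
    - by move=> y _; rewrite normrN ler_norml cos_geN1 cos_le1.
    - by move=> y _; rewrite normrN ler_norml sin_geN1 sin_le1.
    - lra.
    - lra.
    - move=> y /andP[y1 y2]; rewrite polar_sq ler_sqr ?nnegrE; lra.
    - by move=> y _; cts.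
    - by move=> y _; cts.
    - lra.
    - exact: et.
    - exact: t1.
    - by move=> y _; rewrite !sqrrN cos2Dsin2.
  have Kp : 0 < t `^ (1 - b) / (1 - b) by rewrite divr_gt0 ?powR_gt0// subr_gt0.
  have pe y : e <= y -> y `^ b * y `^ (- b) = 1.
    move=> ey; rewrite -powRD; last by rewrite (gt_eqF (lt_le_trans e0 ey)) implybT.
    by rewrite subrr powRr0.
  have cs := @cauchy_schwarz_weighted _ _ _ mu `[e, t]%classic (fun h => Num.sqrt (GU u (1 - h) s) * h `^ b) (fun h => h `^ (- b)) _ _
    (measurable_itv _) _ _ _ _ Kp (normr_ge0 _) _ _.
  rewrite -real_normK ?num_real//.
  apply: le_trans; first apply: cs.
  - by apply: measurable_funTS; measr.
  - by apply: measurable_funTS; measr.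
  - by move=> y _; rewrite mulr_ge0 ?sqrtr_ge0 ?powR_ge0.
  - by move=> y _; exact: powR_ge0.
  - apply: (@le_trans _ _ (\int[mu]_(y in `]0%R, t]) (y `^ (- b))%:E)%E).
      apply: ge0_subset_integral_nomeas; first by move=> y; rewrite lee_fin powR_ge0.
      by move=> y /=; rewrite !in_itv/= => /andP[y1 y2]; rewrite (lt_le_trans e0).
    apply: le_trans; first by apply: integral_powR_gt; lra.
    by rewrite (addrC _ 1).
  - apply: (le_trans h); apply: ge0_le_integral_nomeas => y /=; first by move=> _; rewrite lee_fin sqrtr_ge0.
    by rewrite in_itv/= => /andP[y1 y2]; rewrite lee_fin -mulrA pe// mulr1.
  apply: lee_wpmul2l; first by rewrite lee_fin ltW.
  apply: (@le_trans _ _ (\int[mu]_(h in `[e, t]) (GU u (1 - h) s * h `^ b)%:E)%E).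
    apply: ge0_le_integral_nomeas => y /=; first by move=> _; rewrite lee_fin mulr_ge0 ?sqr_ge0 ?powR_ge0.
    rewrite in_itv/= => /andP[y1 y2]; rewrite lee_fin exprMn sqr_sqrtr ?GU_ge0//.
    rewrite -mulrA; apply: ler_wpM2l; first exact: GU_ge0.
    by rewrite expr2 -mulrA pe// mulr1.
  apply: ge0_subset_integral_nomeas; first by move=> y; rewrite lee_fin mulr_ge0 ?GU_ge0 ?powR_ge0.
  by move=> y /=; rewrite !in_itv/= => /andP[y1 y2]; rewrite (lt_le_trans e0).
move: step; case: (_ * _)%E => [x| |] step.
- have x0 : 0 <= x by have := step t t0 (lexx _); rewrite lee_fin; apply: le_trans; exact: sqr_ge0.
  rewrite lee_fin -real_normK ?num_real//.
  suff hs : `|Q t - 2 * pi * u s| <= Num.sqrt x.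
    by rewrite -(sqr_sqrtr x0) ler_sqr ?nnegrE ?sqrtr_ge0.
  have key e : 0 < e -> e <= t -> `|Q t - 2 * pi * u s| <= Num.sqrt x + M * e `^ al.
    move=> e0 et; have := step e e0 et; rewrite lee_fin => h1.
    have h2 : `|Q t - Q e| <= Num.sqrt x.
      by rewrite -ler_sqr ?nnegrE ?sqrtr_ge0// sqr_sqrtr// real_normK ?num_real.
    have h3 := hM s e e0 (le_trans et (ltW t1)).
    rewrite (_ : Q t - _ = (Q t - Q e) + (Q e - 2 * pi * u s)); last by ring.
    by apply: le_trans (ler_normD _ _) _; exact: lerD.
  apply/ler_addgt0Pr => d d0.
  have M1 : 0 < M + 1 by rewrite ltr_wpDl.
  pose e := Num.min t ((d / (M + 1)) `^ al^-1).
  have e0 : 0 < e by rewrite lt_min t0 powR_gt0// divr_gt0.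
  have et : e <= t by rewrite ge_min lexx.
  apply: le_trans (key e e0 et) _; rewrite lerD2l.
  apply: (@le_trans _ _ (M * (d / (M + 1)))).
    apply: ler_wpM2l => //.
    have -> : d / (M + 1) = ((d / (M + 1)) `^ al^-1) `^ al.
      by rewrite -powRrM mulVf ?gt_eqF// powRr1// ltW// divr_gt0.
    by apply: ge0_ler_powR; rewrite ?nnegrE ?powR_ge0 ?(ltW al0) ?(ltW e0)// ge_min lexx orbT.
  rewrite mulrA ler_pdivrMr//; nra.
- by rewrite leey.
- by have := step t t0 (lexx _); rewrite leeNy_eq.
Qed.

End path_estimates.

(** * Hardy inequalities and the increment as a sum of three path integrals *)

Section carleson_translation.
Context {R : realType}.
Notation mu := (@lebesgue_measure R).
Variables (sg al : R).
Hypothesis sg0 : 0 < sg.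
Hypothesis sg1 : sg < 1.
Hypothesis al0 : 0 < al.
Hypothesis al1 : al < 1.
Implicit Types (u : R -> R) (a L s t : R).
Local Open Scope ereal_scope.

Lemma double_strip (f : R -> R -> \bar R) (a L r : R) : (0 <= L)%R ->
  measurable_fun [set: R * R] (fun z => f z.1 z.2) -> (forall s t, 0 <= f s t) ->
  \int[mu]_(s in `[a, (a + L + L)%R]) \int[mu]_(t in `]0%R, r]) f s t =
  \int[mu]_(s in `[a, (a + L)%R]) \int[mu]_(t in `]0%R, r]) f s t +
  \int[mu]_(s in `[(a + L)%R, (a + L + L)%R]) \int[mu]_(t in `]0%R, r]) f s t.
Proof.
move=> L0 mf f0; apply: integral_itv_split; rewrite ?lerDl//.
- exact: measurable_integral_in.
- by move=> s; apply: integral_ge0.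
Qed.

Lemma shifted_strip (f : R -> R -> \bar R) (a L r : R) : (0 <= L)%R -> (r <= L)%R ->
  measurable_fun [set: R * R] (fun z => f z.1 z.2) -> (forall s t, 0 <= f s t) ->
  \int[mu]_(s in `[a, (a + L)%R]) \int[mu]_(t in `]0%R, r]) f (s + t)%R t <=
  \int[mu]_(s in `[a, (a + L + L)%R]) \int[mu]_(t in `]0%R, r]) f s t.
Proof.
move=> L0 rL mf f0.
rewrite tonelli_in//; last first.
  by measr.
rewrite [leRHS]tonelli_in//.
apply: ge0_le_integral_nomeas => t /=; first by move=> _; apply: integral_ge0.
rewrite in_itv/= => /andP[t0 tr].
rewrite (integral_itv_shift t a _ true false (f := fun s => f s t))//; last first.
  exact: (measurable_section2 t mf).
apply: ge0_subset_integral_nomeas => // s /=.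
by rewrite !in_itv/= => /andP[h1 h2]; apply/andP; split; lra.
Qed.

(** The integrand of [t^(sg - 2)] times the bound of [radial_sq], with [g h] in place of the squared
    gradient at depth [h]. *)
Let F1 (g : R -> R) (b t h : R) : R :=
  if (h <= t)%R then (t `^ (sg - 1 - b) / (1 - b) * (g h * h `^ b))%R else 0%R.

(** After exchanging the integrals, [t] runs over [[h, r]]. Since [b > sg], the integral of
    [t^(sg - 1 - b)] is at most [h^(sg - b) / (b - sg)], and the factor [h^b] turns this into
    [h^sg]. *)
Lemma radial_hardy (g : R -> R) (b r : R) : (sg < b)%R -> (b < 1)%R -> (0 < r)%R ->
  measurable_fun setT g -> (forall h, (0 <= g h)%R) ->
  \int[mu]_(t in `]0%R, r]) \int[mu]_(h in `]0%R, r]) (F1 g b t h)%:E <=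
  (((1 - b) * (b - sg))^-1)%:E * \int[mu]_(h in `]0%R, r]) (g h * h `^ sg)%:E.
Proof.
move=> sb b1 r0 mg g0.
have b0 : (0 <= (1 - b)^-1)%R by rewrite invr_ge0 subr_ge0 ltW.
have F0 t h : (0 <= F1 g b t h)%R.
  by rewrite /F1; case: ifP => // _; rewrite !mulr_ge0 ?powR_ge0.
have mF : measurable_fun [set: R * R] (fun z => F1 g b z.1 z.2).
  by rewrite /F1; measr.
rewrite (dtonelli (measurable_itv _) (measurable_itv _) mF F0) -ge0_integralZl//; last 3 first.
- by apply: measurable_funTS; measr.
- by move=> h _; rewrite lee_fin mulr_ge0 ?powR_ge0.
- by rewrite lee_fin invr_ge0 mulr_ge0// subr_ge0 ltW.
apply: ge0_le_integral_nomeas => h /=; first by move=> _; apply: integral_ge0 => t _; rewrite lee_fin.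
rewrite in_itv/= => /andP[h0 hr].
apply: (@le_trans _ _ (\int[mu]_(t in `[h, r]) ((g h * h `^ b / (1 - b)) * t `^ (sg - 1 - b))%:E)).
  apply: (@le_trans _ _ (\int[mu]_(t in `]0%R, r]) (((fun t => ((g h * h `^ b / (1 - b)) * t `^ (sg - 1 - b))%:E) \_ `[h, +oo[) t))).
    apply: ge0_le_integral_nomeas => t /=; first by rewrite lee_fin.
    move=> _; rewrite /F1 patchE; case: ifPn => ht; last first.
      by case: ifP => // _; rewrite lee_fin !mulr_ge0 ?powR_ge0.
    rewrite ifT; last by rewrite inE/= in_itv/= ht.
    by rewrite lee_fin; apply: eq_leW; ring.
  rewrite -integral_mkcondr; apply: ge0_subset_integral_nomeas.
    by move=> t; rewrite lee_fin !mulr_ge0 ?powR_ge0.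
  by move=> t /= []; rewrite !in_itv/= andbT => /andP[_ tr] ht; rewrite ht.
under eq_integral do rewrite EFinM.
rewrite ge0_integralZl//; last 3 first.
- by apply: measurable_funTS; measr.
- by move=> t _; rewrite lee_fin powR_ge0.
- by rewrite lee_fin !mulr_ge0 ?powR_ge0.
apply: (@le_trans _ _ ((g h * h `^ b / (1 - b))%:E * (h `^ (sg - 1 - b + 1) / (- (sg - 1 - b) - 1))%:E)).
  apply: lee_wpmul2l; first by rewrite lee_fin !mulr_ge0 ?powR_ge0.
  by apply: integral_powR_lt => //; lra.
rewrite -!EFinM lee_fin.
have e : (h `^ sg = h `^ b * h `^ (sg - 1 - b + 1))%R.
  rewrite -powRD; last by rewrite (gt_eqF h0) implybT.
  by rewrite (_ : b + (sg - 1 - b + 1) = sg)%R//; ring.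
rewrite e (_ : - (sg - 1 - b) - 1 = b - sg)%R; last by ring.
apply: eq_leW; field.
by rewrite !subr_eq0 !gt_eqF.
Qed.

Let F2 (u : R -> R) (s t y : R) : R :=
  if (y <= t)%R then (t `^ (sg - 1) * GU u (1 - t) (s + y))%R else 0%R.

(** For fixed [t] and [y <= t], shifting [s] by [y] keeps it inside the doubled arc, so the integral
    in [s] is bounded independently of [y]. The integration in [y] then contributes the factor [t]
    that raises [t^(sg - 1)] to [t^sg]. *)
Lemma angular_hardy (u : R -> R) (a L r : R) : (0 <= L)%R -> (r <= L)%R -> measurable_fun setT u ->
  \int[mu]_(s in `[a, (a + L)%R]) \int[mu]_(t in `]0%R, r]) \int[mu]_(y in `[0%R, r]) (F2 u s t y)%:E <=
  \int[mu]_(s in `[a, (a + L + L)%R]) \int[mu]_(t in `]0%R, r]) (GU u (1 - t) s * t `^ sg)%:E.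
Proof.
move=> L0 rL mu_.
have mG := measurable_GU mu_.
have F0 s t y : (0 <= F2 u s t y)%R.
  by rewrite /F2; case: ifP => // _; rewrite mulr_ge0 ?powR_ge0 ?GU_ge0.
have mF : measurable_fun [set: (R * R) * R] (fun z => F2 u z.1.1 z.1.2 z.2).
  by rewrite /F2; measr.
rewrite tonelli_in//; last 2 first.
- apply: (@measurable_integral_in R _ (R * R)%type _ (fun z y => (F2 u z.1 z.2 y)%:E)) => //.
    exact/measurable_EFinP.
  by move=> z y; rewrite lee_fin.
- by move=> s t; apply: integral_ge0 => y _; rewrite lee_fin.
rewrite [leRHS]dtonelli//; [|by measr|by move=> s t; rewrite mulr_ge0 ?GU_ge0 ?powR_ge0].
apply: ge0_le_integral_nomeas => t /=.
  by move=> _; apply: integral_ge0 => s _; apply: integral_ge0 => y _; rewrite lee_fin.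
rewrite in_itv/= => /andP[t0 tr].
have mFt : measurable_fun [set: R * R] (fun z => F2 u z.1 t z.2).
  by apply: (measurableT_comp mF (g := fun z : R * R => ((z.1, t), z.2))); measr.
rewrite (@dtonelli _ _ _ (fun s y => F2 u s t y))//.
have mGt : measurable_fun setT (fun s : R => GU u (1 - t) s) by measr.
pose X := \int[mu]_(s in `[a, (a + L + L)%R]) (t `^ (sg - 1) * GU u (1 - t) s)%:E.
have X0 : 0 <= X by apply: integral_ge0 => s _; rewrite lee_fin mulr_ge0 ?powR_ge0 ?GU_ge0.
apply: (@le_trans _ _ (\int[mu]_(y in `[0%R, r]) ((fun=> X) \_ `[0%R, t]) y)).
  apply: ge0_le_integral_nomeas => y /=.
    by move=> _; apply: integral_ge0 => s _; rewrite lee_fin.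
  rewrite in_itv/= => /andP[y0 yr]; rewrite patchE.
  have [yt|yt] := leP y t; last first.
    rewrite integral0_eq; first by case: ifP.
    by move=> s _; rewrite /F2 leNgt yt.
  rewrite ifT; last by rewrite inE/= in_itv/= y0.
  under eq_integral do rewrite /F2 yt.
  rewrite (integral_itv_shift y a _ true false (f := fun s => (t `^ (sg - 1) * GU u (1 - t) s)%:E))//; last 2 first.
  - by measr.
  - by move=> s; rewrite lee_fin mulr_ge0 ?powR_ge0 ?GU_ge0.
  apply: ge0_subset_integral_nomeas.
    by move=> s; rewrite lee_fin mulr_ge0 ?powR_ge0 ?GU_ge0.
  by move=> s /=; rewrite !in_itv/= => /andP[h1 h2]; apply/andP; split; lra.
rewrite -integral_mkcondr.
apply: (@le_trans _ _ (\int[mu]_(y in `[0%R, t]) X)).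
  by apply: ge0_subset_integral_nomeas => //; exact: subIsetr.
rewrite integral_cst//= lebesgue_measure_itv/= lte_fin t0 -EFinD subr0 muleC /X.
rewrite -ge0_integralZl//; last 3 first.
- by apply: measurable_funTS; measr.
- by move=> s _; rewrite lee_fin mulr_ge0 ?powR_ge0 ?GU_ge0.
- by rewrite lee_fin ltW.
apply: ge0_le_integral_nomeas => s _.
  by rewrite mule_ge0// lee_fin ?(ltW t0)// mulr_ge0 ?powR_ge0 ?GU_ge0.
rewrite -EFinM lee_fin mulrA mulr_powRB1//; last exact: ltW.
by rewrite mulrC.
Qed.

Lemma carleson_translation u : holder_periodic al u -> carleson_cond sg al u -> translation_cond sg al u.
Proof.
move=> hu; have mu_ := holder_measurable al0 hu; have cu := holder_continuous al0 hu.
move=> [C C0 HC].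
case: hu => u2pi [K K0 HK].
have p2 := @pi_ge2 R.
have [M M0 HM] := PI_boundary al0 al1 cu u2pi K0 HK.
(* The midpoint of []sg, 1[]: [b < 1] is needed by [radial_sq] and [b > sg] by [radial_hardy]. *)
pose b : R := ((1 + sg) / 2)%R.
have [b0 b1 sb] : [/\ (0 < b)%R, (b < 1)%R & (sg < b)%R] by have s0 := sg0; have s1 := sg1; rewrite /b; split; lra.
pose c1 : R := (((1 - b) * (b - sg))^-1)%R.
have c10 : (0 <= c1)%R by rewrite invr_ge0 mulr_ge0// subr_ge0 ltW.
(* The radial pieces contribute [2 * c1] at [s + t], where the arc is doubled, and [c1] at [s]; the
   angular piece contributes 2. The factor [2 * C] comes from [weight_ge]. *)
pose D : R := ((3 * c1 + 2) * (2 * C))%R.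
have D0 : (0 <= D)%R by apply: mulr_ge0 (addr_ge0 (mulr_ge0 _ c10) _) (mulr_ge0 _ C0).
exists (D + K ^+ 2 * (4 * pi) `^ (2 - sg))%R; first exact: (addr_ge0 D0 (mulr_ge0 (sqr_ge0 _) (powR_ge0 _ _))).
move=> a L L0 L2.
have r0 := rho_gt0 L0; have r1 := rho_le1 L2; have rL := rho_le L0.
set rho := (L / (2 * pi))%R in r0 r1 rL *.
(* Halving gives depths at most [1/2], as [weight_ge] requires; shifts between [r] and [rho] are
   left to the Hoelder bound. *)
pose r := (rho / 2)%R.
have [r'0 r'h r'L] : [/\ (0 < r)%R, (r <= 1 / 2)%R & (r <= L)%R] by rewrite /r; split; lra.
have mG := measurable_GU mu_.
pose W s := \int[mu]_(h in `]0%R, r]) (GU u (1 - h) s * h `^ sg)%:E.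
have W0 s : 0 <= W s by apply: integral_ge0 => h _; rewrite lee_fin mulr_ge0 ?GU_ge0 ?powR_ge0.
have mW : measurable_fun setT W.
  by apply: measurable_dsection => //; [measr|move=> s t; rewrite mulr_ge0 ?GU_ge0 ?powR_ge0].
pose T := (2 * C * L `^ (sg + 2 * al))%R.
have WT a' : \int[mu]_(s in `[a', (a' + L)%R]) W s <= T%:E.
  have w0 s h : (0 <= GU u (1 - h) s * weight sg h)%R by rewrite mulr_ge0 ?GU_ge0 ?weight_ge0.
  apply: (@le_trans _ _ (\int[mu]_(s in `[a', (a' + L)%R]) \int[mu]_(h in `]0%R, rho]) (2 * (GU u (1 - h) s * weight sg h))%:E)).
    apply: ge0_le_integral_nomeas => s _; first exact: W0.
    apply: (@le_trans _ _ (\int[mu]_(h in `]0%R, r]) (2 * (GU u (1 - h) s * weight sg h))%:E)).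
      apply: ge0_le_integral_nomeas => h /=; first by rewrite lee_fin mulr_ge0 ?GU_ge0 ?powR_ge0.
      rewrite in_itv/= => /andP[h0 hr]; rewrite lee_fin mulrCA; apply: ler_wpM2l; first exact: GU_ge0.
      by apply: weight_ge => //; exact: le_trans r'h.
    apply: ge0_subset_integral_nomeas; first by move=> h; rewrite lee_fin mulr_ge0.
    by apply: subset_itvl; rewrite bnd_simp /r; lra.
  have mw := @measurable_weight R sg.
  rewrite (dintegralZ (measurable_itv _) (measurable_itv _) (ler0n R 2) w0); last by measr.
  rewrite /T -mulrA [leRHS]EFinM; apply: lee_wpmul2l; first by rewrite lee_fin.
  exact: HC.
have mW2 : measurable_fun [set: R * R] (fun z => (GU u (1 - z.2) z.1 * z.2 `^ sg)%:E) by measr.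
have W2T : \int[mu]_(s in `[a, (a + L + L)%R]) W s <= (2 * T)%:E.
  rewrite /W double_strip ?(ltW L0)//; last by move=> s t; rewrite lee_fin mulr_ge0 ?GU_ge0 ?powR_ge0.
  by rewrite mulrDl mul1r EFinD; apply: leeD; exact: WT.
pose E1 s t := \int[mu]_(h in `]0%R, r]) (F1 (fun h => GU u (1 - h) s) b t h)%:E.
pose E2 s t := \int[mu]_(y in `[0%R, r]) (F2 u s t y)%:E.
have F10 s t h : (0 <= F1 (fun h => GU u (1 - h) s) b t h)%R.
  rewrite /F1; case: ifP => // _.
  by rewrite !mulr_ge0 ?GU_ge0 ?powR_ge0 ?invr_ge0 ?subr_ge0 ?(ltW b1).
have F20 s t y : (0 <= F2 u s t y)%R.
  by rewrite /F2; case: ifP => // _; rewrite mulr_ge0 ?powR_ge0 ?GU_ge0.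
have E10 s t : 0 <= E1 s t by apply: integral_ge0 => h _; rewrite lee_fin.
have E20 s t : 0 <= E2 s t by apply: integral_ge0 => y _; rewrite lee_fin.
have mE1 : measurable_fun [set: R * R] (fun z => E1 z.1 z.2).
  apply: (@measurable_integral_in R _ (R * R)%type _ (fun z h => (F1 (fun h => GU u (1 - h) z.1) b z.2 h)%:E)) => //.
    by rewrite /F1; measr.
  by move=> z h; rewrite lee_fin.
have mE2 : measurable_fun [set: R * R] (fun z => E2 z.1 z.2).
  apply: (@measurable_integral_in R _ (R * R)%type _ (fun z y => (F2 u z.1 z.2 y)%:E)) => //.
    by rewrite /F2; measr.
  by move=> z y; rewrite lee_fin.
have mE1' : measurable_fun [set: R * R] (fun z => E1 (z.1 + z.2)%R z.2).
  by apply: (measurableT_comp mE1 (g := fun z : R * R => ((z.1 + z.2)%R, z.2))); measr.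
have E1rad s t : (0 < t)%R -> (t <= r)%R ->
  (t `^ (sg - 2))%:E * ((PI u ((1 - t) * cos s) ((1 - t) * sin s) - 2 * pi * u s) ^+ 2)%:E <= E1 s t.
  move=> t0 tr.
  have al2 : (0 < al / 2)%R by rewrite divr_gt0.
  have t1 : (t < 1)%R by lra.
  have h := radial_sq s al2 M0 cu HM b0 b1 t0 t1.
  apply: (@le_trans _ _ ((t `^ (sg - 2))%:E * ((t `^ (1 - b) / (1 - b))%:E * \int[mu]_(h in `]0%R, t]) (GU u (1 - h) s * h `^ b)%:E))).
    by apply: lee_wpmul2l => //; rewrite lee_fin powR_ge0.
  rewrite muleA -EFinM -ge0_integralZl//; last 3 first.
  - by apply: measurable_funTS; measr.
  - by move=> h' _; rewrite lee_fin mulr_ge0 ?GU_ge0 ?powR_ge0.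
  - by rewrite lee_fin !mulr_ge0 ?powR_ge0 ?invr_ge0 ?subr_ge0 ?(ltW b1).
  apply: (@le_trans _ _ (\int[mu]_(h in `]0%R, t]) (F1 (fun h => GU u (1 - h) s) b t h)%:E)).
    apply: eq_leW; apply: eq_integral => h'.
    rewrite inE/= in_itv/= => /andP[h0 ht]; rewrite /F1 ht -EFinM; congr (_%:E).
    congr (_ * _)%R; rewrite mulrA -powRD; last by rewrite (gt_eqF t0) implybT.
    by rewrite (_ : sg - 2 + (1 - b) = sg - 1 - b)%R//; ring.
  apply: ge0_subset_integral_nomeas; first by move=> h'; rewrite lee_fin.
  by move=> h' /=; rewrite !in_itv/= => /andP[-> ht]/=; exact: le_trans tr.
have E2ang s t : (0 < t)%R -> (t <= r)%R ->
  (t `^ (sg - 2))%:E * ((PI u ((1 - t) * cos (s + t)) ((1 - t) * sin (s + t)) - PI u ((1 - t) * cos s) ((1 - t) * sin s)) ^+ 2)%:E <= E2 s t.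
  move=> t0 tr.
  have hr : (0 <= 1 - t < 1)%R by apply/andP; split; lra.
  have h := angular_sq s cu hr t0.
  apply: (@le_trans _ _ ((t `^ (sg - 2))%:E * (t%:E * \int[mu]_(y in `[0%R, t]) (GU u (1 - t) (s + y))%:E))).
    by apply: lee_wpmul2l => //; rewrite lee_fin powR_ge0.
  rewrite muleA -EFinM -ge0_integralZl//; last 3 first.
  - by apply: measurable_funTS; measr.
  - by move=> y _; rewrite lee_fin GU_ge0.
  - by rewrite lee_fin mulr_ge0 ?powR_ge0// ltW.
  apply: (@le_trans _ _ (\int[mu]_(y in `[0%R, t]) (F2 u s t y)%:E)).
    apply: eq_leW; apply: eq_integral => y.
    rewrite inE/= in_itv/= => /andP[y0 yt]; rewrite /F2 yt -EFinM; congr (_%:E).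
    rewrite (_ : sg - 2 = sg - 1 - 1)%R; last by ring.
    congr (_ * _)%R; rewrite -[X in (_ * X)%R](powRr1 (ltW t0)) -powRD; last by rewrite (gt_eqF t0) implybT.
    by rewrite subrK.
  apply: ge0_subset_integral_nomeas; first by move=> y; rewrite lee_fin.
  by move=> y /=; rewrite !in_itv/= => /andP[-> ht]/=; exact: le_trans tr.
have pointwise s t : (0 < t)%R -> (t <= r)%R ->
  ((u (s + t) - u s) ^+ 2 * t `^ (sg - 2))%:E <= E1 (s + t)%R t + E2 s t + E1 s t.
  move=> t0 tr.
  have h1 := E1rad s t t0 tr; have h2 := E2ang s t t0 tr; have h3 := E1rad (s + t)%R t t0 tr.
  apply: le_trans (leeD (leeD h3 h2) h1).
  rewrite -!EFinM -!EFinD lee_fin mulrC -!mulrDr; apply: ler_wpM2l; first exact: powR_ge0.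
  (* The difference [2 pi (x - y)] is the sum of three increments. The factor 3 from squaring it is
     absorbed by [(2 pi) ^+ 2 >= 16]. *)
  set A := PI _ _ _; set B := PI _ _ _; set x := u _; set y := u s.
  have q1 : (0 <= (2 * pi * x - A - (A - B)) ^+ 2)%R by exact: sqr_ge0.
  have q2 : (0 <= (2 * pi * x - A - (B - 2 * pi * y)) ^+ 2)%R by exact: sqr_ge0.
  have q3 : (0 <= (A - B - (B - 2 * pi * y)) ^+ 2)%R by exact: sqr_ge0.
  have q4 : (16 * (x - y) ^+ 2 <= (2 * pi) ^+ 2 * (x - y) ^+ 2)%R.
    by apply: ler_wpM2r; [exact: sqr_ge0|nra].
  have q5 : ((2 * pi) ^+ 2 * (x - y) ^+ 2 <= 3 * ((A - 2 * pi * x) ^+ 2 + (A - B) ^+ 2 + (B - 2 * pi * y) ^+ 2))%R.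
    rewrite -subr_ge0 (_ : _ - _ = (2 * pi * x - A - (A - B)) ^+ 2 + (2 * pi * x - A - (B - 2 * pi * y)) ^+ 2 + (A - B - (B - 2 * pi * y)) ^+ 2)%R; last by ring.
    by rewrite !addr_ge0.
  have q7 : (0 <= (A - 2 * pi * x) ^+ 2)%R by exact: sqr_ge0.
  have q8 : (0 <= (A - B) ^+ 2)%R by exact: sqr_ge0.
  have q9 : (0 <= (B - 2 * pi * y) ^+ 2)%R by exact: sqr_ge0.
  lra.
pose k s t := ((u (s + t) - u s) ^+ 2 * t `^ (sg - 2))%R.
have k0 s t : (0 <= k s t)%R by rewrite mulr_ge0 ?sqr_ge0 ?powR_ge0.
have mk : measurable_fun [set: R * R] (fun z => k z.1 z.2) by rewrite /k; measr.
have mks s : measurable_fun setT (fun t => (k s t)%:E).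
  by apply/measurable_EFinP; exact: (measurable_section1 s mk).
pose m := (K ^+ 2 * L `^ (2 * al) * (L / (2 * pi) / 2) `^ (sg - 2))%R.
have m0 : (0 <= m)%R by rewrite !mulr_ge0 ?sqr_ge0 ?powR_ge0.
have far s : \int[mu]_(t in `[r, rho]) (k s t)%:E <= (m * L)%:E.
  apply: (@le_trans _ _ (\int[mu]_(t in `[r, rho]) m%:E)).
    apply: ge0_le_integral_nomeas => t /=; first by rewrite lee_fin.
    rewrite in_itv/= => /andP[rt trho]; rewrite lee_fin /k /m; apply: ler_pM; rewrite ?sqr_ge0 ?powR_ge0//.
      apply: holder_sq_le => //; rewrite addrAC subrr add0r ger0_norm; lra.
    exact: powR_subr2_le.
  rewrite integral_cst_itv; last by rewrite /r; lra.
  by rewrite lee_fin; apply: ler_wpM2l => //; rewrite /r; lra.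
apply: (@le_trans _ _ (\int[mu]_(s in `[a, (a + L)%R]) (\int[mu]_(t in `]0%R, r]) (k s t)%:E + (m * L)%:E))).
  apply: ge0_le_integral_nomeas => s _; first by apply: integral_ge0 => t _; rewrite lee_fin; exact: k0.
  apply: (@le_trans _ _ (\int[mu]_(t in `]0%R, r] `|` `[r, rho]) (k s t)%:E)).
    apply: ge0_subset_integral_nomeas; first by move=> t; rewrite lee_fin; exact: k0.
    move=> t /=; rewrite !in_itv/= => /andP[t0 tr].
    by have [h|h] := leP t r; [left; rewrite t0|right; rewrite (ltW h)].
  apply: le_trans; first by apply: integral_setU_le => // t; rewrite lee_fin; exact: k0.
  by apply: leeD.
rewrite ge0_integralD//; last 3 first.
- by move=> s _; apply: integral_ge0 => t _; rewrite lee_fin; exact: k0.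
- by apply: measurable_funTS; exact: measurable_dsection.
- by move=> s _; rewrite lee_fin mulr_ge0// ltW.
rewrite [leRHS](_ : _ = (D * L `^ (sg + 2 * al))%:E + (m * L * L)%:E); last first.
  by rewrite -EFinD mulrDl /m far_scale.
apply: leeD; last first.
  by rewrite integral_cst_itv ?lerDl ?(ltW L0)// lee_fin [(a + L)%R]addrC addrK.
apply: (@le_trans _ _ (\int[mu]_(s in `[a, (a + L)%R]) \int[mu]_(t in `]0%R, r]) (E1 (s + t)%R t + E2 s t + E1 s t))).
  apply: ge0_le_integral_nomeas => s _; first by apply: integral_ge0 => t _; rewrite lee_fin.
  apply: ge0_le_integral_nomeas => t /=; first by rewrite lee_fin.
  by rewrite in_itv/= => /andP[t0 tr]; exact: pointwise.
have E10' s t : 0 <= E1 (s + t)%R t by exact: E10.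
rewrite (ge0_dintegralD _ _ (emeasurable_funD mE1' mE2) (fun s t => adde_ge0 (E10' s t) (E20 s t)) mE1 E10)//.
rewrite (ge0_dintegralD _ _ mE1' E10' mE2 E20)//.
have I1 a' : \int[mu]_(s in `[a', (a' + L)%R]) \int[mu]_(t in `]0%R, r]) E1 s t <= (c1 * T)%:E.
  apply: (@le_trans _ _ (\int[mu]_(s in `[a', (a' + L)%R]) (c1%:E * W s))).
    apply: ge0_le_integral_nomeas => s _; first by apply: integral_ge0.
    apply: radial_hardy => //; last by move=> h; exact: GU_ge0.
    by measr.
  rewrite ge0_integralZl//; last by apply: measurable_funTS; exact: mW.
  by rewrite [leRHS]EFinM; apply: lee_wpmul2l; [rewrite lee_fin|exact: WT].
have I2 : \int[mu]_(s in `[a, (a + L)%R]) \int[mu]_(t in `]0%R, r]) E1 (s + t)%R t <= (2 * (c1 * T))%:E.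
  apply: (le_trans (@shifted_strip E1 a L r (ltW L0) r'L mE1 E10)).
  rewrite (@double_strip E1 a L r (ltW L0) mE1 E10).
  by rewrite [X in X%:E]mulrDl mul1r EFinD; apply: leeD; exact: I1.
have I3 : \int[mu]_(s in `[a, (a + L)%R]) \int[mu]_(t in `]0%R, r]) E2 s t <= (2 * T)%:E.
  exact: (le_trans (@angular_hardy u a L r (ltW L0) r'L mu_) W2T).
apply: le_trans; first exact: (leeD (leeD I2 I3) (I1 a)).
by rewrite -!EFinD lee_fin /D /T; apply: eq_leW; ring.
Qed.

End carleson_translation.

(** * Polar coordinates *)

Section density.
Context d (T : measurableType d) {R : realType} (m : {measure set T -> \bar R}).
Variable f : T -> \bar R.
Hypothesis mf : measurable_fun [set: T] f.
Hypothesis f0 : forall x, (0 <= f x)%E.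

Definition density (_ : measurable_fun [set: T] f) (_ : forall x, (0 <= f x)%E) (A : set T) :=
  (\int[m]_(x in A) f x)%E.

Let density0 : density mf f0 set0 = 0%E.
Proof. exact: integral_set0. Qed.

Let density_ge0 A : (0 <= density mf f0 A)%E.
Proof. by apply: integral_ge0 => x _; exact: f0. Qed.

Let density_sigma_additive : semi_sigma_additive (density mf f0).
Proof. exact: semi_sigma_additive_nng_induced. Qed.

HB.instance Definition _ := isMeasure.Build _ _ _ (density mf f0)
  density0 density_ge0 density_sigma_additive.

Lemma density_exists : exists nu : {measure set T -> \bar R},
  forall A, nu A = (\int[m]_(x in A) f x)%E.
Proof. by exists (density mf f0). Qed.

End density.

Section polar.
Context {R : realType}.
Notation mu := (@lebesgue_measure R).
Local Notation I := `](- (pi / 2))%R, ((pi : R) / 2)%R[%classic.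
Local Open Scope ereal_scope.

Lemma layer (c v : R) : (0 <= c)%R -> (0 <= v)%R ->
  \int[mu]_(l in `]0%R, +oo[) (if (l < v)%R then c else 0%R)%:E = (c * v)%:E.
Proof.
move=> c0 v0.
have -> : \int[mu]_(l in `]0%R, +oo[) (if (l < v)%R then c else 0%R)%:E =
    \int[mu]_(l in `]0%R, +oo[) ((fun=> c%:E) \_ `]-oo, v[) l.
  by apply: eq_integral => l _; rewrite patchE; case: ifPn => h; [rewrite ifT//|rewrite ifF//];
     rewrite ?inE/= ?in_itv/= ?h//; apply/negbTE; rewrite notin_setE/= in_itv/=; exact/negP.
rewrite -integral_mkcondr (_ : _ `&` _ = `]0%R, v[%classic); last first.
  apply/seteqP; split => l /=; rewrite !in_itv/= andbT; first by case=> -> ->.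
  by move=> /andP[-> ->].
rewrite integral_cst//= lebesgue_measure_itv/= lte_fin.
case: ifPn => [_|]; first by rewrite -EFinD subr0 -EFinM.
rewrite -leNgt => v0'; have -> : v = 0%R by apply/eqP; rewrite eq_le v0 v0'.
by rewrite mule0 mulr0.
Qed.

Lemma cos_gt0I th : I th -> (0 < cos th)%R.
Proof. by rewrite /= in_itv/= => h; exact: cos_gt0_pihalf. Qed.

Lemma measurable_tan : measurable_fun setT (@tan R).
Proof. by rewrite /tan; measr. Qed.

(* The case of an indicator function in [integral_tan], from which the general
   case follows by the layer-cake formula [layer]. *)
Lemma tan_pushforward (x : R) (A : set R) : (0 < x)%R -> measurable A ->
  mu A = \int[mu]_(th in ((fun th => x * tan th)%R @^-1` A) `&` I) (x / cos th ^+ 2)%:E.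
Proof.
move=> x0 mA; have xn : x != 0%R by rewrite gt_eqF.
pose w := (fun th : R => (x / cos th ^+ 2)%:E) \_ I.
have w0 th : 0 <= w th.
  by rewrite /w patchE; case: ifP => // _; rewrite lee_fin divr_ge0 ?sqr_ge0// ltW.
have mw : measurable_fun setT w.
  by apply/(measurable_restrictT _ _).1 => //; apply: measurable_funTS; measr.
have mt : @measurable_fun _ _ (measurableTypeR R) (measurableTypeR R) setT (fun th => x * tan th)%R.
  by have h := measurable_tan; measr.
pose nu : {measure set (measurableTypeR R) -> \bar R} :=
  pushforward (density mu mw w0) ((fun th => x * tan th)%R : measurableTypeR R -> measurableTypeR R).
have : mu A = nu mt A.
  (* It suffices to test on []a, b]]: the preimage is an interval between arctangents, on which
     [x / cos th ^+ 2] has the primitive [x tan th]. *)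
  apply: (@lebesgue_measure_unique _ (nu mt)) => //= _ [[a b]] _ <-.
  rewrite /nu/= /pushforward/= /density /w -integral_mkcondr.
  have -> : (fun th : R => (x * tan th)%R) @^-1` `]a, b]%classic `&` I = `](atan (a / x)), (atan (b / x))]%classic.
    apply/seteqP; split => th /=; rewrite !in_itv/=.
      case=> /andP[h1 h2] h; rewrite -(tanK (x := th)) ?in_itv//.
      rewrite lt_atan ?le_atan// ?ltr_pdivrMr ?ler_pdivlMr// mulrC//.
    move=> /andP[h1 h2].
    have h : (- (pi / 2) < th < pi / 2)%R.
      by rewrite (lt_trans (atan_gtNpi2 _) h1) (le_lt_trans h2 (atan_ltpi2 _)).
    split=> //; have ha := atan_gtNpi2; have hb := atan_ltpi2.
    have t1 : (a / x < tan th)%R by rewrite -[X in (X < _)%R]atanK ltr_tan// in_itv/= ?ha ?hb.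
    have t2 : (tan th <= b / x)%R.
      rewrite -[X in (_ <= X)%R]atanK; move: h2; rewrite le_eqVlt => /orP[/eqP ->//|h2].
      by rewrite ltW// ltr_tan// in_itv/= ?ha ?hb.
    move: t1 t2; rewrite ltr_pdivrMr// ler_pdivlMr// [(tan th * x)%R]mulrC => -> ->//.
  rewrite lebesgue_measure_itv/= lte_fin.
  case: ifPn => [ab|]; last first.
    rewrite -leNgt => ba; rewrite set_itv_ge ?integral_set0//.
    by rewrite bnd_simp -leNgt le_atan// ler_pM2r// invr_gt0.
  have ab' : (atan (a / x) <= atan (b / x))%R by rewrite le_atan// ler_pM2r ?invr_gt0// ltW.
  rewrite integral_itv_obnd_cbnd; last by apply: measurable_funTS; measr.
  have cn th : (atan (a / x) <= th <= atan (b / x))%R -> cos th != 0%R.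
    move=> /andP[h1 h2]; rewrite gt_eqF// cos_gt0_pihalf//.
    by rewrite (lt_le_trans (atan_gtNpi2 _) h1) (le_lt_trans h2 (atan_ltpi2 _)).
  have dt th : (atan (a / x) <= th <= atan (b / x))%R -> is_derive th 1%R (fun th => x * tan th)%R (x / cos th ^+ 2)%R.
    move=> /cn c; have h := is_derive_tan c.
    by apply: is_derive_eq; rewrite /GRing.scale/= ?mulr0 ?addr0.
  have ct th : (atan (a / x) <= th <= atan (b / x))%R -> {for th, continuous (fun th => x / cos th ^+ 2)%R}.
    by move=> /cn c; have c2 := expf_neq0 2 c; cts.
  rewrite (ftc2 ab' dt ct) !atanK -EFinD; congr (_%:E).
  by rewrite ![(x * _)%R]mulrC !divfK.
by move=> ->; rewrite /nu/= /pushforward/= /density /w -integral_mkcondr.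
Qed.

Lemma integral_tan (x : R) (f : R -> R) : (0 < x)%R ->
  measurable_fun setT f -> (forall y, (0 <= f y)%R) ->
  \int[mu]_y (f y)%:E = \int[mu]_(th in I) (x / cos th ^+ 2 * f (x * tan th))%:E.
Proof.
move=> x0 mf f0.
have mt := measurable_tan.
have c0 th : (0 <= x / cos th ^+ 2)%R by rewrite divr_ge0 ?sqr_ge0// ltW.
have -> : \int[mu]_y (f y)%:E = \int[mu]_y \int[mu]_(l in `]0%R, +oo[) (if (l < f y)%R then 1%R else 0%R)%:E.
  by apply: eq_integral => y _; rewrite layer// mul1r.
have m1 : measurable_fun [set: R * R] (fun z => if (z.2 < f z.1)%R then 1%R else 0%R : R).
  by measr.
have m1_ge0 y l : (0 <= if (l < f y)%R then 1 else 0 :> R)%R by case: ifP.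
rewrite (dtonelli measurableT (measurable_itv _) m1 m1_ge0).
have -> : \int[mu]_(th in I) (x / cos th ^+ 2 * f (x * tan th))%:E =
   \int[mu]_(th in I) \int[mu]_(l in `]0%R, +oo[) (if (l < f (x * tan th))%R then (x / cos th ^+ 2)%R else 0%R)%:E.
  by apply: eq_integral => th _; rewrite layer.
have m2 : measurable_fun [set: R * R] (fun z => if (z.2 < f (x * tan z.1))%R then (x / cos z.1 ^+ 2)%R else 0%R) by measr.
have m2_ge0 th l : (0 <= if (l < f (x * tan th)) then x / cos th ^+ 2 else 0 :> R)%R by case: ifP.
rewrite (dtonelli (measurable_itv _) (measurable_itv _) m2 m2_ge0).
apply: eq_integral => l _.
have mA : measurable [set y | (l < f y)%R].
  rewrite -[X in measurable X]setTI.
  have -> : [set y | (l < f y)%R] = f @^-1` `]l, +oo[ by apply/seteqP; split => y /=; rewrite in_itv/= andbT.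
  exact: mf.
transitivity (mu [set y | (l < f y)%R]).
  rewrite -[X in _ = mu X]setIT -integral_indic//.
  apply: eq_integral => y _; rewrite indicE; congr ((_)%:E).
  by case: ifPn => h; [rewrite mem_set|rewrite memNset//; exact/negP].
rewrite (tan_pushforward x0 mA) setIC integral_mkcondr; apply: eq_integral => th _.
rewrite patchE; case: ifPn => h; first by move: h; rewrite inE/= => ->.
by move: h; rewrite notin_setE/= => /negP/negbTE ->.
Qed.

(** Two one-dimensional substitutions replace the planar one: [y = x tan th] for fixed [x > 0], and
    after Tonelli [x = r cos th] for fixed [th]. The Jacobians [x / cos th ^+ 2] and [cos th]
    multiply to [r]. *)
Lemma polar_half (H : R -> R -> R) : measurable_fun [set: R * R] (fun z => H z.1 z.2) ->
  (forall x y, (0 <= H x y)%R) ->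
  \int[mu]_(x in `]0%R, +oo[) \int[mu]_y (H x y)%:E =
  \int[mu]_(th in I) \int[mu]_(r in `]0%R, +oo[) (r * H (r * cos th) (r * sin th))%:E.
Proof.
move=> mH H0.
have mHx x : measurable_fun setT (H x).
  exact: (measurable_section1 x mH).
pose F x th := (if (0 < x)%R then x / cos th ^+ 2 * H x (x * tan th) else 0)%R.
have F0 x th : (0 <= F x th)%R.
  by rewrite /F; case: ifPn => // x0; rewrite mulr_ge0// divr_ge0 ?sqr_ge0// ltW.
have mF : measurable_fun [set: R * R] (fun z => F z.1 z.2).
  have mt := measurable_tan.
  by rewrite /F; measr.
have -> : \int[mu]_(x in `]0%R, +oo[) \int[mu]_y (H x y)%:E = \int[mu]_(x in `]0%R, +oo[) \int[mu]_(th in I) (F x th)%:E.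
  apply: eq_integral => x; rewrite inE/= in_itv/= andbT => x0.
  by rewrite (integral_tan x0)// /F x0.
rewrite (dtonelli (measurable_itv _) (measurable_itv _) mF F0); apply: eq_integral => th; rewrite inE => /cos_gt0I c0.
have mFt : measurable_fun setT (fun x => (F x th)%:E).
  apply/measurable_EFinP; exact: (measurable_section2 th mF).
have F0' x : 0 <= (F x th)%:E by rewrite lee_fin.
rewrite -(integral_scale c0 mFt F0') -ge0_integralZr//; last 2 first.
- by apply: measurable_funTS; apply: (measurableT_comp mFt); measr.
- by rewrite lee_fin ltW.
apply: eq_integral => r; rewrite inE/= in_itv/= andbT => r0.
rewrite /F mulr_gt0// -EFinM; congr (_%:E).
have -> : (cos th * r * tan th = r * sin th)%R by rewrite /tan; field; rewrite gt_eqF.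
by rewrite [(cos th * r)%R]mulrC; field; rewrite gt_eqF.
Qed.

(** The left half plane is the image of the right one under reflection in the origin, which adds
    [pi] to the angle. The two half turns form a period starting at [- pi / 2], which is then moved
    to [[0, 2 pi]]. *)
Lemma polar (H : R -> R -> R) : measurable_fun [set: R * R] (fun z => H z.1 z.2) ->
  (forall x y, (0 <= H x y)%R) ->
  \int[mu]_x \int[mu]_y (H x y)%:E =
  \int[mu]_(th in `[0%R, (2 * pi)%R]) \int[mu]_(r in `]0%R, +oo[) (r * H (r * cos th) (r * sin th))%:E.
Proof.
move=> mH H0.
pose G th := \int[mu]_(r in `]0%R, +oo[) (r * H (r * cos th) (r * sin th))%:E.
have G0 th : 0 <= G th.
  by apply: integral_ge0 => r; rewrite /= in_itv/= andbT => r0; rewrite lee_fin mulr_ge0// ltW.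
have mG : measurable_fun setT G.
  (* Taking [Num.max 0 r] instead of [r] makes the integrand nonnegative on the whole plane without
     changing it for [r > 0]. *)
  have n : measurable_fun [set: R * R] (fun z => Num.max 0 z.2 * H (z.2 * cos z.1) (z.2 * sin z.1))%R.
    by measr.
  apply: (eq_measurable_fun (fun th => \int[mu]_(r in `]0%R, +oo[) (Num.max 0 r * H (r * cos th) (r * sin th))%:E)).
    move=> th _; apply: eq_integral => r; rewrite inE/= in_itv/= andbT => r0.
    by rewrite max_r// ltW.
  apply: (@measurable_dsection R `]0%R, +oo[ (fun th r => Num.max 0 r * H (r * cos th) (r * sin th))%R) => //.
  by move=> th r; rewrite mulr_ge0// le_max lexx.
have Gp th : G (th + 2 * pi)%R = G th.
  by apply: eq_integral => r _; rewrite [(2 * pi)%R]mulr_natl cosD2pi sinD2pi.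
pose f x := \int[mu]_y (H x y)%:E.
have f0 x : 0 <= f x by apply: integral_ge0 => y _; rewrite lee_fin.
have mf : measurable_fun setT f by exact: measurable_dsection.
have right : \int[mu]_(x in `]0%R, +oo[) f x = \int[mu]_(th in I) G th by exact: polar_half.
have left : \int[mu]_(x in `]0%R, +oo[) f (- x)%R = \int[mu]_(th in I) G (th + pi)%R.
  have mH' : measurable_fun [set: R * R] (fun z => H (- z.1) (- z.2))%R by measr.
  have -> : \int[mu]_(x in `]0%R, +oo[) f (- x)%R = \int[mu]_(x in `]0%R, +oo[) \int[mu]_y (H (- x) (- y))%:E.
    apply: eq_integral => x _; rewrite /f.
    have mHx : measurable_fun setT (fun y => (H (- x) y)%:E).
      apply/measurable_EFinP; exact: (measurable_section1 (- x)%R mH).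
    by rewrite -(@integral_opp R setT (fun y => (H (- x) y)%:E))// ?preimage_setT// => y; rewrite lee_fin.
  rewrite (polar_half mH' (fun x y => H0 _ _)).
  by apply: eq_integral => th _; apply: eq_integral => r _; rewrite cosDpi sinDpi !mulrN.
have -> : \int[mu]_x f x = \int[mu]_(x in `]0%R, +oo[) f (- x)%R + \int[mu]_(x in `]0%R, +oo[) f x.
  have -> : [set: R] = `]-oo, 0%R] `|` `]0%R, +oo[.
    by apply/seteqP; split => x //= _; rewrite !in_itv/= andbT; case: (leP x 0%R) => _; [left|right].
  rewrite ge0_integral_setU; last 5 first.
  - exact: measurable_itv.
  - exact: measurable_itv.
  - exact: measurable_funTS.
  - by move=> x _; exact: f0.
  - by rewrite disj_set2E; apply/eqP/seteqP; split => x //= []; rewrite !in_itv/= andbT leNgt => /negP.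
  congr (_ + _).
  have mfN : measurable_fun setT (fun x : R => f (- x)%R) by apply: (measurableT_comp mf); exact: oppr_measurable.
  rewrite integral_itv_obnd_cbnd; last exact: measurable_funTS.
  have := @integral_opp R `[0%R, +oo[%classic (fun x => f (- x)%R) (measurable_itv _) mfN (fun x => f0 _).
  move=> <-; have -> : -%R @^-1` `[0%R, +oo[%classic = `]-oo, 0%R]%classic :> set R.
    by apply/seteqP; split => x /=; rewrite !in_itv/= andbT oppr_ge0.
  by apply: eq_integral => x _; rewrite opprK.
rewrite right left addeC -(integral_periodic (- (pi / 2)) twopi_gt0 mG G0 Gp).
have p0 := @pi_gt0 R.
rewrite (@integral_itv_split R _ (pi / 2) _ G); [|lra|lra|exact: mG|exact: G0].
congr (_ + _).
  rewrite integral_itv_obnd_cbnd; last by apply: measurable_funTS.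
  by rewrite integral_itv_bndo_bndc//; exact: measurable_funTS.
have mGp : measurable_fun setT (fun th : R => G (th + pi)%R).
  have n : measurable_fun setT (fun th : R => th + pi)%R by measr.
  exact: (measurableT_comp mG n).
rewrite integral_itv_obnd_cbnd; last exact: measurable_funTS.
rewrite integral_itv_bndo_bndc; last exact: measurable_funTS.
rewrite (integral_itv_shift pi _ _ true false mG G0).
have -> : (- (pi / 2) + pi = pi / 2 :> R)%R by field.
by have -> : (pi / 2 + pi = - (pi / 2) + 2 * pi :> R)%R by field.
Qed.

End polar.

(** * Reduction to real-valued continuous functions *)

Section bounded_functionals.
Context {R : realType}.
Notation mu := (@lebesgue_measure R).
Implicit Types (Phi : set R[i] -> \bar R) (Psi : R -> R -> \bar R).

Definition bounded_by (e : R) Psi := exists2 C : R, 0 <= C & forall a L, 0 < L -> L <= 2 * pi ->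
  (Psi a L <= (C * L `^ e)%:E)%E.

Lemma bounded_byD (e : R) Psi1 Psi2 : (forall a L, 0 < L -> L <= 2 * pi -> (0 <= Psi1 a L)%E) ->
  (forall a L, 0 < L -> L <= 2 * pi -> (0 <= Psi2 a L)%E) ->
  bounded_by e (fun a L => Psi1 a L + Psi2 a L)%E <-> bounded_by e Psi1 /\ bounded_by e Psi2.
Proof.
move=> p1 p2; split.
  move=> [C C0 HC]; split; exists C => // a L L0 L2; apply: le_trans (HC a L L0 L2).
    by apply: leeDl; exact: p2.
  by apply: leeDr; exact: p1.
move=> [[C C0 HC] [D D0 HD]]; exists (C + D); first exact: addr_ge0.
by move=> a L L0 L2; rewrite mulrDl EFinD; apply: leeD; [exact: HC|exact: HD].
Qed.

Lemma sup_arcs_bounded (e k : R) Phi Psi : 0 < k ->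
  (forall a b x y, a < b -> b <= a + 2 * pi ->
    Phi (arc a b x y) = ((k * ((b - a) / (2 * pi)) `^ (- e))%:E * Psi a (b - a)%R)%E) ->
  (sup_arcs Phi < +oo)%E <-> bounded_by e Psi.
Proof.
move=> k0 H.
have s0 L : 0 < L -> 0 < (L / (2 * pi)) `^ (- e) by move=> L0; rewrite powR_gt0// rho_gt0.
have t0 : 0 < (2 * pi : R) `^ e by rewrite powR_gt0// twopi_gt0.
have sE L : 0 < L -> (L / (2 * pi)) `^ (- e) = (2 * pi) `^ e / L `^ e.
  have g (q : R) : 0 < q -> q^-1 `^ (- e) = q `^ e.
    by move=> q0; rewrite -powR_inv1 ?(ltW q0)// -powRrM mulN1r opprK.
  move=> L0; rewrite [(L / _) `^ _]powRM ?(ltW L0)// ?invr_ge0 ?(ltW twopi_gt0)//.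
  by rewrite g ?twopi_gt0// mulrC powRN.
rewrite (sup_arcsP (phi := fun a L => ((k * (L / (2 * pi)) `^ (- e))%:E * Psi a L)%E) H).
split=> -[C C0 HC].
  exists (C / (k * (2 * pi) `^ e)); first by rewrite divr_ge0// mulr_ge0// ltW.
  move=> a L L0 L2; have := HC a L L0 L2.
  have ks : 0 < k * (L / (2 * pi)) `^ (- e) by rewrite mulr_gt0// s0.
  rewrite -[in X in X -> _](invrK (k * _)) -lee_pdivlMl ?invr_gt0// invrK -EFinM => h.
  apply: (le_trans h); rewrite lee_fin sE//; apply: eq_leW; field.
  by rewrite !gt_eqF// powR_gt0.
exists (C * (k * (2 * pi) `^ e)); first by rewrite mulr_ge0// mulr_ge0// ltW.
move=> a L L0 L2.
have ks : 0 < k * (L / (2 * pi)) `^ (- e) by rewrite mulr_gt0// s0.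
rewrite -lee_pdivlMl// -EFinM; apply: le_trans (HC a L L0 L2) _.
rewrite lee_fin sE//; apply: eq_leW; field.
by rewrite !gt_eqF// powR_gt0.
Qed.

Lemma ae_dintegral (A B : set R) (f g : R -> R -> R) : measurable A -> measurable B ->
  measurable_fun [set: R * R] (fun z => f z.1 z.2) -> measurable_fun [set: R * R] (fun z => g z.1 z.2) ->
  (forall x y, 0 <= f x y) -> (forall x y, 0 <= g x y) ->
  {ae mu, forall x, {ae mu, forall y, f x y = g x y}} ->
  (\int[mu]_(x in A) \int[mu]_(y in B) (f x y)%:E = \int[mu]_(x in A) \int[mu]_(y in B) (g x y)%:E)%E.
Proof.
move=> mA mB mf mg f0 g0 fg.
have sec (h : R -> R -> R) x : measurable_fun [set: R * R] (fun z => h z.1 z.2) -> measurable_fun setT (fun y => (h x y)%:E).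
  by move=> mh; apply/measurable_EFinP; exact: (measurable_section1 x mh).
apply: ge0_ae_eq_integral => //.
- by apply: measurable_funTS; exact: measurable_dsection.
- by apply: measurable_funTS; exact: measurable_dsection.
- by move=> x _; apply: integral_ge0 => y _; rewrite lee_fin.
- by move=> x _; apply: integral_ge0 => y _; rewrite lee_fin.
have [N [mN N0 PN]] := fg; exists N; split => // x /= nh; apply: PN => /= h; apply: nh => _.
apply: ge0_ae_eq_integral => //.
- by apply: measurable_funTS; exact: sec.
- by apply: measurable_funTS; exact: sec.
- by move=> y _; rewrite lee_fin.
- by move=> y _; rewrite lee_fin.
have [N' [mN' N'0 PN']] := h; exists N'; split => // y /= ny; apply: PN' => /= e; apply: ny => _.
by rewrite e.
Qed.

Lemma ae_shift (P : R -> Prop) (t : R) : {ae mu, forall s, P s} -> {ae mu, forall s, P (s + t)}.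
Proof.
move=> [N [mN N0 PN]]; exists ((fun s => s + t) @^-1` N); split.
- rewrite -[X in measurable X]setTI; have n : measurable_fun setT (fun s : R => s + t) by measr.
  exact: n.
- by rewrite -N0; exact: (lebesgue_measure_shift t mN).
- by move=> s /= h; apply: PN.
Qed.

Lemma cabs_sqE (z : R[i]) : cabs z ^+ 2 = complex.Re z ^+ 2 + complex.Im z ^+ 2.
Proof. by case: z => x y; rewrite /cabs/= sqr_sqrtr// addr_ge0// sqr_ge0. Qed.

Lemma cabsB_sqE (z w : R[i]) :
  cabs (z - w) ^+ 2 = (complex.Re z - complex.Re w) ^+ 2 + (complex.Im z - complex.Im w) ^+ 2.
Proof. by rewrite cabs_sqE; case: z; case: w. Qed.

End bounded_functionals.

Section circle_functions.
Context {R : realType}.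
Notation mu := (@lebesgue_measure R).
Variables (p beta : R) (f : R[i] -> R[i]).
Hypothesis b1 : beta < 1.

Let al : R := 2 - 2 * beta.
Let sg : R := p - 2 + 2 * beta.
Let u s := complex.Re (f (cis s)).
Let v s := complex.Im (f (cis s)).

Let al0 : 0 < al. Proof. by have := b1; rewrite /al; lra. Qed.

Let u2pi s : u (s + 2 * pi) = u s. Proof. by rewrite /u cisD2pi. Qed.
Let v2pi s : v (s + 2 * pi) = v s. Proof. by rewrite /v cisD2pi. Qed.

(** The exponent [4 beta - 5] is [-(1 + 2 al)], the one required by [campanato]. That result is
    applied to the real and imaginary parts separately, their oscillation being bounded by that of
    [f]. *)
Lemma BMO_holder : BMO beta f -> exists w1 w2 : R -> R,
  [/\ holder_periodic al w1, holder_periodic al w2,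
      {ae mu, forall s, u s = w1 s} & {ae mu, forall s, v s = w2 s}].
Proof.
move=> [[mu_ mv _] fin].
pose Phi I := ((arc_length I `^ (4 * beta - 5))%:E *
  \int[mu]_(s in params I) ((cabs (f (cis s) - arc_mean f I) ^+ 2)%:E))%E.
have [C C0 HC] : exists2 C : R, 0 <= C & forall a L, 0 < L -> L <= 2 * pi -> (Phi (arc a (a + L) true true) <= C%:E)%E.
  have [C C0 HC] := sup_arcs_bound fin; exists C => // a L L0 L2.
  by apply: HC; rewrite ?ltrDl ?lerD2l.
pose m a L := arc_mean f (arc a (a + L) true true).
have m2pi a L : m (a + 2 * pi) L = m a L.
  rewrite /m; congr arc_mean; rewrite /arc; apply/seteqP; split => z [s /=]; rewrite in_itv/= => /andP[s1 s2] <-.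
    exists (s - 2 * pi); first by rewrite /= in_itv/=; apply/andP; split; lra.
    by rewrite -cisD2pi subrK.
  exists (s + 2 * pi); first by rewrite /= in_itv/=; apply/andP; split; lra.
  by rewrite cisD2pi.
have bound (g : R -> R) (k : R -> R -> R) : measurable_fun setT g -> (forall s, g (s + 2 * pi) = g s) ->
   (forall a L s, (g s - k a L) ^+ 2 <= cabs (f (cis s) - m a L) ^+ 2) ->
   forall a L : R, 0 < L -> L <= 2 * pi ->
  (\int[mu]_(s in `[a, (a + L)%R]) ((g s - k a L) ^+ 2)%:E <= (C * L `^ (1 + 2 * al))%:E)%E.
  move=> mg g2 gk a L L0 L2.
  have aL : a < a + L by rewrite ltrDl.
  have aL2 : a + L <= a + 2 * pi by rewrite lerD2l.
  rewrite -(@integral_params R a (a + L) true true (fun s => ((g s - k a L) ^+ 2)%:E) aL aL2); first last.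
  - by move=> s; rewrite g2.
  - by move=> s; rewrite lee_fin sqr_ge0.
  - by measr.
  apply: (@le_trans _ _ (\int[mu]_(s in params (arc a (a + L) true true)) ((cabs (f (cis s) - m a L) ^+ 2)%:E))%E).
    by apply: ge0_le_integral_nomeas => s _; rewrite lee_fin ?sqr_ge0.
  have := HC a L L0 L2; rewrite /Phi -/(m a L) arc_lengthE// [a + L]addrC addrK [L + a]addrC.
  have r0 := rho_gt0 L0.
  rewrite -[X in (X%:E * _)%E]invrK -lee_pdivlMl ?invr_gt0 ?powR_gt0// -EFinM invrK.
  move=> h; apply: (le_trans h); rewrite lee_fin mulrC; apply: ler_wpM2l => //.
  rewrite -powRN (_ : - (4 * beta - 5) = 1 + 2 * al); last by rewrite /al; ring.
  apply: ge0_ler_powR; rewrite ?nnegrE ?(ltW L0) ?(ltW r0)//.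
    by apply: addr_ge0 => //; apply: mulr_ge0 => //; exact: ltW.
  by have := rho_le L0; lra.
have bu := bound u (fun a L => complex.Re (m a L)) mu_ u2pi.
have bv := bound v (fun a L => complex.Im (m a L)) mv v2pi.
have {}bu := bu (fun a L s => _); have {}bv := bv (fun a L s => _).
have mRe a L : complex.Re (m (a + 2 * pi) L) = complex.Re (m a L) by rewrite m2pi.
have mIm a L : complex.Im (m (a + 2 * pi) L) = complex.Im (m a L) by rewrite m2pi.
have [|w1 h1 e1] := campanato al0 C0 mu_ mRe.
  by apply: bu => a L s; rewrite cabsB_sqE lerDl sqr_ge0.
have [|w2 h2 e2] := campanato al0 C0 mv mIm.
  by apply: bv => a L s; rewrite cabsB_sqE lerDr sqr_ge0.
by exists w1, w2.
Qed.

Section representatives.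
Variables w1 w2 : R -> R.
Hypothesis h1 : holder_periodic al w1.
Hypothesis h2 : holder_periodic al w2.
Hypothesis e1 : {ae mu, forall s, u s = w1 s}.
Hypothesis e2 : {ae mu, forall s, v s = w2 s}.
Hypothesis mu_ : measurable_fun setT u.
Hypothesis mv : measurable_fun setT v.

Let e12 : {ae mu, forall s, u s = w1 s /\ v s = w2 s}.
Proof.
have [N1 [m1 z1 P1]] := e1; have [N2 [m2 z2 P2]] := e2.
have [N [mN N0 PN]] := negligibleU (ex_intro _ N1 (And3 m1 z1 P1)) (ex_intro _ N2 (And3 m2 z2 P2)).
exists N; split => // s /= h; apply: PN.
have [eu|eu] := pselect (u s = w1 s); last by left.
by right => ev; apply: h.
Qed.

(** Periodicity moves both integrations from [params] to [[a, b]]. There [f] is replaced by its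
    representatives: for almost every [s], the integrand is unchanged for almost every [t]. *)
Lemma Qspace_chord : L2_circle f ->
  Qspace p beta f <-> chord_cond sg al w1 /\ chord_cond sg al w2.
Proof.
move=> L2f.
have mw1 := holder_measurable al0 h1; have mw2 := holder_measurable al0 h2.
pose K (u v : R -> R) s t := (u s - u t) ^+ 2 * chord (s - t) `^ (sg - 2) + (v s - v t) ^+ 2 * chord (s - t) `^ (sg - 2).
have K0 a b s t : 0 <= K a b s t by apply: addr_ge0; apply: mulr_ge0; rewrite ?sqr_ge0 ?powR_ge0.
have mK a b : measurable_fun setT a -> measurable_fun setT b -> measurable_fun [set: R * R] (fun z => K a b z.1 z.2).
  by move=> ma mb; apply: measurable_funD; exact: measurable_chord_kernel.
have k0 (a : R -> R) s t : 0 <= (a s - a t) ^+ 2 * chord (s - t) `^ (sg - 2).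
  by rewrite mulr_ge0 ?sqr_ge0 ?powR_ge0.
pose P (w : R -> R) a L := (\int[mu]_(s in `[a, (a + L)%R]) \int[mu]_(t in `[a, (a + L)%R])
   ((w s - w t) ^+ 2 * chord (s - t) `^ (sg - 2))%:E)%E.
have P0 w a L : 0 < L -> L <= 2 * pi -> (0 <= P w a L)%E.
  by move=> _ _; apply: integral_ge0 => s _; apply: integral_ge0 => t _; rewrite lee_fin.
apply: (iff_trans _ (@bounded_byD R (sg + 2 * al) (P w1) (P w2) (P0 w1) (P0 w2))).
rewrite /Qspace; set Phi := (fun I => _)%E.
rewrite -(@sup_arcs_bounded R (sg + 2 * al) 1 Phi _ ltr01); first by split; [case|].
move=> a b x y ab ba; rewrite /Phi arc_lengthE// mul1r; congr (_ * _)%E.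
  by congr ((_ `^ _)%:E); rewrite /sg /al; ring.
rewrite /P (_ : a + (b - a) = b); last by rewrite addrC subrK.
rewrite -(dintegralD (measurable_itv _) (measurable_itv _) (measurable_chord_kernel _ mw1) (k0 w1)
  (measurable_chord_kernel _ mw2) (k0 w2)).
have eqK s t : cabs (f (cis s) - f (cis t)) ^+ 2 / cabs (cis s - cis t) `^ (4 - p - 2 * beta) = K u v s t.
  by rewrite cabsB_sqE cabs_cisB -powRN /K -mulrDl; congr (_ * _ `^ _); rewrite /sg; ring.
transitivity (\int[mu]_(s in params (arc a b x y)) \int[mu]_(t in `[a, b]) (K u v s t)%:E)%E.
  apply: eq_integral => s _; under eq_integral do rewrite eqK.
  apply: (integral_params _ _ ab ba).
  - apply/measurable_EFinP; exact: (measurable_section1 s (mK _ _ mu_ mv)).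
  - by move=> t; rewrite lee_fin.
  - move=> t; rewrite /K u2pi v2pi -[chord (s - (t + _))]chordD2pi.
    by rewrite (_ : s - (t + 2 * pi) + 2 * pi = s - t)//; ring.
pose g s := (\int[mu]_(t in `[a, b]) (K u v s t)%:E)%E.
have mg : measurable_fun setT g by apply: measurable_dsection => //; exact: mK.
have g0 s : (0 <= g s)%E by apply: integral_ge0 => t _; rewrite lee_fin.
have gp s : g (s + 2 * pi) = g s.
  apply: eq_integral => t _; rewrite /K u2pi v2pi.
  by rewrite (_ : s + 2 * pi - t = s - t + 2 * pi) ?chordD2pi//; ring.
rewrite (@integral_params R a b x y g ab ba mg g0 gp).
apply: (@ae_dintegral R `[a, b]%classic `[a, b]%classic (K u v) (K w1 w2)) => //; try exact: mK.
have [N [mN N0 PN]] := e12; exists N; split => // s /= nh; apply: PN => /= -[es1 es2]; apply: nh.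
have [N' [mN' N'0 PN']] := e12; exists N'; split => // t /= nh; apply: PN' => /= -[et1 et2]; apply: nh.
by rewrite /K es1 es2 et1 et2.
Qed.

(** For each fixed [t] both [s] and [s + t] avoid the exceptional null set for almost every [s],
    since a translate of a null set is null. *)
Lemma translation_translation :
  translation_condition p beta f <-> translation_cond sg al w1 /\ translation_cond sg al w2.
Proof.
have mw1 := holder_measurable al0 h1; have mw2 := holder_measurable al0 h2.
pose K (u v : R -> R) s t := (u (s + t) - u s) ^+ 2 * t `^ (sg - 2) + (v (s + t) - v s) ^+ 2 * t `^ (sg - 2).
have K0 a b s t : 0 <= K a b s t by apply: addr_ge0; apply: mulr_ge0; rewrite ?sqr_ge0 ?powR_ge0.
have mk (a : R -> R) : measurable_fun setT a -> measurable_fun [set: R * R] (fun z => (a (z.1 + z.2) - a z.1) ^+ 2 * z.2 `^ (sg - 2)).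
  by move=> ma; measr.
have mK a b : measurable_fun setT a -> measurable_fun setT b -> measurable_fun [set: R * R] (fun z => K a b z.1 z.2).
  by move=> ma mb; apply: measurable_funD; exact: mk.
have k0 (a : R -> R) s t : 0 <= (a (s + t) - a s) ^+ 2 * t `^ (sg - 2).
  by rewrite mulr_ge0 ?sqr_ge0 ?powR_ge0.
pose P (w : R -> R) a L := (\int[mu]_(s in `[a, (a + L)%R]) \int[mu]_(t in `]0%R, (L / (2 * pi))%R])
   ((w (s + t) - w s) ^+ 2 * t `^ (sg - 2))%:E)%E.
have P0 w a L : 0 < L -> L <= 2 * pi -> (0 <= P w a L)%E.
  by move=> _ _; apply: integral_ge0 => s _; apply: integral_ge0 => t _; rewrite lee_fin.
apply: (iff_trans _ (@bounded_byD R (sg + 2 * al) (P w1) (P w2) (P0 w1) (P0 w2))).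
rewrite /translation_condition; apply: (sup_arcs_bounded ltr01).
move=> a b x y ab ba; rewrite arc_lengthE// mul1r; congr (_ * _)%E.
  by congr ((_ `^ _)%:E); rewrite /sg /al; ring.
rewrite /P (_ : a + (b - a) = b); last by rewrite addrC subrK.
rewrite -(dintegralD (measurable_itv _) (measurable_itv _) (mk _ mw1) (k0 w1) (mk _ mw2) (k0 w2)).
set r := (b - a) / (2 * pi).
have eqK s t : cabs (f (cis (s + t)) - f (cis s)) ^+ 2 / t `^ (4 - p - 2 * beta) = K u v s t.
  by rewrite cabsB_sqE -powRN /K -mulrDl; congr (_ * _ `^ _); rewrite /sg; ring.
have mswap a' b' : measurable_fun setT a' -> measurable_fun setT b' -> measurable_fun [set: R * R] (fun z => K a' b' z.2 z.1).
  by move=> ma mb; apply: (measurableT_comp (mK _ _ ma mb) (g := fun z : R * R => (z.2, z.1))); measr.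
transitivity (\int[mu]_(t in `]0%R, r]) \int[mu]_(s in `[a, b]) (K u v s t)%:E)%E.
  apply: eq_integral => t _.
  have mKt : measurable_fun setT (fun s => (K u v s t)%:E).
    apply/measurable_EFinP; exact: (measurable_section2 t (mK _ _ mu_ mv)).
  rewrite -(@integral_params R a b x y)//; last 2 first.
  - by move=> s; rewrite lee_fin.
  - by move=> s; rewrite /K addrAC !u2pi !v2pi.
  rewrite -ge0_integralZr//; last 4 first.
  - exact: measurable_params.
  - apply: measurable_funTS.
    have n : measurable_fun setT (fun s : R => ((u (s + t) - u s) ^+ 2 + (v (s + t) - v s) ^+ 2)%:E) by measr.
    by under eq_fun do rewrite cabsB_sqE.
  - by move=> s _; rewrite lee_fin sqr_ge0.
  - by rewrite lee_fin invr_ge0 powR_ge0.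
  by apply: eq_integral => s _; rewrite -EFinM eqK.
rewrite [RHS](dtonelli (measurable_itv _) (measurable_itv _) (mK w1 w2 mw1 mw2) (K0 w1 w2)).
apply: (@ae_dintegral R `]0%R, r]%classic `[a, b]%classic (fun t s => K u v s t) (fun t s => K w1 w2 s t)) => //; try exact: mswap.
apply: aeW => t.
have [N1 [m1 z1 P1]] := e12; have [N2 [m2 z2 P2]] := ae_shift t e12.
have [N [mN N0 PN]] := negligibleU (ex_intro _ N1 (And3 m1 z1 P1)) (ex_intro _ N2 (And3 m2 z2 P2)).
exists N; split => // s /= nh; apply: PN.
have [[es1 es2]|hs] := pselect (u s = w1 s /\ v s = w2 s); last by left.
right => -[et1 et2]; apply: nh.
by rewrite /K es1 es2 et1 et2.
Qed.

End representatives.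

End circle_functions.

(** * Carleson boxes *)

Section arc_cones.
Context {R : realType}.
Notation mu := (@lebesgue_measure R).
Implicit Types (a b s t : R).

Lemma cabs_scale_cis (r s : R) : 0 <= r -> cabs ((r * cos s) +i* (r * sin s))%C = r.
Proof. by move=> r0; rewrite /cabs/= polar_sq sqrtr_sqr ger0_norm. Qed.

Lemma scale_cis_div (r s : R) : 0 < r ->
  ((r * cos s) +i* (r * sin s))%C / (cabs ((r * cos s) +i* (r * sin s))%C)%:C%C = cis s.
Proof.
move=> r0; rewrite cabs_scale_cis ?(ltW r0)//.
have -> : ((r * cos s) +i* (r * sin s))%C = cis s * r%:C%C.
  by rewrite /cis /GRing.mul/= !mulr0 subr0 add0r ![_ * r]mulrC.
by rewrite mulfK// gt_eqF// ltcR.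
Qed.

(* The half-angle formula [tan (arg / 2) = y / (x + r)]. *)
Definition angle (w : R * R) : R :=
  let r := Num.sqrt (w.1 ^+ 2 + w.2 ^+ 2) in
  if 0 < w.1 + r then 2 * atan (w.2 / (w.1 + r)) else pi.

Lemma measurable_angle : measurable_fun setT angle.
Proof.
have m : measurable_fun setT (@atan R).
  by apply: continuous_measurable_fun; exact: continuous_atan.
by rewrite /angle; measr.
Qed.

Lemma cis_angle (w : R * R) : 0 < w.1 ^+ 2 + w.2 ^+ 2 ->
  pt w / (cabs (pt w))%:C%C = cis (angle w).
Proof.
case: w => x y; rewrite /pt [(x, y).1]/= [(x, y).2]/= => xy.
set r := Num.sqrt (x ^+ 2 + y ^+ 2).
have r0 : 0 < r by rewrite sqrtr_gt0.
suff -> : (x +i* y)%C = ((r * cos (angle (x, y))) +i* (r * sin (angle (x, y))))%C.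
  exact: scale_cis_div.
rewrite /angle/= -/r.
have rE : r ^+ 2 = x ^+ 2 + y ^+ 2 by rewrite sqr_sqrtr// ltW.
(* The sum [x + r] fails to be positive only on the negative real axis, where the angle is [pi]. *)
case: ltP => [xr|xr]; last first.
  have y0 : y = 0 by nra.
  by rewrite cospi sinpi mulr0 mulrN1 y0; congr (_ +i* _)%C; nra.
set q := y / (x + r); set a := atan q.
have xr0 : x + r != 0 by rewrite gt_eqF.
have ca : cos a != 0.
  by rewrite gt_eqF// cos_gt0_pihalf// atan_gtNpi2 atan_ltpi2.
have ta : tan a = q by rewrite atanK.
have c2 : cos a ^+ 2 = (x + r) / (2 * r).
  have e : (cos a ^+ 2)^-1 = 2 * r / (x + r).
    have yE : y ^+ 2 = (r - x) * (x + r) by lra.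
    by rewrite cos2_tan2// ta /q expr_div_n yE; field.
  by rewrite -[LHS]invrK e invf_div.
have s1 : sin a = q * cos a by rewrite -ta /tan divfK.
congr (_ +i* _)%C.
  rewrite (_ : cos (2 * a) = 2 * cos a ^+ 2 - 1); last first.
    by rewrite mulr_natl cos_mulr2n -mulr_natl.
  by rewrite c2; field; rewrite gt_eqF.
rewrite (_ : sin (2 * a) = 2 * (q * cos a ^+ 2)); last first.
  by rewrite mulr_natl sin_mulr2n s1 mulrCA -expr2 -mulr_natl.
by rewrite c2 /q; field; rewrite xr0 gt_eqF.
Qed.

(** Off the origin the cone over an arc is the preimage, under the measurable function [angle], of a
    measurable set of parameters. *)
Lemma measurable_arc_cone a b x y :
  measurable [set w : R * R | arc a b x y (pt w / (cabs (pt w))%:C%C)].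
Proof.
have -> : [set w : R * R | arc a b x y (pt w / (cabs (pt w))%:C%C)] =
    [set w | 0 < w.1 ^+ 2 + w.2 ^+ 2] `&` angle @^-1` (@cis R @^-1` arc a b x y).
  apply/seteqP; split => w /=; last by move=> [w0]; rewrite cis_angle.
  have [w0|w0] := ltP 0 (w.1 ^+ 2 + w.2 ^+ 2).
    by rewrite cis_angle.
  (* The origin is not in the cone: division by 0 yields 0, which is not on the circle. *)
  rewrite (ler0_sqrtr w0) (_ : pt w / 0%:C%C = 0); last first.
    by rewrite -[0%:C%C]/(0 : R[i]) invr0 mulr0.
  move=> -[s _] /(congr1 (@cabs R)).
  have := circle_cis s; rewrite /circle/= => ->.
  by rewrite /cabs/= expr0n addr0 sqrtr0 => /eqP; rewrite oner_eq0.
have m : measurable_fun [set: R * R] (fun w => w.1 ^+ 2 + w.2 ^+ 2) by measr.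
apply: measurableI.
  have := m measurableT `]0, +oo[%classic (measurable_itv _); rewrite setTI.
  by congr measurable; apply/seteqP; split => w /=; rewrite in_itv/= andbT.
have := measurable_angle measurableT (measurable_arc_preimage a b x y).
by rewrite setTI.
Qed.

End arc_cones.

Section poisson_extension.
Context {R : realType}.
Notation mu := (@lebesgue_measure R).
Variables (f : R[i] -> R[i]) (w1 w2 : R -> R).
Hypothesis c1 : continuous w1.
Hypothesis c2 : continuous w2.
Hypothesis mRe : measurable_fun setT (fun s : R => complex.Re (f (cis s))).
Hypothesis mIm : measurable_fun setT (fun s : R => complex.Im (f (cis s))).
Hypothesis e1 : {ae mu, forall s, complex.Re (f (cis s)) = w1 s}.
Hypothesis e2 : {ae mu, forall s, complex.Im (f (cis s)) = w2 s}.
Implicit Types x y c d t : R.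

Lemma divr_real_complex (x y c : R) : c != 0 -> ((x +i* y) / c%:C = (x / c) +i* (y / c))%C.
Proof.
move=> c0; have -> : (x +i* y = ((x / c) +i* (y / c)) * c%:C)%C.
  by rewrite /GRing.mul/= !mulr0 subr0 add0r !divfK.
by rewrite mulfK// eq_complex/= negb_and c0.
Qed.

Lemma params_circle : params (@circle R) = `[0, (2 * pi)[%classic.
Proof.
apply/seteqP; split => s /=; first by case=> h _; rewrite in_itv.
by rewrite in_itv/= => h; split => //; exact: circle_cis.
Qed.

Let poisson_part (g w : R -> R) (h : R -> R) x y : continuous w ->
  measurable_fun setT g -> {ae mu, forall s, g s = w s} -> (forall s, h s = g s * Pk x y s) ->
  \int[mu]_(s in params (@circle R)) h s = PI w x y.
Proof.
move=> cw mg gw hE; rewrite /PI /Rintegral; congr fine.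
have mP : measurable_fun setT (Pk x y) by rewrite /Pk /den; measr.
have mw : measurable_fun setT w by exact: continuous_measurable_fun.
have mgP : measurable_fun setT (fun s => (g s * Pk x y s)%:E) by measr.
have mwP : measurable_fun setT (fun s => (w s * Pk x y s)%:E) by measr.
rewrite params_circle.
transitivity (\int[mu]_(s in `[0%R, (2 * pi)%R[) (g s * Pk x y s)%:E)%E.
  by apply: eq_integral => s _; rewrite hE.
rewrite integral_itv_bndo_bndc; last exact: measurable_funTS.
apply: ae_eq_integral => //; [exact: measurable_funTS|exact: measurable_funTS|].
have [N [mN N0 PN]] := gw; exists N; split => // s /= nh; apply: PN => /= h'; apply: nh => _.
by rewrite h'.
Qed.

Lemma poissonE x y : poisson f (x +i* y)%C = ((PI w1 x y / (2 * pi)) +i* (PI w2 x y / (2 * pi)))%C.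
Proof.
have p0 : 2 * pi != 0 :> R by rewrite gt_eqF// twopi_gt0.
rewrite /poisson /arc_integral.
have k s : (1 - cabs (x +i* y)%C ^+ 2) / cabs (cis s - (x +i* y)%C) ^+ 2 = Pk x y s.
  by rewrite cabsB_sqE cabs_sqE /Pk /den/= opprD addrA.
rewrite (@poisson_part (fun s => complex.Re (f (cis s))) w1 _ x y c1 mRe e1); last first.
  by move=> s; rewrite k; case: (f (cis s)) => a b /=; rewrite mulr0 subr0.
rewrite (@poisson_part (fun s => complex.Im (f (cis s))) w2 _ x y c2 mIm e2); last first.
  by move=> s; rewrite k; case: (f (cis s)) => a b /=; rewrite mulr0 add0r.
exact: divr_real_complex.
Qed.

Let derive1_PI (w : R -> R) x y c d : continuous w -> c ^+ 2 + d ^+ 2 = 1 -> x ^+ 2 + y ^+ 2 < 1 ->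
  derive1 (fun t : R => PI w (x + t * c) (y + t * d) / (2 * pi)) 0 = (c * PIx w x y + d * PIy w x y) / (2 * pi).
Proof.
move=> cw cd xy.
pose n := Num.sqrt (x ^+ 2 + y ^+ 2).
have n0 : 0 <= n by exact: sqrtr_ge0.
have nE : n ^+ 2 = x ^+ 2 + y ^+ 2 by rewrite sqr_sqrtr// addr_ge0// sqr_ge0.
have n1 : n < 1 by rewrite -ltr_sqr ?nnegrE// nE expr1n.
have [cb db] : `|c| <= 1 /\ `|d| <= 1.
  by split; rewrite -ler_sqr ?nnegrE// real_normK ?num_real// expr1n -cd; [rewrite lerDl|rewrite lerDr]; exact: sqr_ge0.
have cs : `|x * c + y * d| <= n.
  rewrite -ler_sqr ?nnegrE// real_normK ?num_real// nE.
  rewrite -subr_ge0 (_ : _ - _ = (x * d - y * c) ^+ 2 + (x ^+ 2 + y ^+ 2) * (1 - (c ^+ 2 + d ^+ 2))); last by ring.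
  by rewrite cd subrr mulr0 addr0 sqr_ge0.
pose e : R := (1 - n) / 2.
have e0 : 0 < e by rewrite divr_gt0// subr_gt0.
have zab : - e < 0 < e by rewrite oppr_lt0 e0.
have h : is_derive (0 : R) 1 (fun t : R => PI w (x + t * c) (y + t * d))
   (c * PIx w (x + 0 * c) (y + 0 * d) + d * PIy w (x + 0 * c) (y + 0 * d)).
  apply: (@is_derive_PI_path R w (fun t => x + t * c) (fun t => y + t * d) (fun=> c) (fun=> d) (- e) e (n + e)) => //.
  - by move=> t _; apply: is_derive_eq; rewrite /GRing.scale/=; ring.
  - by move=> t _; apply: is_derive_eq; rewrite /GRing.scale/=; ring.
  - by rewrite addr_ge0// ltW.
  - by rewrite /e; lra.
  - move=> t /andP[t1 t2].
    have te : `|t| <= e by rewrite ler_norml; apply/andP; split; exact: ltW.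
    have -> : (x + t * c) ^+ 2 + (y + t * d) ^+ 2 = n ^+ 2 + 2 * (t * (x * c + y * d)) + t ^+ 2 * (c ^+ 2 + d ^+ 2).
      by rewrite nE; ring.
    rewrite cd mulr1 sqrrD -mulr_natl -(real_normK (num_real t)).
    have h1 : t * (x * c + y * d) <= n * e.
      apply: le_trans (ler_norm _) _; rewrite normrM mulrC; exact: ler_pM.
    have h2 : `|t| ^+ 2 <= e ^+ 2 by rewrite ler_sqr ?nnegrE// ltW.
    by lra.
rewrite !mul0r !addr0 in h.
have h' : is_derive (0 : R) 1 (fun t : R => PI w (x + t * c) (y + t * d) / (2 * pi)) ((c * PIx w x y + d * PIy w x y) / (2 * pi)).
  by apply: is_derive_eq; rewrite /GRing.scale/= ?mulr0 ?add0r ?addr0 mulrC.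
by rewrite derive1E; have [_ ->] := h'.
Qed.

Lemma cpartial_poisson x y c d : c ^+ 2 + d ^+ 2 = 1 -> x ^+ 2 + y ^+ 2 < 1 ->
  cpartial (c +i* d)%C (poisson f) (x +i* y)%C =
  (((c * PIx w1 x y + d * PIy w1 x y) / (2 * pi)) +i* ((c * PIx w2 x y + d * PIy w2 x y) / (2 * pi)))%C.
Proof.
move=> cd xy; rewrite /cpartial.
have e t : ((x +i* y) + t%:C * (c +i* d) = (x + t * c) +i* (y + t * d))%C.
  by rewrite /GRing.add/GRing.mul/= !mul0r subr0 addr0.
under [X in derive1 X]eq_fun do rewrite e poissonE/=.
under [X in (_ +i* derive1 X _)%C]eq_fun do rewrite e poissonE/=.
by rewrite !derive1_PI.
Qed.

(** The parallelogram law [|A - iB|^2 + |A + iB|^2 = 2 (|A|^2 + |B|^2)], for [A] and [B] the partial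
    derivatives in the directions 1 and [i]. *)
Lemma cabs_sq_wirtinger (A1 B1 A2 B2 : R) :
  cabs ((A1 +i* B1) - 'i * (A2 +i* B2))%C ^+ 2 + cabs ((A1 +i* B1) + 'i * (A2 +i* B2))%C ^+ 2
  = 2 * ((A1 ^+ 2 + A2 ^+ 2) + (B1 ^+ 2 + B2 ^+ 2)).
Proof.
have -> : ('i * (A2 +i* B2) = (- B2) +i* A2)%C.
  by rewrite /GRing.mul/= !mul0r !mul1r sub0r add0r.
have -> : ((A1 +i* B1) + ((- B2) +i* A2) = (A1 - B2) +i* (B1 + A2))%C by [].
have -> : ((A1 +i* B1) - ((- B2) +i* A2) = (A1 + B2) +i* (B1 - A2))%C.
  by apply/eqP; rewrite eq_complex/= opprK !eqxx.
by rewrite !cabs_sqE/=; ring.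
Qed.

(** In the constant, 2 comes from the parallelogram law and [(2 pi) ^+ 2] from the missing
    normalization of [PI]. *)
Lemma grad_sq_poisson x y : x ^+ 2 + y ^+ 2 < 1 ->
  grad_sq (poisson f) (x +i* y)%C =
  2 / (2 * pi) ^+ 2 * ((PIx w1 x y ^+ 2 + PIy w1 x y ^+ 2) + (PIx w2 x y ^+ 2 + PIy w2 x y ^+ 2)).
Proof.
move=> xy; have two (z : R[i]) : 2 * (z / 2) = z by rewrite mulrC divfK// pnatr_eq0.
rewrite /grad_sq /d_dz /d_dzbar !two.
have -> : cpartial 1 (poisson f) (x +i* y)%C = ((PIx w1 x y / (2 * pi)) +i* (PIx w2 x y / (2 * pi)))%C.
  by rewrite (@cpartial_poisson x y 1 0)// ?expr1n ?expr0n ?addr0// !mul1r !mul0r !addr0.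
have -> : cpartial 'i%C (poisson f) (x +i* y)%C = ((PIy w1 x y / (2 * pi)) +i* (PIy w2 x y / (2 * pi)))%C.
  by rewrite (@cpartial_poisson x y 0 1)// ?expr1n ?expr0n ?add0r// !mul1r !mul0r !add0r.
by rewrite cabs_sq_wirtinger !expr_div_n -!mulrDl mulrA [RHS]mulrAC.
Qed.

End poisson_extension.

(** * The Carleson condition in polar coordinates *)

Section carleson_conversion.
Context {R : realType}.
Notation mu := (@lebesgue_measure R).
Variables (sg al : R) (f : R[i] -> R[i]) (w1 w2 : R -> R).
Hypothesis c1 : continuous w1.
Hypothesis c2 : continuous w2.
Hypothesis mRe : measurable_fun setT (fun s : R => complex.Re (f (cis s))).
Hypothesis mIm : measurable_fun setT (fun s : R => complex.Im (f (cis s))).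
Hypothesis e1 : {ae mu, forall s, complex.Re (f (cis s)) = w1 s}.
Hypothesis e2 : {ae mu, forall s, complex.Im (f (cis s)) = w2 s}.

Let k0 : R := 2 / (2 * pi) ^+ 2.
Let k0_gt0 : 0 < k0. Proof. by rewrite divr_gt0// exprn_gt0// twopi_gt0. Qed.

Let h (z : R[i]) : R := grad_sq (poisson f) z * (1 - cabs z ^+ 2) `^ sg.

(** An explicit formula that is measurable on the whole plane and agrees with [h] on the disc; [h]
    itself is defined through derivatives. *)
Let Hd (x y : R) : R :=
  k0 * ((PIx w1 x y ^+ 2 + PIy w1 x y ^+ 2) + (PIx w2 x y ^+ 2 + PIy w2 x y ^+ 2)) * (1 - x ^+ 2 - y ^+ 2) `^ sg.

Let Hd_ge0 x y : 0 <= Hd x y.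
Proof. by apply: mulr_ge0 (powR_ge0 _ _); rewrite mulr_ge0 ?(ltW k0_gt0)// !addr_ge0 ?sqr_ge0. Qed.

Let mHd : measurable_fun [set: R * R] (fun z => Hd z.1 z.2).
Proof.
have mw1 : measurable_fun setT w1 by exact: continuous_measurable_fun.
have mw2 : measurable_fun setT w2 by exact: continuous_measurable_fun.
have m1 := measurable_PIx mw1; have m2 := measurable_PIy mw1.
have m3 := measurable_PIx mw2; have m4 := measurable_PIy mw2.
by rewrite /Hd; measr.
Qed.

Let cabs_pt (w : R * R) : cabs (pt w) = Num.sqrt (w.1 ^+ 2 + w.2 ^+ 2).
Proof. by []. Qed.

Let disc_pt (w : R * R) : disc (pt w) -> w.1 ^+ 2 + w.2 ^+ 2 < 1.
Proof.
by move=> dw; have : cabs (pt w) < 1 := dw; rewrite cabs_pt -{1}(@sqrtr1 R) ltr_sqrt.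
Qed.

Let h_disc (w : R * R) : disc (pt w) -> h (pt w) = Hd w.1 w.2.
Proof.
move=> dw; rewrite /h /pt (grad_sq_poisson c1 c2 mRe mIm e1 e2 (disc_pt dw)) cabs_sqE/=.
by rewrite /Hd (_ : 1 - (w.1 ^+ 2 + w.2 ^+ 2) = 1 - w.1 ^+ 2 - w.2 ^+ 2)//; ring.
Qed.

Let measurable_cabs_pt : measurable_fun [set: R * R] (fun w => cabs (pt w)).
Proof. by rewrite /cabs/=; measr. Qed.

Let measurable_disc_pt : measurable (@pt R @^-1` @disc R).
Proof.
have := measurable_cabs_pt measurableT (measurable_itv `]-oo, 1[); rewrite setTI.
by congr measurable; apply/seteqP; split => w /=; rewrite in_itv.
Qed.

Let measurable_box a b x y : a < b -> b <= a + 2 * pi ->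
  measurable (@pt R @^-1` carleson_box (arc a b x y)).
Proof.
move=> ab ba.
have -> : @pt R @^-1` carleson_box (arc a b x y) =
  (@pt R @^-1` @disc R) `&` ((fun w => cabs (pt w)) @^-1` `[1 - arc_length (arc a b x y), +oo[%classic `&`
  [set w : R * R | arc a b x y (pt w / (cabs (pt w))%:C%C)]).
  apply/seteqP; split => w /=; rewrite in_itv/= andbT; first by move=> [].
  by move=> [? []].
apply: measurableI => //; apply: measurableI; last exact: measurable_arc_cone.
by rewrite -[X in measurable X]setTI; exact: measurable_cabs_pt.
Qed.

Let G (w : R -> R) (s t : R) : R := GU w (1 - t) s * weight sg t.

Let G_ge0 w s t : 0 <= G w s t.
Proof. by rewrite mulr_ge0 ?GU_ge0 ?weight_ge0. Qed.

Let mG (w : R -> R) : continuous w -> measurable_fun [set: R * R] (fun z => G w z.1 z.2).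
Proof.
move=> cw; have mw : measurable_fun setT w by exact: continuous_measurable_fun.
by have n := measurable_GU mw; have n2 := @measurable_weight R sg; rewrite /G; measr.
Qed.

(** In polar coordinates the box is the product of the arc and the radii in [[1 - r, 1[]; the radius
    is finally replaced by the depth. *)
Let sector a b x y : a < b -> b <= a + 2 * pi ->
  (\int[(mu \x mu)%E]_(w in @pt R @^-1` carleson_box (arc a b x y)) (Hd w.1 w.2)%:E =
   \int[mu]_(s in `[a, b]) \int[mu]_(t in `]0%R, ((b - a) / (2 * pi))%R]) (k0 * (G w1 s t + G w2 s t))%:E)%E.
Proof.
move=> ab ba; set I := arc a b x y; set r := (b - a) / (2 * pi).
have r1 : r <= 1 by rewrite rho_le1// lerBlDl.
pose B := @pt R @^-1` carleson_box I.
have mB : measurable B by exact: measurable_box.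
pose H u v := Hd u v * \1_B (u, v).
have H0 u v : 0 <= H u v by rewrite mulr_ge0// indicE.
have mH : measurable_fun [set: R * R] (fun z => H z.1 z.2).
  apply: measurable_funM => //.
  have -> : (fun z : R * R => \1_B (z.1, z.2) : R) = \1_B by apply/funext => -[].
  exact: measurable_indic.
have -> : (\int[(mu \x mu)%E]_(w in B) (Hd w.1 w.2)%:E = \int[(mu \x mu)%E]_w (H w.1 w.2)%:E)%E.
  rewrite integral_mkcond; apply: eq_integral => -[u v] _; rewrite patchE /H/= indicE.
  by case: ifP => _; rewrite ?mulr1 ?mulr0.
rewrite fubini_tonelli1; last 2 first.
- by apply/measurable_EFinP.
- by move=> w; rewrite lee_fin.
rewrite /fubini_F /= (polar mH H0).
pose E := @cis R @^-1` I.
have mE : measurable E by exact: measurable_arc_preimage.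
pose F s t := k0 * (GU w1 t s + GU w2 t s) * (1 - t ^+ 2) `^ sg * `|t|.
have F0 s t : 0 <= F s t.
  apply: mulr_ge0 => //.
  by apply: mulr_ge0 (powR_ge0 _ _); rewrite mulr_ge0 ?(ltW k0_gt0)// addr_ge0 ?GU_ge0.
have mF : measurable_fun [set: R * R] (fun z => F z.1 z.2).
  have mw1 : measurable_fun setT w1 by exact: continuous_measurable_fun.
  have mw2 : measurable_fun setT w2 by exact: continuous_measurable_fun.
  by have n1 := measurable_GU mw1; have n2 := measurable_GU mw2; rewrite /F; measr.
have mFs s : measurable_fun setT (fun t => (F s t)%:E).
  by apply/measurable_EFinP; exact: (measurable_section1 s mF).
have F0' s t : (0 <= (F s t)%:E)%E by rewrite lee_fin.
pose Q s := (\int[mu]_(t in `[(1 - r)%R, 1%R]) (F s t)%:E)%E.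
have Q0 s : (0 <= Q s)%E by apply: integral_ge0.
have mQ : measurable_fun setT Q by exact: measurable_dsection.
have Q2 s : Q (s + 2 * pi) = Q s by apply: eq_integral => t _; rewrite /F !GUD2pi.
have HF s t : 0 < t -> t * H (t * cos s) (t * sin s) = if [&& 1 - r <= t, t < 1 & s \in E] then F s t else 0.
  move=> t0; rewrite /H indicE.
  have -> : ((t * cos s, t * sin s) \in B) = [&& 1 - r <= t, t < 1 & s \in E].
    set z := ((t * cos s) +i* (t * sin s))%C.
    have zE : cabs z = t := cabs_scale_cis s (ltW t0).
    have zI : z / (cabs z)%:C%C = cis s := scale_cis_div s t0.
    apply/idP/idP.
      move=> /set_mem [d l i].
      have d' : cabs z < 1 := d; rewrite zE in d'.
      have l' : 1 - arc_length I <= cabs z := l; rewrite arc_lengthE// zE in l'.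
      have i' : I (z / (cabs z)%:C%C) := i; rewrite zI in i'.
      by rewrite l' d' /=; apply/mem_set.
    move=> /and3P[h1 h2 /set_mem h3]; apply/mem_set.
    have d' : cabs z < 1 by rewrite zE.
    have l' : 1 - arc_length I <= cabs z by rewrite arc_lengthE// zE.
    have i' : I (z / (cabs z)%:C%C) by rewrite zI.
    by split.
  have e : 1 - (t * cos s) ^+ 2 - (t * sin s) ^+ 2 = 1 - t ^+ 2 by rewrite -addrA -opprD polar_sq.
  case: ifP => _; rewrite ?mulr0// mulr1 /F gtr0_norm// /Hd e /GU; ring.
have step s : (\int[mu]_(t in `]0%R, +oo[) (t * H (t * cos s) (t * sin s))%:E = (Q \_ E) s)%E.
  rewrite patchE; case: ifPn => sE; last first.
    rewrite integral0_eq// => t /=; rewrite in_itv/= andbT => t0.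
    by rewrite HF// (negbTE sE) !andbF.
  have -> : (\int[mu]_(t in `]0%R, +oo[) (t * H (t * cos s) (t * sin s))%:E =
     \int[mu]_(t in `]0%R, +oo[ `&` `[(1 - r)%R, 1%R[) (F s t)%:E)%E.
    rewrite integral_mkcondr; apply: eq_integral => t; rewrite inE/= in_itv/= andbT => t0.
    rewrite HF// sE andbT patchE.
    case: ifPn => ht; first by rewrite ifT// inE/= in_itv.
    by rewrite ifF//; apply/negbTE; rewrite notin_setE/= in_itv/=; exact/negP.
  (* The two intervals of radii differ at most in their end points; for an arc of full length,
     [1 - r] is 0 and that end point is lost too. *)
  apply/eqP; rewrite eq_le; apply/andP; split.
    apply: ge0_subset_integral_nomeas => // t /= [_].
    by rewrite !in_itv/= => /andP[-> /ltW ->].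
  rewrite /Q integral_itv_bndoo; last exact: measurable_funTS.
  apply: ge0_subset_integral_nomeas => // t /=.
  by rewrite !in_itv/= andbT => /andP[h1 h2]; rewrite (ltW h1) h2; split => //; apply: le_lt_trans h1; rewrite subr_ge0.
under eq_integral do rewrite step.
have mQE : measurable_fun setT (Q \_ E).
  by apply/(measurable_restrictT _ _).1 => //; exact: measurable_funTS.
rewrite -integral_itv_bndo_bndc; last exact: measurable_funTS.
rewrite -integral_mkcondr.
have -> : `[0%R, (2 * pi)%R[%classic `&` E = params I.
  by apply/seteqP; split => s /=; rewrite in_itv.
rewrite (@integral_params R a b x y Q ab ba mQ Q0 Q2).
apply: eq_integral => s _; rewrite /Q.
have e0 : `[(1 - r)%R, 1%R]%classic = [set` Interval (BSide true (- r + 1)%R) (BSide false (0 + 1)%R)] :> set R.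
  by rewrite add0r addrC.
rewrite e0 -(@integral_itv_shift R 1 (- r) 0 true false (fun t => (F s t)%:E))//.
have mF1 : measurable_fun setT (fun t : R => (F s (t + 1))%:E).
  have n : measurable_fun setT (fun t : R => t + 1) by measr.
  exact: (measurableT_comp (mFs s) n).
have := integral_itv_opp 0 r mF1 (fun t => F0' _ _); rewrite oppr0 => ->.
rewrite -integral_itv_obnd_cbnd; last first.
  by apply: measurable_funTS; apply: (measurableT_comp mF1); exact: oppr_measurable.
by apply: eq_integral => t _; rewrite [- t + 1]addrC; congr (_%:E); rewrite /F /G /weight; ring.
Qed.

Let Pw (w : R -> R) a L := (\int[mu]_(s in `[a, (a + L)%R]) \int[mu]_(t in `]0%R, (L / (2 * pi))%R])
    (G w s t)%:E)%E.

Let Pw_ge0 (w : R -> R) a L : 0 < L -> L <= 2 * pi -> (0 <= Pw w a L)%E.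
Proof.
by move=> _ _; apply: integral_ge0 => s _; apply: integral_ge0 => t _; rewrite lee_fin.
Qed.

Let box_measure (m : {measure set (measurableTypeR R * measurableTypeR R) -> \bar R}) a b x y :
  has_density m h -> a < b -> b <= a + 2 * pi ->
  (m (@pt R @^-1` carleson_box (arc a b x y)) = (k0 / pi)%:E * (Pw w1 a (b - a)%R + Pw w2 a (b - a)%R))%E.
Proof.
move=> hm ab ba; have mB := measurable_box x y ab ba.
rewrite hm//.
have -> : @pt R @^-1` carleson_box (arc a b x y) `&` @pt R @^-1` @disc R = @pt R @^-1` carleson_box (arc a b x y).
  by apply/setIidPl => w [].
have -> : (\int[area R]_(w in @pt R @^-1` carleson_box (arc a b x y)) (h (pt w))%:E =
   \int[area R]_(w in @pt R @^-1` carleson_box (arc a b x y)) (Hd w.1 w.2)%:E)%E.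
  by apply: eq_integral => w /set_mem [dw _ _]; rewrite h_disc.
rewrite ge0_integral_mscale//; last 2 first.
- by apply: measurable_funTS; exact/measurable_EFinP.
- by move=> w _; rewrite lee_fin.
rewrite sector// /Pw (_ : a + (b - a) = b); last by rewrite addrC subrK.
rewrite -(dintegralD (measurable_itv _) (measurable_itv _) (mG c1) (G_ge0 w1) (mG c2) (G_ge0 w2)).
rewrite (dintegralZ (measurable_itv _) (measurable_itv _) (ltW k0_gt0) (fun s t => addr_ge0 (G_ge0 w1 s t) (G_ge0 w2 s t)) (measurable_funD (mG c1) (mG c2))).
by rewrite muleA -EFinM /= [pi^-1 * k0]mulrC.
Qed.

(** The density determines the mass of every box, so all measures with density [h] are Carleson or
    none is. For the converse such a measure must exist: it is built from [Hd] restricted to the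
    disc. *)
Lemma carleson_measureP :
  (exists m : {measure set (measurableTypeR R * measurableTypeR R) -> \bar R},
     has_density m h /\ is_carleson (sg + 2 * al) m) <->
  carleson_cond sg al w1 /\ carleson_cond sg al w2.
Proof.
have kp : 0 < k0 / pi by rewrite divr_gt0// pi_gt0.
have key m : has_density m h -> is_carleson (sg + 2 * al) m <-> carleson_cond sg al w1 /\ carleson_cond sg al w2.
  move=> hm.
  apply: (iff_trans _ (@bounded_byD R (sg + 2 * al) (Pw w1) (Pw w2) (@Pw_ge0 w1) (@Pw_ge0 w2))).
  apply: (sup_arcs_bounded kp) => a b x y ab ba.
  by rewrite (box_measure x y hm ab ba) arc_lengthE// -powRN muleAC -EFinM.
split; first by move=> [m [hm /(key m hm)]].
move=> cc.
pose g := (fun w : R * R => (Hd w.1 w.2)%:E) \_ (@pt R @^-1` @disc R).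
have mg : measurable_fun setT g.
  by apply/(measurable_restrictT _ _).1 => //; apply: measurable_funTS; exact/measurable_EFinP.
have g0 w : (0 <= g w)%E by rewrite /g patchE; case: ifP => // _; rewrite lee_fin.
have [m hm] := density_exists (area R) mg g0.
have hd : has_density m h.
  move=> A mA; rewrite hm /g -integral_mkcondr.
  by apply: eq_integral => w /set_mem [_ dw]; rewrite h_disc.
by exists m; split => //; apply/key.
Qed.

End carleson_conversion.

Unset Implicit Arguments.

Theorem theorem1 (R : realType) (p beta : R) (f : R[i] -> R[i])
    (p_gt0 : 0 < p) (p_lt1 : p < 1)
    (beta_gt : 1 / 2 < beta) (beta_lt1 : beta < 1)
    (pbeta : 0 < p - 2 + 2 * beta)
    (fBMO : BMO beta f) :
  let cond1 := Qspace p beta f in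
  let cond2 := translation_condition p beta f in
  let cond3 :=
    exists mu : {measure set (measurableTypeR R * measurableTypeR R) -> \bar R},
      has_density mu (fun z : R[i] =>
        grad_sq (poisson f) z * (1 - cabs z ^+ 2) `^ (p - 2 + 2 * beta)) /\
      is_carleson (p + 2 - 2 * beta) mu in
  (cond1 <-> cond2) /\ (cond2 <-> cond3) /\ (cond1 <-> cond3).
Proof.
set cond1 := Qspace _ _ _; set cond2 := translation_condition _ _ _.
move=> /=; set cond3 := (exists _, _).
have sg1 : p - 2 + 2 * beta < 1 by lra.
have al0 : 0 < 2 - 2 * beta by lra.
have al1 : 2 - 2 * beta < 1 by lra.
have [w1 [w2 [h1 h2 e1 e2]]] := BMO_holder beta_lt1 fBMO.
have [L2f _] := fBMO; have [mRe mIm _] := L2f.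
have c1 := holder_continuous al0 h1; have c2 := holder_continuous al0 h2.
have C1 := Qspace_chord p beta_lt1 h1 h2 e1 e2 mRe mIm L2f.
have C2 := translation_translation p beta_lt1 h1 h2 e1 e2 mRe mIm.
have C3 := carleson_measureP (p - 2 + 2 * beta) (2 - 2 * beta) c1 c2 mRe mIm e1 e2.
rewrite (_ : p - 2 + 2 * beta + 2 * (2 - 2 * beta) = p + 2 - 2 * beta) -/cond3 in C3; last by ring.
have ct (w : R -> R) : holder_periodic (2 - 2 * beta) w ->
    chord_cond (p - 2 + 2 * beta) (2 - 2 * beta) w <-> translation_cond (p - 2 + 2 * beta) (2 - 2 * beta) w.
  move=> hw; have mw := holder_measurable al0 hw; split; first exact: chord_translation.
  exact: translation_chord.
have tc (w : R -> R) : holder_periodic (2 - 2 * beta) w ->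
    translation_cond (p - 2 + 2 * beta) (2 - 2 * beta) w <-> carleson_cond (p - 2 + 2 * beta) (2 - 2 * beta) w.
  by move=> hw; split; [exact: translation_carleson|exact: carleson_translation].
have and_iff (A B C D : Prop) : (A <-> B) -> (C <-> D) -> (A /\ C <-> B /\ D).
  by move=> [ab ba] [cd dc]; split=> -[x1 x2]; split; auto.
have H12 : cond1 <-> cond2.
  apply: (iff_trans C1); apply: (iff_trans _ (iff_sym C2)).
  exact: and_iff (ct _ h1) (ct _ h2).
have H23 : cond2 <-> cond3.
  apply: (iff_trans C2); apply: (iff_trans _ (iff_sym C3)).
  exact: and_iff (tc _ h1) (tc _ h2).
by split=> //; split=> //; exact: iff_trans H23.
Qed.
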